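(* Consider the optimal control problem (P): minimize $\Psi(x(T))$ over all extended processes $(x,\mu,\{w^r\}_{r\in[0,h]})$ for (DIS) satisfying $\|\mu\|_{TV}\le K$ and $x(T)\in\mathcal{T}$, where $K>0$, $\mathcal{T}\subset\mathbb{R}^n$ is nonempty and $\Psi:\mathbb{R}^n\to\mathbb{R}$. Assume that $\mathcal{T}$ is closed, that $\Psi$ is lower semicontinuous, and that there exists an admissible extended process. Then there exists an optimal extended process, i.e. an admissible extended process $(\bar x,\bar\mu,\{\bar w^r\}_{r\in[0,h]})$ such that $\Psi(\bar x(T))\le\Psi(x(T))$ for every admissible extended process $(x,\mu,\{w^r\}_{r\in[0,h]})$.
   Context: **Data and standing assumptions.** $h>0$, $T>0$, $x_0\in\mathbb{R}^n$, $\xi_0\in\mathbb{R}^n$, and $f,g:\mathbb{R}^n\times\mathbb{R}^n\to\mathbb{R}^n$ are bounded $C^1$ functions; $T=Nh$ for some integer $N>0$. (DIS) denotes the delayed impulsive control system $dx(t)=f(x(t),x(t-h))\,dt+g(x(t),x(t-h))\,d\mu(t)$, $t\in[0,T]$, $x(0)=x_0$, $x(t)=\xi_0$ for $t\in[-h,0[$, whose solutions are the extended processes defined below. $C^\oplus(0,T)$ is the set of non-negative scalar Borel measures on $[0,T]$; $\|\mu\|_{TV}=\int_{[0,T]}d\mu(t)$ is the total variation; $\mu^c$ is the continuous (non-atomic) component of $\mu$; $x^-(t)=x(t^-)$ is the left limit. **Impulsive control.** An impulsive control $(\mu,\{w^r\}_{r\in[0,h]})$ comprises $\mu\in C^\oplus(0,T)$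 and a family of measurable functions $w^r=(w^r_1,\dots,w^r_N):[0,1]\to[0,+\infty[^N$, $r\in[0,h]$, such that: (i) for any $r\in[0,h]$, $\sum_{i=1}^N w^r_i(s)=\sum_{i=1}^N\int_0^1 w^r_i(s')\,ds'$ for a.e. $s\in[0,1]$; (ii) for any $r\in]0,h[$, $\int_0^1 w^r_i(s)\,ds=\mu(\{r+(i-1)h\})$ for $i=1,\dots,N$; (iii) $\int_0^1[w^h_i(s)+w^0_{i+1}(s)]\,ds=\mu(\{ih\})$ for $i=0,\dots,N$, where $w^h_0\equiv0$ and $w^0_{N+1}\equiv0$. **Extended process.** A triple $(x,\mu,\{w^r\}_{r\in[0,h]})$ is an extended process for (DIS) (with extended state trajectory $x$) if $x\in BV([-h,T];\mathbb{R}^n)$, $(\mu,\{w^r\})$ is an impulsive control, and: (i) $x(t)=\xi_0$ for $t\in[-h,0[$; (ii) for each $i=1,\dots,N$: $x((i-1)h)=x_0$ if $i=1$ and $x((i-1)h)=\zeta^0_i(1)$ if $i>1$; for $t\in](i-1)h,ih[$, $$x(t)=\zeta^0_i(1)+\int_{(i-1)h}^t f(x(t'),x(t'-h))\,dt'+\int_{[(i-1)h,t]}g(x(t'),x(t'-h))\,d\mu^c(t')+\sum_{r\in]0,t-(i-1)h]}\big(\zeta^r_i(1)-x((r+(i-1)h)^-)\big);$$ and $x(T)=\zeta^h_N(1)$. Here, for $r\in[0,h]$, $\zeta^r_1,\dots,\zeta^r_N:[0,1]\to\mathbb{R}^n$ satisfy the coupled differential equations $\frac{d}{ds}\zeta^r_i(s)=w^r_i(s)\,g(\zeta^r_i(s),\zeta^r_{i-1}(s))$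 for a.e. $s\in[0,1]$, $i=1,\dots,N$, with $\zeta^r_i(0)=x^-(r+(i-1)h)$ if $r\in]0,h]$ and $\zeta^0_i(0)=\zeta^h_{i-1}(1)$ if $r=0$, where $\zeta^r_0(s):=\xi_0$ if $s\in[0,1[$ or $r\in[0,h[$, and $\zeta^h_0(1):=x_0$. **Admissible.** An extended process is admissible if $x(T)\in\mathcal{T}$ and $\|\mu\|_{TV}\le K$. *)

(* Defs.v *)
From HB Require Import structures.
From mathcomp Require Import all_boot all_order all_algebra.
From mathcomp Require Import finmap.
From mathcomp Require Import all_classical all_reals all_analysis.
From mathcomp.analysis.showcase Require summability.

Set Implicit Arguments.
Unset Strict Implicit.
Unset Printing Implicit Defensive.

Import Order.TTheory GRing.Theory Num.Theory.
Import numFieldNormedType.Exports.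

Local Open Scope classical_set_scope.
Local Open Scope ring_scope.

Section atoms.
Context {R : realType}.
Implicit Type mu : {finite_measure set (measurableTypeR R) -> \bar R}.

Definition atoms mu : set R := [set t | (0 < mu [set t])%E].

Lemma countable_atoms mu : countable (atoms mu).
Proof.
have -> : atoms mu = \bigcup_k [set t | ((k.+1%:R^-1)%:E <= mu [set t])%E].
  apply/seteqP; split=> [t /= t0|t [k _ /=] kt]; last first.
    by rewrite /atoms/= (lt_le_trans _ kt)// lte_fin invr_gt0 ltr0n.
  have fint : mu [set t] \is a fin_num by exact: fin_num_measure.
  have m0 : (0 < fine (mu [set t])).
    by rewrite fine_gt0// t0 ltey_eq fint.
  have [k kt] := ltr_add_invr m0.
  exists k => //=; rewrite -(fineK fint) lee_fin.
  by move: kt; rewrite add0r => /ltW.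
apply: bigcup_countable => // k _; apply: finite_set_countable.
apply: contrapT => infA.
have finT : mu setT \is a fin_num by exact: fin_num_measure.
have [m mT] : exists m : nat, fine (mu setT) < m%:R * k.+1%:R^-1.
  exists (Num.truncn (fine (mu setT) * k.+1%:R)).+1.
  rewrite ltr_pdivlMr ?ltr0n//.
  exact: truncnS_gt.
have [B BA Bm] := infinite_set_fset m infA.
suff: (mu [set` B] <= mu setT)%E.
  apply/negP; rewrite -ltNge -(fineK finT).
  rewrite (@lt_le_trans _ _ (m%:R * k.+1%:R^-1)%:E)// ?lte_fin//.
  rewrite (_ : [set` B] = \big[setU/set0]_(i <- B) [set i]); last first.
    by rewrite -bigcup_fset; apply/seteqP; split=> [x /= xB|x [y /= yB ->]//]; exists x.
  rewrite measure_fbigsetU//=; last first.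
    by move=> i j _ _ [x [/= -> ->]].
  rewrite (@le_trans _ _ (\sum_(i <- B) (k.+1%:R^-1 : R)%:E)%E)//; last first.
    rewrite big_seq [leRHS]big_seq; apply: lee_sum => i iB.
    exact: (BA i).
  rewrite sumEFin lee_fin big_const_seq count_predT iter_addr_0 -[leRHS]mulr_natl.
  by rewrite ler_wpM2r ?invr_ge0// ler_nat.
rewrite le_measure// inE//; apply: countable_measurable => //.
by apply: finite_set_countable; exact: finite_fset.
Qed.

Lemma measurable_atoms mu : measurable (atoms mu : set (measurableTypeR R)).
Proof. by apply: countable_measurable (countable_atoms mu) => //. Qed.

(* The restriction of [mu] to the complement of its (countable) set of atoms. *)
Definition cont_part mu : {measure set (measurableTypeR R) -> \bar R} :=
  mrestr mu (measurableC (measurable_atoms mu)).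

End atoms.

(* For [U] finite-dimensional, which is the only use made of it, continuity of
   all the directional derivatives is continuity of the differential. *)
Definition C1 {R : realType} {U V : normedModType R} (F : U -> V) : Prop :=
  (forall z, differentiable F z) /\ (forall v, continuous (fun z => 'D_v F z)).

Definition BV_vec {R : realType} {n : nat} (a b : R) (x : R -> 'rV[R]_n) : Prop :=
  forall j, bounded_variation a b (fun t => x t ord0 j).

Definition absolutely_continuous_on {R : realType} {V : normedModType R}
    (a b : R) (z : R -> V) : Prop :=
  forall e : R, 0 < e -> exists2 d : R, 0 < d &
    forall I : seq (R * R),
      (forall p, p \in I -> a <= p.1 /\ p.1 <= p.2 /\ p.2 <= b) ->
      pairwise (fun p q => p.2 <= q.1) I ->
      \sum_(p <- I) (p.2 - p.1) < d ->
      \sum_(p <- I) `|z p.2 - z p.1| < e.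

Definition left_lim {R : realType} {V : normedModType R} (x : R -> V) (t : R) : V :=
  lim (x s @[s --> t^'-]).

Definition Rintegral_vec {R : realType} {n : nat}
    (mu : {measure set (measurableTypeR R) -> \bar R}) (A : set R)
    (F : R -> 'rV[R]_n) : 'rV[R]_n :=
  \row_j \int[mu]_(t in A) F t ord0 j.

(* Unordered sum over a possibly uncountable [A]: the limit of the finite
   partial sums along the finite subsets of [R] directed by inclusion. *)
Definition unordered_sum {R : realType} {V : normedModType R} (A : set R)
    (a : R -> V) : V :=
  summability.sum (fun r : R => if r \in A then a r else 0).

Section impulsive_systems.
Context {R : realType} {n : nat}.
Variables (N : nat) (h T : R).
Local Notation E := 'rV[R]_n.
Local Notation leb := (@lebesgue_measure R).

(* Elements of the positive cone of the dual of C([0,T]), as finite Borel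
   measures on the line carried by [0,T]; the total variation is then the mass
   of [0,T]. *)
Definition carried_by (mu : {finite_measure set (measurableTypeR R) -> \bar R}) :
    Prop :=
  mu (~` `[0, T]) = 0%E.

Definition total_var (mu : {finite_measure set (measurableTypeR R) -> \bar R}) :
    \bar R :=
  mu `[0, T]%classic.

(* [w r i s] is the paper's w^r_i(s), with r in [0,h], s in [0,1] and i in
   1, ..., N; values at other arguments are irrelevant.  [pad w] extends [w] by
   w_0 = w_(N+1) = 0. *)
Definition pad (w : R -> nat -> R -> R) (r : R) (i : nat) (s : R) : R :=
  if (1 <= i <= N)%N then w r i s else 0.

Record impulsive_control
    (mu : {finite_measure set (measurableTypeR R) -> \bar R})
    (w : R -> nat -> R -> R) : Prop := ImpulsiveControl {
  ic_carried : carried_by mu ;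
  ic_measurable : forall (r : R) i, 0 <= r <= h -> (1 <= i <= N)%N ->
    measurable_fun (`[0, 1] : set (measurableTypeR R)) (w r i) ;
  ic_ge0 : forall (r : R) i (s : R), 0 <= r <= h -> (1 <= i <= N)%N -> 0 <= s <= 1 ->
    0 <= w r i s ;
  ic_sum : forall r : R, 0 <= r <= h ->
    {ae leb, forall s : R, 0 <= s <= 1 ->
      ((\sum_(1 <= i < N.+1) w r i s)%:E =
       \sum_(1 <= i < N.+1) \int[leb]_(s' in `[0%R, 1%R]) (w r i s')%:E)%E} ;
  ic_interior : forall (r : R) i, 0 < r < h -> (1 <= i <= N)%N ->
    (\int[leb]_(s in `[0%R, 1%R]) (w r i s)%:E = mu [set (r + i.-1%:R * h)%R])%E ;
  ic_grid : forall i, (i <= N)%N ->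
    (\int[leb]_(s in `[0%R, 1%R]) (pad w h i s + pad w 0 i.+1 s)%:E
     = mu [set (i%:R * h)%R])%E
}.

Variables (x0 xi0 : E) (f g : E * E -> E).

(* [zeta r i s] is the paper's zeta^r_i(s), with r in [0,h], s in [0,1] and i in
   0, ..., N.  The solutions are in the sense of Caratheodory. *)
Record attached_family (x : R -> E) (w : R -> nat -> R -> R)
    (zeta : R -> nat -> R -> E) : Prop := AttachedFamily {
  af_initial : forall r s : R, 0 <= r <= h -> 0 <= s <= 1 ->
    zeta r 0%N s = if (s < 1) || (r < h) then xi0 else x0 ;
  af_ac : forall (r : R) i, 0 <= r <= h -> (1 <= i <= N)%N ->
    absolutely_continuous_on 0 1 (zeta r i) ;
  af_ode : forall (r : R) i, 0 <= r <= h -> (1 <= i <= N)%N ->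
    {ae leb, forall s : R, 0 <= s <= 1 ->
      is_derive s (1 : R) (zeta r i)
        (w r i s *: g (zeta r i s, zeta r i.-1 s))} ;
  af_start : forall (r : R) i, 0 < r <= h -> (1 <= i <= N)%N ->
    zeta r i 0 = left_lim x (r + i.-1%:R * h) ;
  af_start0 : forall i, (1 <= i <= N)%N -> zeta 0 i 0 = zeta h i.-1 1
}.

Record extended_process (x : R -> E)
    (mu : {finite_measure set (measurableTypeR R) -> \bar R})
    (w : R -> nat -> R -> R) : Prop := ExtendedProcess {
  ep_bv : BV_vec (- h) T x ;
  ep_control : impulsive_control mu w ;
  ep_history : forall t : R, - h <= t < 0 -> x t = xi0 ;
  ep_state : exists2 zeta : R -> nat -> R -> E, attached_family x w zeta &
    [/\ forall i, (1 <= i <= N)%N ->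
          x (i.-1%:R * h) = if i == 1%N then x0 else zeta 0 i 1,
        forall i (t : R), (1 <= i <= N)%N -> i.-1%:R * h < t < i%:R * h ->
          x t = zeta 0 i 1
            + Rintegral_vec leb `[i.-1%:R * h, t] (fun t' => f (x t', x (t' - h)))
            + Rintegral_vec (cont_part mu) `[i.-1%:R * h, t]
                (fun t' => g (x t', x (t' - h)))
            + unordered_sum `]0, t - i.-1%:R * h]
                (fun r => zeta r i 1 - left_lim x (r + i.-1%:R * h))
      & x T = zeta h N 1]
}.

Record admissible (K : R) (target : set E) (x : R -> E)
    (mu : {finite_measure set (measurableTypeR R) -> \bar R})
    (w : R -> nat -> R -> R) : Prop := Admissible {
  adm_process : extended_process x mu w ;
  adm_target : target (x T) ;
  adm_var : (total_var mu <= K%:E)%E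
}.

End impulsive_systems.

(* Main.v *)
(* Reparametrize a process by a common clock: at value S u of the clock, [th u] in
   [0, h] is the time elapsed in every window [(i-1)h, ih] simultaneously, [eta i u]
   the mass of mu spent in the i-th window, and [y i u] the state there; the jumps
   are traversed at constant [th] along the attached controls, which is why the
   delayed coupling between windows survives.  These arcs are uniformly Lipschitz
   and satisfy dy_i = f(y_i, y_(i-1)) dth + g(y_i, y_(i-1)) deta_i, a relation
   stable under pointwise limits, so by compactness a lower semicontinuous final
   cost attains its minimum over them.  Conversely an arc is the completion of a
   process: mu is the sum of the images of the deta_i under th + (i-1)h, the
   attached controls are the densities of the eta_i on the level sets of th, and
   the state equation holds because both of its sides change by the same amount,
   up to o(v - u), between two nearby parameters u < v. *)

Require Import Defs.
From HB Require Import structures.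
From mathcomp Require Import all_boot all_order all_algebra.
From mathcomp Require Import finmap.
From mathcomp Require Import all_classical all_reals all_analysis.
From mathcomp Require Import measurable_realfun.
From mathcomp.analysis.showcase Require summability.
From mathcomp Require Import ring lra.
Import Order.TTheory GRing.Theory Num.Theory.
Import numFieldNormedType.Exports.
Set Implicit Arguments.
Unset Strict Implicit.
Unset Printing Implicit Defensive.
Local Open Scope classical_set_scope.
Local Open Scope ring_scope.

(** * Local-to-global principles *)

(** Weak limits of the measures alone would not do: atoms at merging instants, in one window or in
    several at once, fuse into a single atom, and the final state depends on the order in which the
    windows received their mass. The clock keeps that order, because [th] may rest while the [eta i]
    grow. It is normalised by [th u + \sum eta i u = S * u]; for the arc of a process S is h plus
    the total variation, so that [h <= S <= h + K] and [M * (h + K)] is a Lipschitz constant of the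
    states common to all processes. An atom of mu at a grid point ih is shared between the end of
    one window and the start of the next. Each share is counted in its own window, and the two
    recombine only when mu is evaluated. The relation between [y], [th] and [eta] is written with
    constant vectors cf, cg and a tolerance e. One inequality then covers the drift, the diffuse
    part and the jumps, and no derivative of a limit is taken. In return, the attached controls have
    to be recovered as derivatives almost everywhere. *)

Lemma cousin (R : realType) (Q : R -> R -> Prop) (a b : R) : a <= b ->
  (forall x y z, a <= x -> x <= y -> y <= z -> z <= b -> Q x y -> Q y z -> Q x z) ->
  (forall t, a <= t <= b -> exists2 d, 0 < d & forall s, a <= s <= b ->
     (t - d < s <= t -> Q s t) /\ (t <= s < t + d -> Q t s)) ->
  Q a b.
Proof.
move=> ab Qtrans Qloc.
pose A := [set t | a <= t <= b /\ Q a t].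
have Aa : A a.
  split; first by rewrite lexx.
  have [|d d0 /(_ a)[|_]] := Qloc a; rewrite ?lexx//; apply.
  by rewrite ltrDl.
have ubA : ubound A b by move=> t [/andP[]].
have supA : has_sup A by split; [exists a|exists b].
have acb : a <= sup A <= b.
  by rewrite ub_le_sup//=; [apply: ge_sup => //; exists a|exists b].
have [d d0 dQ] := Qloc _ acb.
(* The left half of the local hypothesis shows that the supremum is reached; the right half then
   pushes beyond it unless it equals b. *)
have Qac : Q a (sup A).
  have [t [tab Qat] ct] := sup_adherent d0 supA.
  have tc : t <= sup A by apply: ub_le_sup; [exists b|split].
  have /andP[at_ tb] := tab; have /andP[_ cb] := acb.
  apply: (Qtrans a t) => //; apply: (dQ t tab).1.
  by rewrite ct tc.
have /andP[ac] := acb; rewrite le_eqVlt => /orP[/eqP <-//|cb].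
pose s := Num.min b (sup A + d / 2).
have cs : sup A < s by rewrite lt_min cb ltrDl divr_gt0.
have sb : s <= b by rewrite ge_min lexx.
have sab : a <= s <= b by rewrite sb (le_trans ac) ?ltW.
suff : A s by move/(ub_le_sup (ex_intro _ b ubA)); rewrite leNgt cs.
split=> //; apply: (Qtrans a (sup A)) => //; first exact: ltW.
apply: (dQ s sab).2; rewrite (ltW cs)/= (@le_lt_trans _ _ (sup A + d / 2))//.
  by rewrite ge_min lexx orbT.
by rewrite ltrD2l ltr_pdivrMr// ltr_pMr// ltrDl.
Qed.

(** Without the quotient a derivative is an estimate on increments, of the same shape as
    [arc_dynamics], and s' = s needs no exclusion. *)
Lemma is_derive1P (R : realType) (V : normedModType R) (z : R -> V) (s : R) (l : V) :
  is_derive s (1 : R) z l <->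
  (forall e, 0 < e -> exists2 d, 0 < d & forall s', `|s' - s| < d ->
     `|z s' - z s - (s' - s) *: l| <= e * `|s' - s|).
Proof.
split.
  move=> [/cvg_ex [l' zl']] lE e e0.
  have l'l : l' = l by rewrite -lE; apply/esym/cvg_lim.
  move: zl'; rewrite l'l.
  move/cvgrPdist_le => /(_ _ e0).
  move=> [d /= d0 H]; exists d => // s' s'd.
  have [->|s's] := eqVneq s' s; first by rewrite !subrr scale0r subrr !normr0 mulr0.
  have s's0 : s' - s != 0 by rewrite subr_eq0.
  have := H (s' - s); rewrite /ball_ /= sub0r normrN => /(_ s'd s's0).
  rewrite [(_ - _) *: 1](_ : _ = s' - s); last by rewrite /GRing.scale/= mulr1.
  rewrite subrK => H1.
  rewrite -[X in `|X|](_ : (s' - s) *: ((s' - s)^-1 *: (z s' - z s) - l)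
    = z s' - z s - (s' - s) *: l); last first.
    by rewrite scalerBr scalerA mulfV// scale1r.
  by rewrite normrZ mulrC ler_wpM2r// -normrN opprB.
move=> H.
have zl : (fun h : R => h^-1 *: ((z \o shift s) (h *: (1:R)) - z s)) @ (0:R)^' --> l.
  apply/cvgrPdist_le => e e0; have [d d0 dH] := H e e0.
  exists d => //= h; rewrite /ball_ /= sub0r normrN => hd h0.
  have := dH (h + s); rewrite addrK => /(_ hd) H1.
  rewrite [h *: 1](_ : _ = h); last by rewrite /GRing.scale/= mulr1.
  have -> : l - h^-1 *: (z (h + s) - z s) = - (h^-1 *: (z (h + s) - z s - h *: l)).
    by rewrite [in RHS]scalerBr scalerA mulVf// scale1r opprB.
  by rewrite normrN normrZ normfV mulrC ler_pdivrMr// normr_gt0.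
apply: DeriveDef; first by apply/cvg_ex; exists l.
exact/cvg_lim.
Qed.

Lemma measurable_intervals_union (R : realType) (I : seq (R * R)) :
  measurable [set x : measurableTypeR R | has (fun p => p.1 < x <= p.2) I].
Proof.
elim: I => [|p I IH].
  by rewrite (_ : [set _ | _] = set0)//; apply/seteqP; split.
rewrite (_ : [set _ | _] = `]p.1, p.2]%classic `|`
   [set x : measurableTypeR R | has (fun p => p.1 < x <= p.2) I]); last first.
  apply/seteqP; split=> x /=; rewrite in_itv/=.
    by move=> /orP[]; [left|right].
  by move=> [->//|->]; rewrite orbT.
exact: measurableU.
Qed.

(** Half-open intervals stay disjoint when consecutive pieces share an endpoint, as the pairwise
    condition allows. *)
Lemma sum_intervals_measure (R : realType) (I : seq (R * R)) :
  (forall p, p \in I -> p.1 <= p.2) ->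
  pairwise (fun p q => p.2 <= q.1) I ->
  ((\sum_(p <- I) (p.2 - p.1))%:E =
   @lebesgue_measure R [set x | has (fun p => (p.1 < x <= p.2)%R) I])%E.
Proof.
elim: I => [_ _|p I IH pI /=].
  by rewrite big_nil (_ : [set _ | _] = set0) ?measure0//; apply/seteqP; split.
move=> /andP[/allP pq pw].
rewrite big_cons EFinD IH//; last by move=> q qI; apply: pI; rewrite inE qI orbT.
rewrite (_ : [set x | (p.1 < x <= p.2) || _] = `]p.1, p.2]%classic `|`
   [set x | has (fun p => p.1 < x <= p.2) I]); last first.
  apply/seteqP; split=> x /=; rewrite in_itv/=.
    by move=> /orP[]; [left|right].
  by move=> [->//|->]; rewrite orbT.
rewrite measureU//=.
- congr (_ + _)%E; rewrite lebesgue_measure_itv/= lte_fin.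
  have := pI p; rewrite inE eqxx => /(_ isT); rewrite le_eqVlt => /orP[/eqP ->|->//].
  by rewrite ltxx subrr.
- exact: measurable_intervals_union.
- apply/seteqP; split=> // x /= [].
  rewrite in_itv/= => /andP[_ xp] /hasP[q qI /andP[qx _]].
  by have := lt_le_trans qx (le_trans xp (pq q qI)); rewrite ltxx.
Qed.

(** Around a point of the exceptional null set, intervals lie in an open set U of small measure,
    where absolute continuity makes the variation of z small; around any other point the derivative
    bounds the slope by e. [cousin] joins the two kinds of intervals. *)
Lemma ac_nonincreasing (R : realType) (a b : R) (z : R -> R) :
  a <= b -> absolutely_continuous_on (V := R^o) a b z ->
  {ae @lebesgue_measure R, forall s, a <= s <= b ->
    exists2 l : R, l <= 0 & is_derive s (1 : R) z l} ->
  z b <= z a.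
Proof.
move=> ab acz [E [mE E0 badE]].
apply/ler_addgt0Pr => e0 e00.
(* The ordinary intervals cost [e * (b - a)] and those inside U cost e, together at most e0. *)
pose e := e0 / (b - a + 2).
have e_gt0 : 0 < e by rewrite divr_gt0// ltr_wpDl// subr_ge0.
suff : z b - z a <= e * (b - a) + e.
  rewrite lerBlDl => /le_trans; apply; rewrite lerD2l.
  have -> : e * (b - a) + e = e * (b - a + 1) by ring.
  rewrite /e mulrAC ler_pdivrMr; last by rewrite ltr_wpDl// subr_ge0.
  by rewrite ler_wpM2l ?(ltW e00)// lerD2l ler1n.
have [d d0 dP] := acz e e_gt0.
have Ely : (@lebesgue_measure R E < +oo)%E by rewrite E0 ltry.
have [U [oU EU UE]] := lebesgue_regularity_outer mE Ely d0.
have mU : measurable (U : set (measurableTypeR R)).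
  exact: (@measurable_realfun.open_measurable R).
have Ud : (@lebesgue_measure R U < d%:E)%E.
  rewrite (le_lt_trans _ UE)//.
  rewrite -[X in (_ X <= _)%E](setDUK EU).
  rewrite (le_trans (measureU2 _ _ _))//; first exact: measurableD.
  by move: E0 => /= E0; rewrite (_ : lebesgue_measure E = 0%E) ?add0e//.
(* I lists only the intervals chosen at exceptional points; all others are absorbed in the term
   [e * (y - x)]. *)
pose good (x y : R) (I : seq (R * R)) :=
  [/\ forall p, p \in I -> [/\ x <= p.1, p.1 <= p.2, p.2 <= y & (`[p.1, p.2]%classic `<=` U)],
      pairwise (fun p q => p.2 <= q.1) I
    & z y - z x <= e * (y - x) + \sum_(p <- I) `|z p.2 - z p.1|].
suff [I [I1 I2 I3]] : exists I, good a b I.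
  apply: (le_trans I3); rewrite lerD2l ltW//; apply: dP => //.
    by move=> p /I1[].
  rewrite -lte_fin (le_lt_trans _ Ud)// sum_intervals_measure//; last first.
    by move=> p /I1[].
  apply: le_measure; rewrite ?inE//; first exact: measurable_intervals_union.
  move=> x /= /hasP[p /I1[_ _ _ pU] /andP[px xp]]; apply: pU => /=.
  by rewrite in_itv/= (ltW px).
apply: (cousin (Q := fun x y => exists I, good x y I) ab).
  move=> x y w ax xy yw wb [I [I1 I2 I3]] [J [J1 J2 J3]].
  exists (I ++ J); split.
  - move=> p; rewrite mem_cat => /orP[/I1[xp p12 py pU]|/J1[yp p12 pw pU]]; split=> //.
      exact: le_trans yw.
    exact: le_trans yp.
  - rewrite pairwise_cat I2 J2 !andbT; apply/allrelP => p q /I1[_ _ py _] /J1[yq _ _ _].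
    exact: le_trans yq.
  - rewrite big_cat/=.
    have -> : z w - z x = (z y - z x) + (z w - z y) by ring.
    rewrite (le_trans (lerD I3 J3))//.
    by rewrite le_eqVlt; apply/orP; left; apply/eqP; ring.
move=> t tab.
have [tE|tE] := pselect (E t).
  have /nbhs_ballP[r /= r0 rU] : nbhs t U by apply: open_nbhs_nbhs; split=> //; exact: EU.
  exists r => // s sab; split.
    move=> /andP[ts st]; exists [:: (s, t)]; split.
    - move=> p; rewrite inE => /eqP -> /=; split=> // x /=; rewrite in_itv/= => /andP[sx xt].
      by apply: rU; rewrite /ball/= ger0_norm ?subr_ge0//; lra.
    - by [].
    - rewrite big_seq1/= ler_wpDl ?ler_norm// mulr_ge0// ?(ltW e_gt0)//; lra.
  move=> /andP[ts st]; exists [:: (t, s)]; split.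
  - move=> p; rewrite inE => /eqP -> /=; split=> // x /=; rewrite in_itv/= => /andP[sx xt].
    by apply: rU; rewrite /ball/= ler0_norm ?subr_le0//; lra.
  - by [].
  - rewrite big_seq1/= ler_wpDl ?ler_norm// mulr_ge0// ?(ltW e_gt0)//; lra.
have [l l0 /is_derive1P/(_ _ e_gt0)[r r0 rP]] :
    exists2 l : R, l <= 0 & is_derive t (1 : R) z l.
  apply: contrapT => H; apply: tE; apply: badE => /= H1; exact: (H (H1 tab)).
exists r => // s sab; split.
  move=> /andP[ts st]; exists [::]; split=> //; rewrite big_nil addr0.
  have := rP s; rewrite ler0_norm ?subr_le0//.
  have -> : - (s - t) < r by lra.
  move=> /(_ isT); rewrite ler_norml => /andP[H _]; move: H.
  rewrite /GRing.scale/= => H.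
  have : 0 <= (s - t) * l by rewrite mulr_le0// subr_le0.
  by lra.
move=> /andP[ts st]; exists [::]; split=> //; rewrite big_nil addr0.
have := rP s; rewrite ger0_norm ?subr_ge0//.
have -> : s - t < r by lra.
move=> /(_ isT); rewrite ler_norml => /andP[_ H]; move: H.
rewrite /GRing.scale/= => H.
have : (s - t) * l <= 0 by rewrite mulr_ge0_le0// subr_ge0.
by lra.
Qed.

(** * Primitives and densities *)

(** The cut-off outside [0, 1] makes the integrand integrable on the whole line, so that the theorem
    on differentiation of integrals applies. *)
Definition primitive01 (R : realType) (w : R -> R) (s : R) : R :=
  \int[@lebesgue_measure R]_(t in `[0, s]) (w \_ `[0, 1]) t.

Lemma ae_neq (R : realType) (c : R) : {ae @lebesgue_measure R, forall u : R, u != c}.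
Proof.
exists [set c]; split=> //; first exact: lebesgue_measure_set1.
by move=> u /= /negP; rewrite negbK => /eqP.
Qed.

Section primitive01.
Context (R : realType) (w : R -> R).
Local Notation leb := (@lebesgue_measure R).
Hypothesis mw : measurable_fun (`[0, 1] : set (measurableTypeR R)) w.
Hypothesis w0 : forall s : R, 0 <= s <= 1 -> 0 <= w s.
Hypothesis wfin : (\int[leb]_(s in `[0%R, 1%R]) (w s)%:E < +oo)%E.

Lemma integrable_unit : leb.-integrable `[0, 1] (EFin \o w).
Proof.
apply/integrableP; split; first exact/measurable_EFinP.
apply: le_lt_trans wfin; rewrite le_eqVlt; apply/orP; left; apply/eqP; apply: eq_integral => x.
by rewrite inE/= in_itv/= => /w0 ?; rewrite ger0_norm.
Qed.

Lemma integrable_unit_patch (D : set R) : measurable (D : set (measurableTypeR R)) ->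
  leb.-integrable D (EFin \o (w \_ `[0, 1])).
Proof.
move=> mD; apply: (integrableS measurableT) => //.
rewrite -restrict_EFin; apply/(integrable_mkcond _ _).1 => //.
exact: integrable_unit.
Qed.

Lemma primitive01_0 : primitive01 w 0 = 0.
Proof. by rewrite /primitive01 set_itv1 Rintegral_set1. Qed.

Lemma primitive01B s t : 0 <= s -> s <= t -> t <= 1 ->
  primitive01 w t - primitive01 w s = \int[leb]_(u in `]s, t]) w u.
Proof.
move=> s0 st t1; rewrite /primitive01 Rintegral_itvB ?bnd_simp//; last first.
  exact: integrable_unit_patch.
apply: eq_Rintegral => u; rewrite inE/= in_itv/= => /andP[su ut].
by rewrite patchE mem_set//= in_itv/= (le_trans s0 (ltW su))/= (le_trans ut).
Qed.

Lemma primitive01_1 : (\int[leb]_(s in `[0%R, 1%R]) (w s)%:E)%E = (primitive01 w 1)%:E.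
Proof.
rewrite /primitive01 /Rintegral fineK; last first.
  by apply: integrable_fin_num => //; exact: integrable_unit_patch.
apply: eq_integral => u; rewrite inE/= => u01.
by rewrite patchE mem_set.
Qed.

Lemma primitive01_nondecreasing s t : 0 <= s -> s <= t -> t <= 1 ->
  primitive01 w s <= primitive01 w t.
Proof.
move=> s0 st t1; rewrite -subr_ge0 primitive01B//; apply: Rintegral_ge0 => u.
rewrite /= in_itv/= => /andP[su ut]; apply: w0.
by rewrite (le_trans s0 (ltW su))/= (le_trans ut).
Qed.

Lemma primitive01_lipschitz (m : R) : {ae leb, forall s : R, 0 <= s <= 1 -> w s <= m} ->
  forall s t, 0 <= s -> s <= t -> t <= 1 ->
  primitive01 w t - primitive01 w s <= m * (t - s).
Proof.
move=> wm s t s0 st t1; rewrite primitive01B//.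
have sub : `]s, t]%classic `<=` `[0, 1]%classic.
  move=> u /=; rewrite !in_itv/= => /andP[su ut].
  by rewrite (le_trans s0 (ltW su))/= (le_trans ut).
rewrite -lee_fin /Rintegral fineK; last first.
  apply: integrable_fin_num => //.
  by apply: integrableS integrable_unit.
have -> : ((m * (t - s))%:E = \int[leb]_(u in `]s, t]) m%:E)%E.
  rewrite integral_cst//= lebesgue_measure_itv/= lte_fin EFinM.
  by move: st; rewrite le_eqVlt => /orP[/eqP ->|->//]; rewrite ltxx subrr.
(* A negative m contradicts [0 <= w] on any interval of positive length, so that s = t in that
   case. *)
have [m0|m0] := leP 0 m; last first.
  move: st; rewrite le_eqVlt => /orP[/eqP ->|st].
    by rewrite set_itvoc0 !integral_set0.
  exfalso.
  have [N [mN N0 badN]] := wm.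
  have : (leb `]s, t] <= leb N)%E.
    apply: le_measure; rewrite ?inE// => u su; apply: badN => /= H.
    have u01 : 0 <= u <= 1 by have := sub _ su; rewrite /= in_itv.
    by have := lt_le_trans m0 (le_trans (w0 u01) (H u01)); rewrite ltxx.
  rewrite lebesgue_measure_itv/= lte_fin st.
  move: N0 => /= N0; rewrite (_ : lebesgue_measure N = 0%E)// -EFinB lee_fin.
  by rewrite leNgt subr_gt0 st.
apply: ae_ge0_le_integral => //.
- by move=> u /sub /=; rewrite in_itv/= lee_fin => /w0.
- by apply/measurable_EFinP; apply: measurable_funS mw.
- have F : Filter (almost_everywhere leb) by exact: (ae_filter_ringOfSetsType leb).
  apply: filterS wm => u um /sub; rewrite /= in_itv/= => u01.
  by rewrite lee_fin um.
Qed.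

Lemma primitive01_is_derive :
  {ae leb, forall s : R, 0 <= s <= 1 -> is_derive s (1 : R) (primitive01 w) (w s)}.
Proof.
have loc : locally_integrable [set: R] (w \_ `[0, 1]).
  by apply: open_integrable_locally; [exact: openT|exact: integrable_unit_patch].
have F : Filter (almost_everywhere leb) by exact: (ae_filter_ringOfSetsType leb).
have n0 := ae_neq (0 : R).
have := @FTC1 R (w \_ `[0, 1]) (BLeft 0)
  (fun y => integrable_unit_patch (measurable_itv _)) loc.
apply: filterS2 n0 => s sn0 + s01; have /andP[s0 s1] := s01.
rewrite lte_fin lt_neqAle eq_sym sn0 s0 => /(_ isT)[dW]; rewrite derive1E => DW.
apply: DeriveDef => //.
by rewrite [LHS]DW patchE mem_set.
Qed.

End primitive01.

(** Absolute continuity is transferred through increments. This is how it reaches the coordinates of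
    a vector arc and its combinations with a Lipschitz primitive. *)
Lemma ac_dominated (R : realType) (V V' : normedModType R) (a b C : R)
    (z : R -> V) (u : R -> V') :
  absolutely_continuous_on a b z ->
  (forall s t, a <= s -> s <= t -> t <= b ->
     `|u t - u s| <= `|z t - z s| + C * (t - s)) ->
  absolutely_continuous_on a b u.
Proof.
move=> acz uz e e0.
have e20 : 0 < e / 2 by rewrite divr_gt0.
have [d d0 dP] := acz _ e20.
have C0 : 0 < `|C| + 1 by rewrite ltr_wpDl.
pose d' := Num.min d (e / 2 / (`|C| + 1)).
have d'0 : 0 < d' by rewrite lt_min d0 divr_gt0.
exists d' => // I Iab Ipw Id.
apply: (@le_lt_trans _ _ (\sum_(p <- I) (`|z p.2 - z p.1| + C * (p.2 - p.1)))).
  rewrite big_seq [leRHS]big_seq; apply: ler_sum => p /Iab[? [? ?]]; exact: uz.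
rewrite big_split/= -mulr_sumr [ltRHS]splitr ltr_leD//.
  by apply: dP => //; rewrite (lt_le_trans Id)// ge_min lexx.
have S0 : 0 <= \sum_(p <- I) (p.2 - p.1).
  by rewrite big_seq sumr_ge0// => p /Iab[? [? ?]]; rewrite subr_ge0.
rewrite (@le_trans _ _ ((`|C| + 1) * \sum_(p <- I) (p.2 - p.1)))//.
  by rewrite ler_wpM2r// (le_trans (ler_norm C))// lerDl.
rewrite mulrC -ler_pdivlMr// (le_trans (ltW Id))//.
by rewrite ge_min lexx orbT.
Qed.

Lemma lipschitz_ac (R : realType) (V : normedModType R) (a b C : R) (u : R -> V) :
  (forall s t, a <= s -> s <= t -> t <= b -> `|u t - u s| <= C * (t - s)) ->
  absolutely_continuous_on a b u.
Proof.
move=> uC; apply: (@ac_dominated _ R^o _ _ _ C (cst 0)).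
  by move=> e e0; exists 1 => // I _ _ _; rewrite big1// => p _; rewrite subrr normr0.
by move=> s t *; rewrite subrr normr0 add0r uC.
Qed.

Lemma ac_sub (R : realType) (V : normedModType R) (a b a' b' : R) (u : R -> V) :
  a <= a' -> b' <= b ->
  absolutely_continuous_on a b u -> absolutely_continuous_on a' b' u.
Proof.
move=> aa' b'b acu e e0; have [d d0 dP] := acu e e0; exists d => // I Iab.
apply: dP => p /Iab[? [? ?]]; split; first exact: le_trans aa' _.
by split=> //; exact: le_trans b'b.
Qed.

Section jump.
Context (R : realType) (w z G : R -> R) (m : R).
Local Notation leb := (@lebesgue_measure R).
Hypothesis mw : measurable_fun (`[0, 1] : set (measurableTypeR R)) w.
Hypothesis w0 : forall s : R, 0 <= s <= 1 -> 0 <= w s.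
Hypothesis wfin : (\int[leb]_(s in `[0%R, 1%R]) (w s)%:E < +oo)%E.
Hypothesis wm : {ae leb, forall s : R, 0 <= s <= 1 -> w s <= m}.
Hypothesis acz : absolutely_continuous_on (V := R^o) 0 1 z.
Hypothesis dz : {ae leb, forall s : R, 0 <= s <= 1 ->
  is_derive s (1 : R) z (w s * G s)}.

(** The derivative of [b * z + k * primitive01 w] is [w * (b * G + k)] almost everywhere, hence
    nonpositive. The choices (1, - c - e) and (-1, c - e) of (b, k) give the two sides of
    [jump_estimate]. *)
Let half (b k s t : R) : 0 <= s -> s <= t -> t <= 1 -> `|b| <= 1 ->
  (forall u, s <= u <= t -> u < 1 -> b * G u + k <= 0) ->
  b * (z t - z s) + k * (primitive01 w t - primitive01 w s) <= 0.
Proof.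
move=> s0 st t1 b1 H.
suff : b * z t + k * primitive01 w t <= b * z s + k * primitive01 w s by lra.
apply: (ac_nonincreasing (z := fun u => b * z u + k * primitive01 w u) st).
  apply: (@ac_dominated _ R^o _ _ _ (`|k| * m) z).
    by apply: ac_sub acz.
  move=> u v su uv vt.
  have u0 := le_trans s0 su; have v1 := le_trans vt t1.
  have -> : b * z v + k * primitive01 w v - (b * z u + k * primitive01 w u) =
    b * (z v - z u) + k * (primitive01 w v - primitive01 w u) by ring.
  rewrite (le_trans (ler_normD _ _))// !normrM lerD//.
    by rewrite -[leRHS]mul1r ler_wpM2r.
  rewrite -mulrA ler_wpM2l// ger0_norm; last first.
    by rewrite subr_ge0 primitive01_nondecreasing.
  exact: primitive01_lipschitz.
have d1 := primitive01_is_derive mw w0 wfin.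
have n1 := ae_neq (1 : R).
have F : Filter (almost_everywhere leb) by exact: (ae_filter_ringOfSetsType leb).
near=> u.
move=> sut; have /andP[su ut] := sut.
have u01 : 0 <= u <= 1 by rewrite (le_trans s0 su) (le_trans ut t1).
have u1 : u < 1 by rewrite lt_neqAle (proj2 (andP u01)) andbT; near: u.
have Dz : is_derive u (1 : R) z (w u * G u) by move: u01; near: u.
have Dw : is_derive u (1 : R) (primitive01 w) (w u) by move: u01; near: u.
exists (b * (w u * G u) + k * w u).
  have -> : b * (w u * G u) + k * w u = w u * (b * G u + k) by ring.
  by rewrite mulr_ge0_le0 ?w0// H.
have := is_deriveD (is_deriveZ b Dz) (is_deriveZ k Dw).
by rewrite /GRing.scale/=.
Unshelve. all: by end_near. Qed.

(** Monotonicity replaces integration of z' = w G. The value of G at 1 is left free because, along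
    the jump at r = h, the history takes the value x0 there instead of xi0. *)
Lemma jump_estimate (c e s t : R) : 0 <= s -> s <= t -> t <= 1 ->
  (forall u, s <= u <= t -> u < 1 -> `|G u - c| <= e) ->
  `|z t - z s - c * (primitive01 w t - primitive01 w s)| <=
    e * (primitive01 w t - primitive01 w s).
Proof.
move=> s0 st t1 H.
have H1 := @half 1 (- c - e) s t s0 st t1; rewrite normr1 lexx in H1.
have H2 := @half (-1) (c - e) s t s0 st t1; rewrite normrN1 lexx in H2.
have {}H1 := H1 isT; have {}H2 := H2 isT.
rewrite ler_norml; apply/andP; split.
  suff : -1 * (z t - z s) + (c - e) * (primitive01 w t - primitive01 w s) <= 0 by lra.
  by apply: H2 => u ust u1; have := H u ust u1; rewrite ler_norml => /andP[]; lra.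
suff : 1 * (z t - z s) + (- c - e) * (primitive01 w t - primitive01 w s) <= 0 by lra.
by apply: H1 => u ust u1; have := H u ust u1; rewrite ler_norml => /andP[]; lra.
Qed.

End jump.

(** * Measures and densities attached to monotone Lipschitz functions *)

Section to_finite_measure.
Context d (T : measurableType d) (R : realType) (m : {measure set T -> \bar R}).

(** A copy of m indexed by the proof of its finiteness, so that the structure of finite measure can
    be declared on it. *)
Definition finite_copy (_ : fin_num_fun m) : set T -> \bar R := m.

Context (fin : fin_num_fun m).

HB.instance Definition _ := Measure.copy (finite_copy fin) m.
HB.instance Definition _ :=
  Measure_isFinite.Build d T R (finite_copy fin) fin.

Lemma to_finite_measure :
  exists m' : {finite_measure set T -> \bar R}, forall A, m' A = m A.
Proof. by exists (finite_copy fin). Qed.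

End to_finite_measure.

Lemma finite_measure_of_setT d (T : measurableType d) (R : realType)
    (m : {measure set T -> \bar R}) :
  (m setT < +oo)%E ->
  exists m' : {finite_measure set T -> \bar R}, forall A, m' A = m A.
Proof.
move=> mT; apply: to_finite_measure => A mA.
rewrite ge0_fin_numE// (le_lt_trans _ mT)//.
by apply: le_measure; rewrite ?inE.
Qed.

(** The uniqueness clause serves to identify sums and multiples of such measures through their
    distribution functions. *)
Lemma stieltjes_measure_exists (R : realType) (C : R) (phi : R -> R) :
  {homo phi : s t / s <= t} ->
  (forall s t, s <= t -> phi t - phi s <= C * (t - s)) ->
  exists nu : {measure set (measurableTypeR R) -> \bar R},
    (forall a b, a <= b -> nu `]a, b]%classic = (phi b - phi a)%:E) /\
    (forall m : {measure set (measurableTypeR R) -> \bar R},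
      (forall a b, a <= b -> m `]a, b]%classic = (phi b - phi a)%:E) ->
      forall A, measurable A -> nu A = m A).
Proof.
move=> nd lip.
have rc : right_continuous phi.
  move=> x; apply/cvgrPdist_lt => e e0.
  have C0 : 0 < `|C| + 1 by rewrite ltr_wpDl.
  have d0 : 0 < e / (`|C| + 1) by rewrite divr_gt0.
  exists (e / (`|C| + 1)) => //= y xy yx.
  rewrite distrC ger0_norm ?subr_ge0 ?nd ?ltW//.
  apply: (le_lt_trans (lip _ _ (ltW yx))).
  rewrite (@le_lt_trans _ _ ((`|C| + 1) * (y - x)))//.
    apply: ler_wpM2r; first by rewrite subr_ge0 ltW.
    by rewrite (le_trans (ler_norm C))// lerDl.
  rewrite mulrC -ltr_pdivlMr//.
  by move: xy; rewrite /ball_/= distrC ger0_norm// subr_ge0 ltW.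
pose F : cumulative R R := HB.pack phi (isCumulative.Build R _ R phi nd rc).
have FE a b : a <= b -> lebesgue_stieltjes_measure F `]a, b]%classic = (phi b - phi a)%:E.
  move=> ab; rewrite /lebesgue_stieltjes_measure /measure_extension.
  rewrite measurable_mu_extE/=; last exact: is_ocitv.
  by rewrite wlength_itv_bnd.
exists (lebesgue_stieltjes_measure F); split=> // m mE A mA.
apply: lebesgue_stieltjes_measure_unique => // _ [[a b] _ <-]/=.
have [ab|ba] := leP a b; first by rewrite mE// FE.
by rewrite set_itv_ge ?measure0// bnd_simp -leNgt ltW.
Qed.

Lemma lipschitz_measure (R : realType) (C : R) (phi : R -> R) :
  {homo phi : s t / s <= t} ->
  (forall s t, s <= t -> phi t - phi s <= C * (t - s)) ->
  (forall s, s <= 0 -> phi s = phi 0) -> (forall s, 1 <= s -> phi s = phi 1) ->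
  exists nu : {finite_measure set (measurableTypeR R) -> \bar R},
    [/\ forall a b, a <= b -> nu `]a, b]%classic = (phi b - phi a)%:E,
        nu setT = (phi 1 - phi 0)%:E &
        nu `<< @lebesgue_measure R].
Proof.
move=> nd lip ph0 ph1.
have C0 : 0 <= C.
  have := lip 0 1 ler01; rewrite subr0 mulr1; apply: le_trans.
  by rewrite subr_ge0 nd.
have [nu [nuE nuU]] := stieltjes_measure_exists nd lip.
have nuT : nu setT = (phi 1 - phi 0)%:E.
  rewrite -(bigcup_itvT false false).
  pose I n : set R := `]- (n%:R), n%:R]%classic.
  have h1 : (nu \o I) n @[n --> \oo] --> nu (\bigcup_n I n).
    apply: nondecreasing_cvg_mu; rewrite /I//; first exact: bigcup_measurable.
    by move=> *; apply/subsetPset/subset_itv; rewrite leBSide/= ?lerN2 ler_nat.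
  have h2 : (nu \o I) n @[n --> \oo] --> (phi 1 - phi 0)%:E.
    apply: cvg_near_cst; exists 1%N => // n /= n1.
    rewrite /I nuE ?ge0_cp// ph1 ?ler1n//.
    by rewrite (ph0 (- n%:R))// oppr_le0.
  exact: (cvg_unique _ h1 h2).
have nuac : nu `<< @lebesgue_measure R.
  (* The Lipschitz bound makes psi nondecreasing. By uniqueness its measure plus nu is C times the
     Lebesgue measure, so Lebesgue null sets are null for nu. *)
  pose psi t := C * t - phi t.
  have ndp : {homo psi : s t / s <= t}.
    by move=> s t st; have := lip _ _ st; rewrite /psi; lra.
  have lipp s t : s <= t -> psi t - psi s <= C * (t - s).
    by move=> st; have := nd _ _ st; rewrite /psi; lra.
  have ndC : {homo (fun t : R => C * t) : s t / s <= t} by move=> s t; exact: ler_wpM2l.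
  have lipC s t : s <= t -> C * t - C * s <= C * (t - s) by move=> _; rewrite mulrBr.
  have [nup [nupE _]] := stieltjes_measure_exists ndp lipp.
  have [nuC [nuCE nuCU]] := stieltjes_measure_exists ndC lipC.
  have e1 A : measurable A -> nuC A = (nu A + nup A)%E.
    move=> mA; rewrite (nuCU (measure_add nu nup))//; last first.
      move=> a b ab; rewrite [LHS]measure_addE nuE// nupE// -EFinD; congr EFin.
      by rewrite /psi; ring.
    by rewrite [LHS]measure_addE.
  have e2 A : measurable A -> nuC A = (C%:E * @lebesgue_measure R A)%E.
    move=> mA; rewrite (nuCU (mscale (NngNum C0) (@lebesgue_measure R)))// => a b ab.
    rewrite [LHS](_ : _ = C%:E * @lebesgue_measure R `]a, b]%classic)%E//.
    rewrite lebesgue_measure_itv/= lte_fin.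
    move: ab; rewrite le_eqVlt => /orP[/eqP ->|ab]; first by rewrite ltxx mule0 subrr.
    by rewrite ab -EFinB -EFinM mulrBr.
  move=> A nA B mB BA.
  have lB : @lebesgue_measure R B = 0%E by exact: nA.
  have := e2 B mB; rewrite lB mule0 e1// => /eqP.
  by rewrite padde_eq0// => /andP[/eqP].
have [nu' nu'E] : exists nu' : {finite_measure set (measurableTypeR R) -> \bar R},
    forall A, nu' A = nu A.
  by apply: finite_measure_of_setT; rewrite nuT ltry.
exists nu'; split.
- by move=> a b ab; rewrite nu'E nuE.
- by rewrite nu'E.
- by move=> A /nuac nA B mB BA; rewrite nu'E; exact: nA.
Qed.

(** The Radon-Nikodym density represents the increments of phi, and differentiation of its primitive
    identifies it with the derivative of phi. Unlike that derivative, it is defined and nonnegative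
    everywhere, as a control must be. *)
Lemma lipschitz_density (R : realType) (C : R) (phi : R -> R) :
  {homo phi : s t / s <= t} ->
  (forall s t, s <= t -> phi t - phi s <= C * (t - s)) ->
  (forall s, s <= 0 -> phi s = phi 0) -> (forall s, 1 <= s -> phi s = phi 1) ->
  exists w : R -> R,
    [/\ measurable_fun (setT : set (measurableTypeR R)) w,
        forall s, 0 <= w s,
        (\int[@lebesgue_measure R]_(s in `[0%R, 1%R]) (w s)%:E = (phi 1 - phi 0)%:E)%E &
        {ae @lebesgue_measure R, forall s : R, 0 <= s <= 1 ->
          is_derive s (1 : R) phi (w s)}].
Proof.
move=> nd lip ph0 ph1.
have [nu [nuE nuT nuac]] := lipschitz_measure nd lip ph0 ph1.
have [g [g0 gfin gint gE]] := radon_nikodym_sigma_finite nuac.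
pose w := fine \o g.
have wE s : (w s)%:E = g s by rewrite /w/= fineK.
have mw : measurable_fun (setT : set (measurableTypeR R)) w.
  by apply: measurableT_comp => //; exact: measurable_int gint.
have w0 s : 0 <= w s by rewrite /w/= fine_ge0.
have wint a b : a <= b ->
    (\int[@lebesgue_measure R]_(s in `]a, b]) (w s)%:E)%E = (phi b - phi a)%:E.
  move=> ab; rewrite -nuE// gE//; apply: eq_integral => s _; exact: wE.
have w01 : (\int[@lebesgue_measure R]_(s in `[0%R, 1%R]) (w s)%:E = (phi 1 - phi 0)%:E)%E.
  rewrite -wint// integral_itv_obnd_cbnd//.
  by apply: measurable_funTS; exact/measurable_EFinP.
have mw01 : measurable_fun (`[0, 1] : set (measurableTypeR R)) w by exact: measurable_funTS.
have wfin : (\int[@lebesgue_measure R]_(s in `[0%R, 1%R]) (w s)%:E < +oo)%E.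
  by rewrite w01 ltry.
exists w; split => //.
have d1 := primitive01_is_derive mw01 (fun s _ => w0 s) wfin.
have F : Filter (almost_everywhere (@lebesgue_measure R)).
  exact: (ae_filter_ringOfSetsType (@lebesgue_measure R)).
move: (ae_neq (0 : R)) (ae_neq (1 : R)) d1; apply: filterS3 => s s0 s1 ds s01.
have /andP[s0' s1'] := s01.
have sgt0 : 0 < s by rewrite lt_neqAle eq_sym s0.
have slt1 : s < 1 by rewrite lt_neqAle s1.
have pE t : 0 <= t <= 1 -> primitive01 w t = phi t - phi 0.
  move=> /andP[t0 t1]; have := primitive01B mw01 (fun s _ => w0 s) wfin (lexx 0) t0 t1.
  by rewrite primitive01_0 subr0 => ->; rewrite /Rintegral wint.
apply/is_derive1P => e e0; have [d d0 dP] := (is_derive1P _ _ _).1 (ds s01) e e0.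
(* The radius keeps s' in [0, 1], where [pE] exchanges phi and the primitive. *)
exists (Num.min d (Num.min s (1 - s))); first by rewrite !lt_min d0 sgt0 subr_gt0.
move=> s'; rewrite !lt_min => /and3P[/dP + s's s's1].
have s'01 : 0 <= s' <= 1.
  by move: s's s's1; rewrite !ltr_norml => /andP[? ?] /andP[? ?]; apply/andP; split; lra.
by rewrite pE// pE// opprB addrA subrK.
Qed.

(** * Integrals, atoms and jump sums *)

Section nonatomic_integral.
Context (R : realType) (nu : {measure set (measurableTypeR R) -> \bar R}).
Context (p q M : R) (F : R -> R).
Hypothesis nu_na : forall x, nu [set x] = 0%E.
Hypothesis nu_fin : (nu `]p, q[%classic < +oo)%E.
Hypothesis mF : measurable_fun (`]p, q[ : set (measurableTypeR R)) F.
Hypothesis F_bd : forall t, p < t < q -> `|F t| <= M.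

Lemma na_sub_fin a b : p <= a -> b <= q -> nu `]a, b[%classic \is a fin_num.
Proof.
move=> pa bq; rewrite ge0_fin_numE// (le_lt_trans _ nu_fin)//.
apply: le_measure; rewrite ?inE//.
by apply: subset_itv; rewrite bnd_simp.
Qed.

Lemma na_integrable a b : p <= a -> b <= q ->
  nu.-integrable `]a, b[ (EFin \o F).
Proof.
move=> pa bq; apply: measurable_bounded_integrable => //.
- by rewrite -ge0_fin_numE// na_sub_fin.
- by apply: measurable_funS mF => //; apply: subset_itv; rewrite bnd_simp.
- exists M; split; first exact: num_real.
  move=> K MK t /=; rewrite in_itv/= => /andP[at_ tb].
  rewrite (le_trans (F_bd _)) ?(ltW MK)//.
  by rewrite (le_lt_trans pa)// (lt_le_trans tb).
Qed.

Lemma na_integral_estimate a b k e : p <= a -> b <= q ->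
  (forall t, a < t < b -> `|F t - k| <= e) ->
  `|\int[nu]_(t in `]a, b[) F t - k * fine (nu `]a, b[%classic)|
    <= e * fine (nu `]a, b[%classic).
Proof.
move=> pa bq Fk.
have fn := na_sub_fin pa bq.
have cint (c : R) : nu.-integrable `]a, b[ (EFin \o cst c).
  apply: measurable_bounded_integrable => //.
    by rewrite -ge0_fin_numE// na_sub_fin.
  by exists `|c|; split; [exact: num_real|move=> K cK t _ /=; exact: ltW].
rewrite -!(Rintegral_cst nu)// -RintegralB//; [|exact: na_integrable|exact: cint].
have int1 : nu.-integrable `]a, b[ (EFin \o (fun x => F x - k)).
  rewrite (_ : _ \o _ = (EFin \o F) \- (EFin \o cst k))%E; last first.
    by apply/funext => x /=; rewrite EFinB.
  by apply: integrableB => //; exact: na_integrable.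
apply: (le_trans (le_normr_Rintegral _ int1)) => //.
apply: le_Rintegral => //.
- exact: integrable_norm.
- exact: cint.
Qed.

Lemma na_integral_split a b d : p <= a -> a <= b -> b <= d -> d <= q ->
  \int[nu]_(t in `]a, d[) F t = \int[nu]_(t in `]a, b[) F t + \int[nu]_(t in `]b, d[) F t.
Proof.
move=> pa ab bd dq.
have [->|anb] := eqVneq a b; first by rewrite set_itvoo0 Rintegral_set0 add0r.
have [->|bnd] := eqVneq b d; first by rewrite set_itvoo0 Rintegral_set0 addr0.
have {}ab : a < b by rewrite lt_neqAle anb.
have {}bd : b < d by rewrite lt_neqAle bnd.
have D : (`]a, d[ `\` [set b] = `]a, b[ `|` `]b, d[)%classic.
  apply/seteqP; split=> x /=.
    rewrite !in_itv/= => -[/andP[-> ->] /eqP].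
    by rewrite neq_lt andbT => /orP[|]; [left|right].
  rewrite !in_itv/= => -[|] /andP[H1 H2].
    by rewrite H1 (lt_trans H2)//; split=> // xb; rewrite xb ltxx in H2.
  by rewrite H2 (lt_trans ab)//; split=> // xb; rewrite xb ltxx in H1.
have ia := na_integrable pa dq.
have mab : measurable (`]a, b[%classic : set (measurableTypeR R)) by [].
have mbd : measurable (`]b, d[%classic : set (measurableTypeR R)) by [].
rewrite [LHS]/Rintegral (negligible_integral _ _ ia (nu_na b))// D -/(Rintegral _ _ _).
rewrite Rintegral_setU//.
  apply: integrableS ia => //; first exact: measurableU.
  by rewrite -D; apply: subDsetl.
apply/disj_setPS => y [/=]; rewrite 2!in_itv/= => /andP[_ yb] /andP[].
by rewrite ltNge (ltW yb).
Qed.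

(** F is controlled only inside ]p, q[, while the closed interval may contain p or q. Both endpoints
    are null, and any function is measurable on two points. *)
Lemma na_integral_closed a b : p <= a -> a < b -> b <= q ->
  \int[nu]_(t in `[a, b]) F t = \int[nu]_(t in `]a, b[) F t.
Proof.
move=> pa ab bq.
have ma : measurable ([set a; b] : set (measurableTypeR R)) by exact: measurableU.
have nab : nu [set a; b] = 0%E by rewrite measureU0.
have D : (`[a, b] `\` [set a; b] = `]a, b[)%classic.
  apply/seteqP; split=> x /=; rewrite !in_itv/=.
    move=> [/andP[ax xb] /not_orP[/eqP xa /eqP xnb]].
    by rewrite !lt_neqAle eq_sym xa xnb ax xb.
  move=> /andP[ax xb]; rewrite !ltW//; split=> // -[] xx.
    by rewrite xx ltxx in ax.
  by rewrite xx ltxx in xb.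
have U : (`[a, b] = `]a, b[ `|` [set a; b])%classic.
  rewrite -D setUC setDUK// => x /= [] ->; rewrite in_itv/= ?lexx ?(ltW ab)//.
have mF' : measurable_fun (`[a, b]%classic : set (measurableTypeR R)) F.
  rewrite U; apply/measurable_funU => //; split.
    by apply: measurable_funS mF => //; apply: subset_itv; rewrite bnd_simp.
  by apply/measurable_funU => //; split; exact: measurable_fun_set1.
have ia : nu.-integrable `[a, b] (EFin \o F).
  have mab : measurable (`[a, b]%classic : set (measurableTypeR R)) by [].
  apply/(negligible_integrable ma mab _ nab); first exact/measurable_EFinP.
  by rewrite D; exact: na_integrable.
rewrite /Rintegral (negligible_integral ma _ ia nab)//.
by rewrite D.
Qed.

End nonatomic_integral.

Import summability.
#[local] Existing Instance totally_filter.

Definition restr_to (R : realType) (V : zmodType) (A : set R) (a : R -> V) (r : R) : V :=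
  if r \in A then a r else 0.

Lemma restr_toT (R : realType) (V : zmodType) (A : set R) (a : R -> V) (r : R) :
  A r -> restr_to A a r = a r.
Proof. by move=> Ar; rewrite /restr_to mem_set. Qed.

Lemma restr_toF (R : realType) (V : zmodType) (A : set R) (a : R -> V) (r : R) :
  ~ A r -> restr_to A a r = 0.
Proof. by move=> Ar; rewrite /restr_to memNset. Qed.

Lemma partial_sumE (R : realType) (V : zmodType) (x : R -> V) (B : {fset R}) :
  partial_sum x B = \sum_(r <- B) x r.
Proof. by rewrite /partial_sum big_seq_fsetE. Qed.

Section unordered_sums.
Context (R : realType) (n : nat).
Local Notation V := 'rV[R]_n.
Implicit Types (A B : set R) (a : R -> V).

(** Cauchy criterion along finite sets: once B0 nearly attains the supremum of the finite sums of m,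
    any further terms of a weigh at most C times the remaining defect. *)
Lemma unordered_sum_cvg (C K : R) (m : R -> R) A a :
  0 <= C -> (forall r, 0 <= m r) ->
  (forall B : {fset R}, \sum_(r <- B) m r <= K) ->
  (forall r, A r -> `|a r| <= C * m r) ->
  partial_sum (restr_to A a) @ totally --> unordered_sum A a.
Proof.
move=> C0 m0 mK am.
suff : cvg (partial_sum (restr_to A a) @ totally) by [].
apply: cauchy_cvg; apply: cauchy_exP => e e0.
pose S := [set \sum_(r <- B) m r | B in [set: {fset R}]].
have supS : has_sup S.
  by split; [exists (\sum_(r <- fset0) m r), fset0|exists K => _ [B _ <-]].
have d0 : 0 < e / (C + 1) by rewrite divr_gt0// ltr_wpDl.
have [_ [B0 _ <-] B0S] := sup_adherent d0 supS.
exists (partial_sum (restr_to A a) B0), B0 => // B /= B0B.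
have BB : \sum_(r <- B) m r <= sup S by apply: ub_le_sup; [case: supS|exists B].
have split_sum (W : zmodType) (x : R -> W) :
    \sum_(r <- B) x r = \sum_(r <- B0) x r + \sum_(r <- (B `\` B0)%fset) x r.
  rewrite (big_fsetID _ (mem B0)); congr (_ + _).
    suff -> : [fset r in B | mem B0 r]%fset = B0 by [].
    apply/fsetP => r; rewrite !inE/= andbC; case: (boolP (r \in B0)) => //= rB0.
    by move/fsubsetP : B0B => /(_ _ rB0).
  suff -> : [fset r in B | ~~ mem B0 r]%fset = (B `\` B0)%fset by [].
  by apply/fsetP => r; rewrite !inE/= andbC.
rewrite -ball_normE/= !partial_sumE (split_sum _ (restr_to A a)) opprD addNKr normrN.
rewrite (le_lt_trans (ler_norm_sum _ _ _))//.
apply: (@le_lt_trans _ _ (C * \sum_(r <- (B `\` B0)%fset) m r)).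
  rewrite mulr_sumr; apply: ler_sum => r _; rewrite /restr_to.
  by case: ifPn => [/set_mem /am//|_]; rewrite normr0 mulr_ge0.
move: BB B0S; rewrite (split_sum _ m) => BB B0S.
have md : \sum_(r <- (B `\` B0)%fset) m r < e / (C + 1) by lra.
rewrite (@le_lt_trans _ _ ((C + 1) * \sum_(r <- (B `\` B0)%fset) m r))//.
  by rewrite ler_wpM2r ?sumr_ge0// lerDl.
by rewrite mulrC -ltr_pdivlMr// ltr_wpDl.
Qed.

Lemma unordered_sumE A a (s : V) :
  partial_sum (restr_to A a) @ totally --> s -> unordered_sum A a = s.
Proof. by move=> as_; apply: cvg_lim. Qed.

Lemma partial_sum_setU A B a (s t : V) : A `&` B = set0 ->
  partial_sum (restr_to A a) @ totally --> s ->
  partial_sum (restr_to B a) @ totally --> t ->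
  partial_sum (restr_to (A `|` B) a) @ totally --> s + t.
Proof.
move=> AB sA sB.
rewrite (_ : partial_sum (restr_to (A `|` B) a) =
   partial_sum (restr_to A a) \+ partial_sum (restr_to B a)); first exact: cvgD.
apply/funext => J /=; rewrite !partial_sumE -big_split/=; apply: eq_bigr => r _.
rewrite /restr_to in_setU.
have [rA|rA] /= := boolP (r \in A); last by rewrite add0r.
case: ifPn; last by rewrite addr0.
move=> rB; have : (A `&` B) r by split; exact/set_mem.
by rewrite AB.
Qed.

Lemma partial_sum_set1 (b : R) a :
  partial_sum (restr_to [set b] a) @ totally --> a b.
Proof.
apply: cvg_near_cst; exists [fset b]%fset => // B /= bB.
have bB' : b \in B by move/fsubsetP : bB; apply; rewrite inE.
rewrite partial_sumE (big_fsetD1 b)//= /restr_to in_set1 eqxx big_seq big1 ?addr0// => r.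
by rewrite !inE => /andP[/negbTE rb _]; rewrite in_set1 rb.
Qed.

Lemma eq_unordered_sum A a a' : (forall r, A r -> a r = a' r) ->
  unordered_sum A a = unordered_sum A a'.
Proof.
move=> aa'; congr (summability.sum _); apply/funext => r.
by case: ifPn => // /set_mem /aa'.
Qed.

End unordered_sums.

Section mass.
Context (R : realType) (mu : {finite_measure set (measurableTypeR R) -> \bar R}).

Lemma finite_fset_image (c : R) (B : {fset R}) :
  measurable ([set r + c | r in [set` B]] : set (measurableTypeR R)).
Proof.
apply: countable_measurable => //; apply: finite_set_countable.
by apply: finite_image; exact: finite_fset.
Qed.

Lemma sum_mass_fset (c : R) (B : {fset R}) :
  \sum_(r <- B) fine (mu [set r + c]) = fine (mu [set r + c | r in [set` B]]).
Proof.
have -> : [set r + c | r in [set` B]] = \big[setU/set0]_(r <- B) [set r + c].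
  rewrite -bigcup_fset; apply/seteqP; split=> [t [r /= rB <-]|t [r /= rB ->]].
    by exists r.
  by exists r.
rewrite measure_fbigsetU//=; last by move=> i j _ _ [x [/= -> /addIr]].
rewrite -sum_fine// => r _; exact: fin_num_measure.
Qed.

Lemma sum_mass_le (c : R) (B : {fset R}) :
  \sum_(r <- B) fine (mu [set r + c]) <= fine (mu setT).
Proof.
rewrite sum_mass_fset; apply: fine_le; rewrite ?fin_num_measure//.
  exact: finite_fset_image.
by apply: le_measure; rewrite ?inE//; exact: finite_fset_image.
Qed.

Lemma mass_split (A : set R) : measurable (A : set (measurableTypeR R)) ->
  mu A = (cont_part mu A + mu (A `&` atoms mu))%E.
Proof.
move=> mA; have mat := measurable_atoms mu.
rewrite /cont_part/= /mrestr -measureU//.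
- by rewrite -setIUr setUC setUv setIT.
- by apply: measurableI => //; exact: measurableC.
- exact: measurableI.
- by rewrite setIACA setICl setI0.
Qed.

Lemma cont_part_set1 (x : R) : cont_part mu [set x] = 0%E.
Proof.
rewrite /cont_part/= /mrestr.
have [ax|nax] := pselect (atoms mu x).
  rewrite (_ : _ `&` _ = set0) ?measure0//; apply/seteqP; split=> // t [/= -> nt].
  exact: nt.
rewrite (_ : _ `&` _ = [set x]).
  by move: nax; rewrite /atoms/= => /negP; rewrite -leNgt measure_le0 => /eqP.
by apply/seteqP; split=> [t []//|t /= ->].
Qed.

Lemma fine_massD (A : set R) : measurable (A : set (measurableTypeR R)) ->
  fine (mu A) = fine (cont_part mu A) + fine (mu (A `&` atoms mu)).
Proof.
move=> mA; have mat := measurable_atoms mu.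
have fin : mu (A `&` atoms mu) \is a fin_num.
  by apply: fin_num_measure; exact: measurableI.
rewrite mass_split// fineD// /cont_part/= /mrestr.
by apply: fin_num_measure; apply: measurableI => //; exact: measurableC.
Qed.

(** Enumerate the countable set of atoms in A: the masses of the initial segments increase to the
    mass of the whole set. *)
Lemma atoms_mass_adherent (A : set R) (e : R) :
  measurable (A : set (measurableTypeR R)) -> 0 < e ->
  exists2 B : {fset R}, [set` B] `<=` A `&` atoms mu &
    fine (mu (A `&` atoms mu)) - e < \sum_(t <- B) fine (mu [set t]).
Proof.
move=> mA e0; set D := A `&` atoms mu.
have mD : measurable (D : set (measurableTypeR R)).
  by apply: measurableI => //; exact: measurable_atoms.
have cD : countable D by apply: sub_countable (countable_atoms mu); apply: subset_card_le => t [].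
have Dfin : mu D \is a fin_num by exact: fin_num_measure.
have [D0|[f]] := pfcard_geP cD.
  exists fset0; first by move=> t; rewrite /= inE.
  by rewrite big_seq_fset0 D0 measure0/= sub0r oppr_lt0.
pose Dn n := f @` `I_n.
have fDn n : finite_set (Dn n) by apply: finite_image; exact: finite_II.
have mDn n : measurable (Dn n : set (measurableTypeR R)).
  by apply: countable_measurable => //; exact: finite_set_countable.
have DnD : \bigcup_n Dn n = D.
  apply/seteqP; split=> [t [n _ [k _ <-]]|t Dt]; first by apply: funS.
  have [k _ <-] := 'surj_f Dt; exists k.+1 => //; exists k => //=.
have := @nondecreasing_cvg_mu _ _ _ mu Dn mDn (bigcupT_measurable _ mDn).
rewrite DnD => cvDn.
have {}cvDn : fine (mu (Dn n)) @[n --> \oo] --> fine (mu D).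
  apply: fine_cvg; rewrite fineK//; apply: cvDn.
  move=> n m nm; apply/subsetPset => t [k /= kn <-]; exists k => //=.
  exact: leq_trans kn nm.
have [N _ /(_ N (leqnn N))] := (cvgrPdist_lt _ _).1 cvDn e e0.
rewrite ltr_distlC => /andP[H _].
exists (fset_set (Dn N)).
  by move=> t; rewrite /= in_fset_set// => /set_mem tN; rewrite -DnD; exists N.
have := sum_mass_fset 0 (fset_set (Dn N)).
under eq_bigr do rewrite addr0.
move=> ->; under eq_imagel do rewrite addr0.
by rewrite image_id fset_setK.
Qed.

End mass.

Lemma rV_norm_le (R : realType) (n : nat) (v : 'rV[R]_n) (K : R) : 0 <= K ->
  (forall k, `|v ord0 k| <= K) -> `|v| <= K.
Proof.
move=> K0 vK; rewrite [leLHS]/Num.norm/= mx_normrE; apply: bigmax_le => // -[i k] _ /=.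
by rewrite (ord1 i).
Qed.

Lemma rV_norm_ge (R : realType) (n : nat) (v : 'rV[R]_n) k : `|v ord0 k| <= `|v|.
Proof.
rewrite [leRHS]/Num.norm/= mx_normrE.
exact: (le_bigmax _ (fun ij : 'I_1 * 'I_n => `|v ij.1 ij.2|) (ord0, k)).
Qed.

(* The right-hand side of the state equation over the open interval ]a, b[ of the
   window starting at c, with drift Ff, impulsive part Fg and jumps j. *)
Definition impulse (R : realType) (n : nat)
    (mu : {finite_measure set (measurableTypeR R) -> \bar R}) (c : R)
    (Ff Fg j : R -> 'rV[R]_n) (a b : R) : 'rV[R]_n :=
  Rintegral_vec (@lebesgue_measure R) `]a + c, b + c[%classic Ff
  + Rintegral_vec (cont_part mu) `]a + c, b + c[%classic Fg
  + unordered_sum `]a, b[%classic j.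

Section impulse.
Context (R : realType) (n : nat).
Context (mu : {finite_measure set (measurableTypeR R) -> \bar R}).
Context (c h M : R) (Ff Fg j : R -> 'rV[R]_n).
Local Notation leb := (@lebesgue_measure R).
Hypothesis M0 : 0 <= M.
Hypothesis mFf : forall k, measurable_fun (`]c, c + h[ : set (measurableTypeR R))
  (fun t : R => Ff t ord0 k).
Hypothesis mFg : forall k, measurable_fun (`]c, c + h[ : set (measurableTypeR R))
  (fun t : R => Fg t ord0 k).
Hypothesis Ff_bd : forall t, c < t < c + h -> `|Ff t| <= M.
Hypothesis Fg_bd : forall t, c < t < c + h -> `|Fg t| <= M.
Hypothesis j_bd : forall r, 0 < r < h -> `|j r| <= M * fine (mu [set r + c]).

Local Notation imp := (impulse mu c Ff Fg j).

Lemma leb_open_fin (p q : R) : (leb `]p, q[%classic < +oo)%E.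
Proof. by rewrite lebesgue_measure_itv/=; case: ifP; rewrite ?ltry// -EFinB ltry. Qed.

Lemma cont_part_open_fin (p q : R) : (cont_part mu `]p, q[%classic < +oo)%E.
Proof.
rewrite (_ : cont_part mu _ = mu (`]p, q[ `&` ~` atoms mu))//.
rewrite -ge0_fin_numE//; apply: fin_num_measure; apply: measurableI => //.
by apply: measurableC; exact: measurable_atoms.
Qed.

Let na_leb := @lebesgue_measure_set1 R.
Let na_mu := @cont_part_set1 R mu.
Let Ffk k t : c < t < c + h -> `|Ff t ord0 k| <= M.
Proof. by move=> /Ff_bd; apply: le_trans; exact: rV_norm_ge. Qed.
Let Fgk k t : c < t < c + h -> `|Fg t ord0 k| <= M.
Proof. by move=> /Fg_bd; apply: le_trans; exact: rV_norm_ge. Qed.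

Lemma jump_sum_cvg (A : set R) : (forall r, A r -> 0 < r < h) ->
  partial_sum (restr_to A j) @ totally --> unordered_sum A j.
Proof.
move=> Ah; apply: (@unordered_sum_cvg _ _ M (fine (mu setT))
  (fun r => fine (mu [set r + c]))) => //.
- by move=> r; exact: fine_ge0.
- by move=> B; exact: sum_mass_le.
- by move=> r /Ah; exact: j_bd.
Qed.

(** Points that are not atoms contribute nothing, so every partial sum is at most the mass of the
    atoms; [atoms_mass_adherent] supplies finite sets that nearly attain it. *)
Lemma mass_sum_cvg a b :
  partial_sum (restr_to `]a, b[ (fun r : R => fine (mu [set r + c]))) @ totally -->
  fine (mu (`]a + c, b + c[ `&` atoms mu)).
Proof.
set D := _ `&` _; pose m (r : R) := fine (mu [set r + c]).
have mab : measurable (`]a + c, b + c[%classic : set (measurableTypeR R)) by [].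
have mD : measurable (D : set (measurableTypeR R)).
  by apply: measurableI => //; exact: measurable_atoms.
have m0 r : 0 <= m r by exact: fine_ge0.
have restr0 r : 0 <= restr_to `]a, b[ m r by rewrite /restr_to; case: ifP.
have upper (B : {fset R}) : partial_sum (restr_to `]a, b[ m) B <= fine (mu D).
  rewrite partial_sumE.
  rewrite (big_fsetID _ (fun r => (a < r < b) && (r + c \in atoms mu)))/=.
  rewrite [X in _ + X]big_seq [X in _ + X]big1 ?addr0; last first.
    move=> r; rewrite !inE/= negb_and => /andP[_ H].
    have [rab|rab] := pselect (`]a, b[%classic r); last by rewrite restr_toF.
    rewrite restr_toT//; move: H; rewrite (_ : a < r < b)/=; last by move: rab; rewrite /= in_itv.
    move=> /negP rat; apply/eqP; rewrite fine_eq0 ?fin_num_measure//; apply/negPn/negP => mr.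
    by apply: rat; rewrite inE /atoms/= lt_neqAle eq_sym mr/=.
  rewrite big_seq (eq_bigr m); last first.
    move=> r; rewrite !inE/= => /andP[_ /andP[rab _]].
    by rewrite restr_toT//= in_itv.
  rewrite -big_seq sum_mass_fset; apply: fine_le; rewrite ?fin_num_measure//.
    exact: finite_fset_image.
  apply: le_measure; rewrite ?inE//; first exact: finite_fset_image.
  move=> t [r /= + <-]; rewrite !inE/= => /andP[_ /andP[/andP[ar rb] rat]].
  by split; [rewrite /= in_itv/= !ltrD2r ar|exact/set_mem].
apply/cvgrPdist_lt => e e0.
have [B BD Be] := atoms_mass_adherent mu mab e0.
exists [fset t - c | t in B]%fset => // B' /= BB'.
rewrite ger0_norm ?subr_ge0 ?upper// ltrBlDr -ltrBlDl.
apply: (lt_le_trans Be).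
have -> : \sum_(t <- B) fine (mu [set t]) =
    \sum_(r <- [fset t - c | t in B]%fset) restr_to `]a, b[ m r.
  rewrite big_imfset/=; last by move=> x y _ _ /addIr.
  rewrite big_seq [RHS]big_seq; apply: eq_bigr => t tB.
  have [/= tab _] := BD _ tB.
  rewrite restr_toT ?/m ?subrK//.
  by move: tab; rewrite /= !in_itv/= ltrBrDr ltrBlDr.
rewrite partial_sumE (big_fsetID _ (mem [fset t - c | t in B]%fset) B')/=.
have -> : [fset x in B' | x \in [fset t - c | t in B]%fset]%fset = [fset t - c | t in B]%fset.
  apply/fsetP => r; rewrite !inE/= andbC.
  by case: (boolP (r \in [fset t - c | t in B]%fset)) => //= /(fsubsetP BB').
by rewrite lerDl sumr_ge0.
Qed.

(** The diffuse part and the jumps are compared with the same vector cg, so their two masses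
    recombine into the mass of mu. The bound thereby takes the form of [arc_dynamics]. *)
Lemma impulse_estimate a b e (cf cg : 'rV[R]_n) :
  0 <= a -> a <= b -> b <= h -> 0 <= e ->
  (forall r, a < r < b -> [/\ `|Ff (r + c) - cf| <= e, `|Fg (r + c) - cg| <= e &
     `|j r - fine (mu [set r + c]) *: cg| <= e * fine (mu [set r + c])]) ->
  `|imp a b - (b - a) *: cf - fine (mu `]a + c, b + c[%classic) *: cg|
    <= e * (b - a + fine (mu `]a + c, b + c[%classic)).
Proof.
move=> a0 ab bh e0 H.
have pa : c <= a + c by rewrite lerDr.
have bq : b + c <= c + h by rewrite addrC lerD2l.
have Hs t : a + c < t < b + c -> a < t - c < b by rewrite ltrBrDr ltrBlDr.
have mab : measurable (`]a + c, b + c[%classic : set (measurableTypeR R)) by [].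
have lebab : fine (leb `]a + c, b + c[%classic) = b - a.
  rewrite lebesgue_measure_itv/= lte_fin ltrD2r.
  move: ab; rewrite le_eqVlt => /orP[/eqP ->|ab]; first by rewrite ltxx subrr.
  by rewrite ab/=; ring.
have E1 : `|Rintegral_vec leb `]a + c, b + c[%classic Ff - (b - a) *: cf| <= e * (b - a).
  apply: rV_norm_le => [|k]; first by rewrite mulr_ge0// subr_ge0.
  rewrite !mxE -lebab [_ * cf _ _]mulrC.
  apply: (na_integral_estimate (leb_open_fin c (c + h)) (@mFf k) (@Ffk k)) => // t tab.
  have [+ _ _] := H _ (Hs _ tab); rewrite subrK; apply: le_trans.
  by have := rV_norm_ge (Ff t - cf) k; rewrite !mxE.
have E2 : `|Rintegral_vec (cont_part mu) `]a + c, b + c[%classic Fg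
     - fine (cont_part mu `]a + c, b + c[%classic) *: cg|
     <= e * fine (cont_part mu `]a + c, b + c[%classic).
  apply: rV_norm_le => [|k]; first by rewrite mulr_ge0// fine_ge0.
  rewrite !mxE [_ * cg _ _]mulrC.
  apply: (na_integral_estimate (cont_part_open_fin c (c + h)) (@mFg k) (@Fgk k)) => // t tab.
  have [_ + _] := H _ (Hs _ tab); rewrite subrK; apply: le_trans.
  by have := rV_norm_ge (Fg t - cg) k; rewrite !mxE.
set m := fine (mu (`]a + c, b + c[ `&` atoms mu)).
have E3 : `|unordered_sum `]a, b[%classic j - m *: cg| <= e * m.
  have c1 : partial_sum (restr_to `]a, b[ j) @ totally --> unordered_sum `]a, b[%classic j.
    apply: jump_sum_cvg => r /=; rewrite in_itv/= => /andP[ar rb].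
    by rewrite (le_lt_trans a0 ar) (lt_le_trans rb bh).
  have := @mass_sum_cvg a b; rewrite -/m => c2.
  (* For finite partial sums the estimate is the triangle inequality; c3 and c4 carry it to the
     limit. *)
  have c3 : `|partial_sum (restr_to `]a, b[ j) B
      - partial_sum (restr_to `]a, b[ (fun r : R => fine (mu [set r + c]))) B *: cg|
      @[B --> totally]
      --> `|unordered_sum `]a, b[%classic j - m *: cg|.
    by apply: cvg_norm; apply: cvgB => //; exact: cvgZr_tmp.
  have c4 : e * partial_sum (restr_to `]a, b[ (fun r : R => fine (mu [set r + c]))) B
      @[B --> totally] --> e * m.
    exact: cvgMl_tmp.
  rewrite -subr_le0; apply: (cvgr_to_le (cvgB c3 c4)).
  apply: nearW => B; rewrite /= subr_le0.
  rewrite !partial_sumE scaler_suml -sumrB mulr_sumr.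
  rewrite (le_trans (ler_norm_sum _ _ _))//; apply: ler_sum => r _.
  have [rab|rab] := pselect (`]a, b[%classic r).
    by rewrite !restr_toT//; move: rab; rewrite /= in_itv/= => /H[].
  by rewrite !restr_toF// scale0r subr0 normr0 mulr0.
rewrite (fine_massD mu mab) -/m /impulse.
set I1 := Rintegral_vec leb _ _ in E1 *.
set I2 := Rintegral_vec _ _ Fg in E2 *.
set I3 := unordered_sum _ _ in E3 *.
set d := fine (cont_part mu _) in E2 *.
have -> : I1 + I2 + I3 - (b - a) *: cf - (d + m) *: cg =
    (I1 - (b - a) *: cf) + (I2 - d *: cg) + (I3 - m *: cg).
  by apply/rowP => k; rewrite !mxE; ring.
rewrite (le_trans (ler_normD _ _))//.
rewrite (le_trans (lerD (le_trans (ler_normD _ _) (lerD E1 E2)) E3))//.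
by rewrite -!mulrDr addrA.
Qed.

(** Neither of the two integrators charges the point b, which therefore contributes its jump and
    nothing else. *)
Lemma impulse_split a b d : 0 <= a -> a < b -> b < d -> d <= h ->
  imp a d = imp a b + j b + imp b d.
Proof.
move=> a0 ab bd dh.
have b0 : 0 < b by exact: le_lt_trans ab.
have bh : b < h by exact: lt_le_trans dh.
have E1 : Rintegral_vec leb `]a + c, d + c[%classic Ff =
    Rintegral_vec leb `]a + c, b + c[%classic Ff + Rintegral_vec leb `]b + c, d + c[%classic Ff.
  apply/rowP => k; rewrite !mxE.
  apply: (na_integral_split na_leb (leb_open_fin c (c + h)) (@mFf k) (@Ffk k));
    by [rewrite lerDr|rewrite lerD2r ltW|rewrite addrC lerD2l].
have E2 : Rintegral_vec (cont_part mu) `]a + c, d + c[%classic Fg =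
    Rintegral_vec (cont_part mu) `]a + c, b + c[%classic Fg
    + Rintegral_vec (cont_part mu) `]b + c, d + c[%classic Fg.
  apply/rowP => k; rewrite !mxE.
  apply: (na_integral_split na_mu (cont_part_open_fin c (c + h)) (@mFg k) (@Fgk k));
    by [rewrite lerDr|rewrite lerD2r ltW|rewrite addrC lerD2l].
have E3 : unordered_sum `]a, d[%classic j =
    unordered_sum `]a, b[%classic j + j b + unordered_sum `]b, d[%classic j.
  have D : (`]a, d[ = `]a, b[ `|` [set b] `|` `]b, d[)%classic.
    apply/seteqP; split=> r /=; rewrite !in_itv/=.
      move=> /andP[ar rd]; have [rb|rb|->] := ltgtP r b.
      - by left; left; rewrite ar.
      - by right; rewrite rd.
      - by left; right.
    move=> [[/andP[ar rb]|->]|/andP[br rd]].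
    - by rewrite ar (lt_trans rb).
    - by rewrite ab bd.
    - by rewrite (lt_trans ab) ?rd.
  rewrite D; apply: unordered_sumE.
  apply: partial_sum_setU.
  - apply/seteqP; split=> // r /= [[|->]]; rewrite !in_itv/= ?ltxx//.
    by move=> /andP[_ rb] /andP[]; rewrite ltNge (ltW rb).
  - apply: partial_sum_setU.
    + apply/seteqP; split=> // r /= [H rb]; move: H.
      by rewrite rb in_itv/= ltxx andbF.
    + apply: jump_sum_cvg => r /=; rewrite in_itv/= => /andP[ar rb].
      by rewrite (le_lt_trans a0 ar) (lt_trans rb bh).
    + exact: partial_sum_set1.
  - apply: jump_sum_cvg => r /=; rewrite in_itv/= => /andP[ar rb].
    by rewrite (lt_trans b0 ar) (lt_le_trans rb dh).
rewrite /impulse E1 E2 E3.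
by apply/rowP => k; rewrite !mxE; ring.
Qed.

(** Passes from the closed intervals of the state equation to open ones, which are additive up to
    isolated jumps. *)
Lemma impulse_closed b : 0 < b -> b < h ->
  Rintegral_vec leb `[c, b + c]%classic Ff
  + Rintegral_vec (cont_part mu) `[c, b + c]%classic Fg
  + unordered_sum `]0, b]%classic j = imp 0 b + j b.
Proof.
move=> b0 bh.
have bq : b + c <= c + h by rewrite addrC lerD2l ltW.
have cb : c < b + c by rewrite ltrDr.
have E1 : Rintegral_vec leb `[c, b + c]%classic Ff = Rintegral_vec leb `]0 + c, b + c[%classic Ff.
  apply/rowP => k; rewrite !mxE add0r.
  exact: (na_integral_closed na_leb (leb_open_fin c (c + h)) (@mFf k) (@Ffk k)).
have E2 : Rintegral_vec (cont_part mu) `[c, b + c]%classic Fg =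
    Rintegral_vec (cont_part mu) `]0 + c, b + c[%classic Fg.
  apply/rowP => k; rewrite !mxE add0r.
  exact: (na_integral_closed na_mu (cont_part_open_fin c (c + h)) (@mFg k) (@Fgk k)).
have E3 : unordered_sum `]0, b]%classic j = unordered_sum `]0, b[%classic j + j b.
  have D : (`]0, b] = `]0, b[ `|` [set b])%classic.
    apply/seteqP; split=> r /=; rewrite !in_itv/=.
      move=> /andP[ar rb]; move: rb; rewrite le_eqVlt => /orP[/eqP ->|rb]; first by right.
      by left; rewrite ar.
    by move=> [/andP[ar rb]|->]; rewrite ?b0 ?lexx// ar ltW.
  rewrite D; apply: unordered_sumE; apply: partial_sum_setU.
  - apply/seteqP; split=> // r /= [H rb]; move: H.
    by rewrite rb in_itv/= ltxx andbF.
  - apply: jump_sum_cvg => r /=; rewrite in_itv/= => /andP[ar rb].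
    by rewrite ar (lt_trans rb bh).
  - exact: partial_sum_set1.
by rewrite E1 E2 E3 addrA.
Qed.

End impulse.

(** * Measurability of the delayed integrands and masses of punctured neighbourhoods *)

Lemma countable_measurable_fun (R : realType) (D : set R) (phi : R -> R) :
  countable D -> measurable_fun (D : set (measurableTypeR R)) phi.
Proof.
move=> cD mD B mB; apply: countable_measurable => //.
by apply: sub_countable cD; apply: subset_card_le => t [].
Qed.

(** On the countable set D every function is measurable, and off D continuity suffices. *)
Lemma measurable_fun_cocountable (R : realType) (p q : R) (D : set R) (phi : R -> R) :
  countable D -> (forall t, p < t < q -> ~ D t -> {for t, continuous phi}) ->
  measurable_fun (`]p, q[ : set (measurableTypeR R)) phi.
Proof.
move=> cD phic.
have mD : measurable (D : set (measurableTypeR R)) by apply: countable_measurable => //.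
have -> : `]p, q[%classic = (`]p, q[ `\` D) `|` (`]p, q[ `&` D).
  by rewrite setUC setUIDK.
have m1 : measurable (`]p, q[ `\` D : set (measurableTypeR R)) by exact: measurableD.
have m2 : measurable (`]p, q[ `&` D : set (measurableTypeR R)) by exact: measurableI.
apply/measurable_funU => //; split.
  apply: subspace_continuous_measurable_fun => //.
  apply: continuous_in_subspaceT => t /set_mem [/= tpq Dt].
  by apply: phic => //; move: tpq; rewrite in_itv.
by apply: countable_measurable_fun; apply: sub_countable cD; apply: subset_card_le => t [].
Qed.

(** The variation on [a, t] is nondecreasing in t and dominates the increments of phi, so phi is
    continuous wherever it is; a monotone function has countably many discontinuities. *)
Lemma BV_cocountable_continuous (R : realType) (a b : R) (phi : R -> R) :
  a < b -> bounded_variation a b phi ->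
  exists2 D : set R, countable D &
    forall t, a < t < b -> ~ D t -> {for t, continuous phi}.
Proof.
move=> ab bv.
pose V t := fine (total_variation a t phi).
have fin t : a <= t -> t <= b -> total_variation a t phi \is a fin_num.
  by move=> at_ tb; apply/(bounded_variationP _ at_)/(bounded_variationl at_ tb).
have VB s t : a <= s -> s <= t -> t <= b -> `|phi t - phi s| <= V t - V s.
  move=> as_ st tb.
  have D := total_variationD phi as_ st.
  have := total_variation_ge phi st.
  have fst : total_variation s t phi \is a fin_num.
    apply/(bounded_variationP _ st).
    exact: (bounded_variationl st tb (bounded_variationr as_ (le_trans st tb) bv)).
  rewrite -(fineK fst) lee_fin => /le_trans; apply.
  rewrite /V D fineD// ?fin//; last exact: le_trans tb.
  by rewrite addrAC subrr add0r.
have Vnd : {in `[a, b] &, nondecreasing_fun V}.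
  move=> s t; rewrite !in_itv/= => /andP[as_ sb] /andP[at_ tb] st.
  by rewrite -subr_ge0; apply: le_trans (VB _ _ as_ st tb).
exists [set t | t \in (`]a, b[) /\ discontinuity V t]; first exact: discontinuity_countable.
move=> t /andP[at_ tb] /= nD.
have cl : cvg (V x @[x --> t^'-]).
  apply: nondecreasing_at_left_is_cvgr; near=> u.
    move=> x y.
    have au : a < u by near: u; exact: nbhs_left_gt.
    rewrite !in_itv/= => /andP[ux xt] /andP[uy yt]; apply: Vnd; rewrite in_itv/=.
      by rewrite (ltW (lt_trans au ux)) (ltW (lt_trans xt tb)).
    by rewrite (ltW (lt_trans au uy)) (ltW (lt_trans yt tb)).
  have au : a < u by near: u; exact: nbhs_left_gt.
  exists (V t) => _ [y + <-] /=; rewrite ?in_itv/= => /andP[uy yt].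
  apply: Vnd; rewrite ?in_itv/= ?(ltW yt)//.
    by rewrite (ltW (lt_trans au uy)) (ltW (lt_trans yt tb)).
  by rewrite !ltW.
have cr : cvg (V x @[x --> t^'+]).
  apply: nondecreasing_at_right_is_cvgr; near=> u.
    move=> x y.
    have ub : u < b by near: u; exact: nbhs_right_lt.
    rewrite !in_itv/= => /andP[tx xu] /andP[ty yu]; apply: Vnd; rewrite in_itv/=.
      by rewrite (ltW (lt_trans at_ tx)) (ltW (lt_trans xu ub)).
    by rewrite (ltW (lt_trans at_ ty)) (ltW (lt_trans yu ub)).
  have ub : u < b by near: u; exact: nbhs_right_lt.
  exists (V t) => _ [y + <-] /=; rewrite ?in_itv/= => /andP[ty yu].
  apply: Vnd; rewrite ?in_itv/= ?(ltW ty)//.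
    by rewrite !ltW.
  by rewrite (ltW (lt_trans at_ ty)) (ltW (lt_trans yu ub)).
(* Off the exceptional set the one-sided limits of V agree; monotonicity then squeezes V t itself
   onto their common value. *)
set L := lim (V x @[x --> t^'-]).
have LE : L = lim (V x @[x --> t^'+]).
  apply: contrapT => /eqP LL; apply: nD; split; first by rewrite in_itv/= at_.
  by split.
have cl' : V x @[x --> t^'-] --> L by [].
have cr' : V x @[x --> t^'+] --> L by rewrite LE.
have Vle x y : a < x -> x <= y -> y < b -> V x <= V y.
  by move=> ax xy yb; apply: Vnd; rewrite // in_itv/= ?ltW// ?(lt_le_trans ax) ?(le_lt_trans xy).
apply/cvgrPdist_le => e e0.
have e20 : 0 < e / 2 by rewrite divr_gt0.
have [d1 /= d10 H1] := (cvgrPdist_lt _ _).1 cl' _ e20.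
have [d2 /= d20 H2] := (cvgrPdist_lt _ _).1 cr' _ e20.
pose d := Num.min (Num.min d1 d2) (Num.min (t - a) (b - t)).
have d0 : 0 < d by rewrite !lt_min d10 d20 !subr_gt0 at_ tb.
have dd1 : d <= d1 by rewrite /d !ge_min lexx.
have dd2 : d <= d2 by rewrite /d !ge_min lexx !orbT.
have dta : d <= t - a by rewrite /d !ge_min lexx !orbT.
have dbt : d <= b - t by rewrite /d !ge_min lexx !orbT.
have HL y : t - d < y -> y < t -> `|V y - L| < e / 2.
  move=> ty yt; rewrite distrC; apply: H1 => //=; rewrite ger0_norm; lra.
have HR y : t < y -> y < t + d -> `|V y - L| < e / 2.
  move=> ty yt; rewrite distrC; apply: H2 => //=; rewrite ler0_norm; lra.
have Ht : `|V t - L| < e / 2.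
  have := HL (t - d / 2); have := HR (t + d / 2).
  have v1 : V (t - d / 2) <= V t by apply: Vle; lra.
  have v2 : V t <= V (t + d / 2) by apply: Vle; lra.
  have l1 : t < t + d / 2 by lra.
  have l2 : t + d / 2 < t + d by lra.
  have l3 : t - d < t - d / 2 by lra.
  have l4 : t - d / 2 < t by lra.
  move=> /(_ l1 l2) + /(_ l3 l4); rewrite !ltr_norml => /andP[_ h1] /andP[h2 _].
  by apply/andP; split; lra.
have He y : `|V y - L| < e / 2 -> `|V y - V t| <= e.
  move=> Hy; have -> : V y - V t = (V y - L) - (V t - L) by ring.
  by rewrite (le_trans (ler_normB _ _))// [leRHS]splitr ltW// ltrD.
exists d => // y /=; rewrite ltr_distlC => /andP[ty yt].
have [yt'|yt'|->] := ltgtP y t; last by rewrite subrr normr0 ltW.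
  apply: le_trans (He y (HL y ty yt')).
  have ay : a <= y by lra.
  by apply: le_trans (VB y t ay (ltW yt') (ltW tb)) _; rewrite distrC ler_norm.
apply: le_trans (He y (HR y yt' yt)).
have yb : y <= b by lra.
by rewrite distrC; apply: le_trans (VB t y (ltW at_) (ltW yt') yb) _; rewrite ler_norm.
Unshelve. all: by end_near. Qed.

Lemma rV_cvg (R : realType) (n : nat) (U : Type) (F : set_system U) (FF : Filter F)
    (x : U -> 'rV[R]_n) (l : 'rV[R]_n) :
  (forall k, (fun t => x t ord0 k) @ F --> l ord0 k) -> x @ F --> l.
Proof.
move=> H; apply/cvgrPdist_le => e e0.
have : \forall t \near F, forall k, `|l ord0 k - x t ord0 k| <= e.
  by apply: filter_forall => k; have /cvgrPdist_le/(_ e e0) := H k.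
apply: filterS => t tk; apply: rV_norm_le => [|k]; first exact: ltW.
by rewrite !mxE.
Qed.

Lemma BV_vec_cocountable_continuous (R : realType) (n : nat) (a b : R) (x : R -> 'rV[R]_n) :
  a < b -> BV_vec a b x ->
  exists2 D : set R, countable D &
    forall t, a < t < b -> ~ D t -> {for t, continuous x}.
Proof.
move=> ab bvx.
have H k : exists D : set R, countable D /\
    forall t, a < t < b -> ~ D t -> {for t, continuous (fun t => x t ord0 k)}.
  by have [D cD HD] := BV_cocountable_continuous ab (bvx k); exists D.
have [D HD] := choice H.
exists (\bigcup_k D k).
  by apply: bigcup_countable => // k _; have [] := HD k.
move=> t tab Dt; apply: rV_cvg => k; apply: (HD k).2 => // Dkt; apply: Dt.
by exists k.
Qed.

(** The bad times are the discontinuities of x and their translates by h, both countable. *)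
Lemma delayed_measurable (R : realType) (n : nat) (a b h p q : R) (x : R -> 'rV[R]_n)
    (F : 'rV[R]_n * 'rV[R]_n -> 'rV[R]_n) :
  a < b -> BV_vec a b x -> continuous F ->
  a <= p - h -> a <= p -> q - h <= b -> q <= b ->
  forall k, measurable_fun (`]p, q[ : set (measurableTypeR R))
    (fun t => F (x t, x (t - h)) ord0 k).
Proof.
move=> ab bvx cF aph ap qhb qb k.
have [D cD HD] := BV_vec_cocountable_continuous ab bvx.
apply: (@measurable_fun_cocountable _ _ _ (D `|` [set t + h | t in D])).
  rewrite -bigcup2E; apply: bigcup_countable => // -[|[|?]] _ /=; [exact: cD| |exact: countable0].
  by apply: sub_countable cD; exact: card_image_le.
move=> t /andP[pt tq] /not_orP[Dt Dth].
have c1 : {for t, continuous x}.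
  by apply: HD => //; rewrite (le_lt_trans ap) ?(lt_le_trans tq).
have c2 : {for t - h, continuous x}.
  apply: HD => [|Dt']; first by apply/andP; split; lra.
  by apply: Dth; exists (t - h) => //; rewrite subrK.
have c3 : (fun s => x (s - h)) @ t --> x (t - h).
  apply: (@cvg_comp _ _ _ (fun s : R => s - h) x _ (nbhs (t - h))) => //.
  by apply: cvgB; [exact: cvg_id|exact: cvg_cst].
have c4 : (fun s => (x s, x (s - h))) @ t --> (x t, x (t - h)).
  exact: (@cvg_pair _ _ _ (nbhs t) (nbhs (x t)) (nbhs (x (t - h))) _ _ _ _ _ c1 c3).
have c5 : (fun s => F (x s, x (s - h))) @ t --> F (x t, x (t - h)).
  exact: (cvg_comp _ _ c4 (cF _)).
have c6 := @coord_continuous R 1 n ord0 k (F (x t, x (t - h))).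
exact: (cvg_comp _ _ c5 c6).
Qed.

(** The punctured neighbourhoods decrease to the empty set. Leaving out b itself is what removes a
    possible atom there. *)
Lemma thin_interval (R : realType) (mu : {finite_measure set (measurableTypeR R) -> \bar R})
    (b e : R) : 0 < e ->
  exists2 d, 0 < d & fine (mu `]b - d, b[%classic) + fine (mu `]b, b + d[%classic) < e.
Proof.
move=> e0.
pose q (k : nat) : R := k.+1%:R^-1.
pose F (k : nat) : set (measurableTypeR R) :=
  `]b - q k, b[ `|` `]b, b + q k[.
have mF k : measurable (F k) by exact: measurableU.
have kle (k l : nat) : (k <= l)%N -> q l <= q k.
  by move=> kl; rewrite /q lef_pV2 ?posrE// ler_nat.
have nF : nonincreasing_seq F.
  move=> k l kl; apply/subsetPset => t /= [|] /=; rewrite !in_itv/= => /andP[h1 h2].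
    left; rewrite /= in_itv/= h2 andbT (le_lt_trans _ h1)// lerD2l lerN2.
    exact: kle.
  right; rewrite /= in_itv/= h1/= (lt_le_trans h2)// lerD2l.
  exact: kle.
have F0 : \bigcap_k F k = set0.
  apply/seteqP; split=> // t Ft.
  have tb : t <> b.
    by move=> tb; have := Ft 0%N I; rewrite tb => -[] /=; rewrite in_itv/= ltxx ?andbF.
  have tb0 : 0 < `|t - b| by rewrite normr_gt0 subr_eq0; apply/eqP.
  have [k kt] := ltr_add_invr tb0; rewrite add0r -/(q k) in kt.
  have := Ft k I => -[] /=; rewrite in_itv/= => /andP[h1 h2].
    by move: kt; rewrite ler0_norm; lra.
  by move: kt; rewrite ger0_norm; lra.
have Fy : (mu (F 0%N) < +oo)%E by rewrite -ge0_fin_numE//; exact: fin_num_measure.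
have := nonincreasing_cvg_mu Fy mF _ nF; rewrite F0 measure0 => /(_ measurable0) H.
have {}H : fine (mu (F k)) @[k --> \oo] --> (0 : R).
  by apply: fine_cvg.
have [k _ /(_ k (leqnn k))] := (cvgrPdist_lt _ _).1 H e e0.
rewrite sub0r normrN ger0_norm ?fine_ge0// => Hk.
exists (q k); first by rewrite invr_gt0.
rewrite -fineD ?fin_num_measure// -measureU//.
apply/seteqP; split=> // t /= []; rewrite !in_itv/= => /andP[_ tb] /andP[bt _].
by have := lt_trans tb bt; rewrite ltxx.
Qed.

Lemma thin_intervals (R : realType) (mu : {finite_measure set (measurableTypeR R) -> \bar R})
    (N : nat) (b : nat -> R) (e : R) : 0 < e ->
  exists2 d, 0 < d & forall i, (i < N)%N ->
    fine (mu `]b i - d, b i[%classic) + fine (mu `]b i, b i + d[%classic) < e.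
Proof.
move=> e0; elim: N => [|N [d d0 IH]]; first by exists 1.
have [d' d'0 H] := thin_interval mu (b N) e0.
have mono (x p q : R) : p <= q ->
    fine (mu `]x - p, x[%classic) + fine (mu `]x, x + p[%classic) <=
    fine (mu `]x - q, x[%classic) + fine (mu `]x, x + q[%classic).
  move=> pq; apply: lerD; apply: fine_le; rewrite ?fin_num_measure//;
    apply: le_measure; rewrite ?inE//.
    by apply: subset_itvr; rewrite bnd_simp lerD2l lerN2.
  by apply: subset_itvl; rewrite bnd_simp lerD2l.
exists (Num.min d d'); first by rewrite lt_min d0.
move=> i; rewrite ltnS leq_eqVlt => /orP[/eqP ->|iN].
  by apply: le_lt_trans H; apply: mono; rewrite ge_min lexx orbT.
by apply: le_lt_trans (IH i iN); apply: mono; rewrite ge_min lexx.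
Qed.

Lemma thin_intervals_sum (R : realType)
    (mu : {finite_measure set (measurableTypeR R) -> \bar R})
    (N : nat) (b : nat -> R) (e : R) : 0 < e ->
  exists2 d, 0 < d &
    \sum_(1 <= i < N.+1) fine (mu `]b i - d, b i[%classic) <= e /\
    \sum_(1 <= i < N.+1) fine (mu `]b i, b i + d[%classic) <= e.
Proof.
move=> e0.
have N1 : 0 < N%:R + 1 :> R by rewrite ltr_wpDl.
(* The index N.+1 includes b N, and the denominator N + 1 is positive whatever N is. *)
have [d d0 H] := thin_intervals mu N.+1 b (divr_gt0 e0 N1).
have sume : \sum_(1 <= i < N.+1) (e / (N%:R + 1)) <= e.
  rewrite sumr_const_nat subSS subn0 -[leLHS]mulr_natl mulrA ler_pdivrMr// mulrC.
  by rewrite ler_wpM2l ?(ltW e0)// lerDl.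
exists d => //; split; apply: le_trans sume;
  rewrite big_nat [leRHS]big_nat; apply: ler_sum => i /andP[_ iN];
  apply: le_trans (ltW (H i iN)).
  by rewrite lerDl fine_ge0.
by rewrite lerDr fine_ge0.
Qed.

(** * From processes to arcs *)

(* Graph completion of a process on the common clock [S * u]: [th u] is the time
   in [0, h], [eta i u] the mass of the measure spent on the i-th window
   [(i-1)h, ih] and [y i u] the state there. *)
Record space_time_arc (R : realType) (n N : nat) (h K M : R) (x0 xi0 : 'rV[R]_n)
    (S : R) (th : R -> R) (eta : nat -> R -> R) (y : nat -> R -> 'rV[R]_n) : Prop :=
  SpaceTimeArc {
  sta_S : h <= S <= h + K ;
  sta_th0 : th 0 = 0 ;
  sta_th1 : th 1 = h ;
  sta_eta0 : forall i, (1 <= i <= N)%N -> eta i 0 = 0 ;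
  sta_th_nd : forall u v, 0 <= u -> u <= v -> v <= 1 -> th u <= th v ;
  sta_eta_nd : forall i u v, (1 <= i <= N)%N -> 0 <= u -> u <= v -> v <= 1 ->
    eta i u <= eta i v ;
  sta_sum : forall u, 0 <= u <= 1 -> th u + \sum_(1 <= i < N.+1) eta i u = S * u ;
  sta_y0 : forall u, 0 <= u <= 1 -> y 0%N u = xi0 ;
  sta_start : y 1%N 0 = x0 ;
  sta_link : forall i, (1 <= i < N)%N -> y i.+1 0 = y i 1 ;
  sta_lip : forall i u v, (1 <= i <= N)%N -> 0 <= u -> u <= v -> v <= 1 ->
    `|y i v - y i u| <= M * (th v - th u + (eta i v - eta i u))
}.

(* The relation dy_i = f dth + g deta_i, stated without integrals so that it
   passes to pointwise limits of arcs. *)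
Definition arc_dynamics (R : realType) (n N : nat) (f g : 'rV[R]_n * 'rV[R]_n -> 'rV[R]_n)
    (th : R -> R) (eta : nat -> R -> R) (y : nat -> R -> 'rV[R]_n) : Prop :=
  forall i u v cf cg e, (1 <= i <= N)%N -> 0 <= u -> u <= v -> v <= 1 -> 0 <= e ->
  (forall t, u <= t <= v -> `|f (y i t, y i.-1 t) - cf| <= e /\
                            `|g (y i t, y i.-1 t) - cg| <= e) ->
  `|y i v - y i u - (th v - th u) *: cf - (eta i v - eta i u) *: cg|
    <= e * (th v - th u + (eta i v - eta i u)).

Section forward.
Context (R : realType) (n N : nat) (h T M : R) (x0 xi0 : 'rV[R]_n)
  (f g : 'rV[R]_n * 'rV[R]_n -> 'rV[R]_n) (x : R -> 'rV[R]_n)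
  (mu : {finite_measure set (measurableTypeR R) -> \bar R})
  (w : R -> nat -> R -> R) (zeta : R -> nat -> R -> 'rV[R]_n).
Local Notation leb := (@lebesgue_measure R).
Hypothesis h0 : 0 < h.
Hypothesis TE : T = N%:R * h.
Hypothesis fc : continuous f.
Hypothesis gc : continuous g.
Hypothesis M0 : 0 <= M.
Hypothesis fM : forall z, `|f z| <= M.
Hypothesis gM : forall z, `|g z| <= M.
Hypothesis bvx : BV_vec (- h) T x.
Hypothesis icw : impulsive_control N h T mu w.
Hypothesis hist : forall t : R, - h <= t < 0 -> x t = xi0.
Hypothesis af : attached_family N h x0 xi0 g x w zeta.

Local Notation c i := (i.-1%:R * h).
Local Notation P r i s := (primitive01 (w r i) s).

(** Almost everywhere equal to the sum of the controls at r: the constant speed at which the clock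
    runs through the jump common to all windows. *)
Definition weight_mass (r : R) : R := \sum_(1 <= i < N.+1) P r i 1.
Local Notation m := weight_mass.

Let wm r i : 0 <= r <= h -> (1 <= i <= N)%N ->
  measurable_fun (`[0, 1] : set (measurableTypeR R)) (w r i).
Proof. exact: ic_measurable icw r i. Qed.

Let w0 r i : 0 <= r <= h -> (1 <= i <= N)%N -> forall s : R, 0 <= s <= 1 -> 0 <= w r i s.
Proof. by move=> rh iN s; exact: ic_ge0 icw r i s rh iN. Qed.

Let padT r i : (1 <= i <= N)%N -> pad N w r i = w r i.
Proof. by move=> iN; apply/funext => s; rewrite /pad iN. Qed.

Let padF r i : ~~ (1 <= i <= N)%N -> pad N w r i = cst 0.
Proof. by move=> /negbTE iN; apply/funext => s; rewrite /pad iN. Qed.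

Let padm r i : 0 <= r <= h ->
  measurable_fun (`[0, 1] : set (measurableTypeR R)) (pad N w r i).
Proof.
move=> rh; have [iN|iN] := boolP (1 <= i <= N)%N; first by rewrite padT//; exact: wm.
by rewrite padF//; exact: measurable_cst.
Qed.

Let pad0 r i s : 0 <= r <= h -> 0 <= s <= 1 -> 0 <= pad N w r i s.
Proof. by move=> rh s01; rewrite /pad; case: ifPn => // iN; exact: w0. Qed.

Let rh0 : 0 <= (0 : R) <= h. Proof. by rewrite lexx ltW. Qed.
Let rhh : 0 <= h <= h. Proof. by rewrite lexx ltW. Qed.

Let pad_integral i : (i <= N)%N ->
  (\int[leb]_(s in `[0%R, 1%R]) (pad N w h i s)%:E
   + \int[leb]_(s in `[0%R, 1%R]) (pad N w 0 i.+1 s)%:E = mu [set (i%:R * h)%R])%E.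
Proof.
move=> iN; have H := ic_grid icw iN; rewrite -{}H; symmetry.
under eq_integral do rewrite EFinD.
rewrite ge0_integralD//=.
- by move=> s; rewrite in_itv/= => s01; rewrite lee_fin pad0.
- by apply/measurable_EFinP; exact: padm.
- by move=> s; rewrite in_itv/= => s01; rewrite lee_fin pad0.
- by apply/measurable_EFinP; exact: padm.
Qed.

Let padfin r i : 0 <= r <= h -> (0 <= \int[leb]_(s in `[0%R, 1%R]) (pad N w r i s)%:E)%E.
Proof.
by move=> rh; apply: integral_ge0 => s /=; rewrite in_itv/= => s01; rewrite lee_fin pad0.
Qed.

(** At r = 0 and r = h only the sum of two neighbouring integrals is an atom of mu; each of the two,
    being nonnegative, is bounded by that atom. *)
Let wfin r i : 0 <= r <= h -> (1 <= i <= N)%N ->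
  (\int[leb]_(s in `[0%R, 1%R]) (w r i s)%:E < +oo)%E.
Proof.
move=> /andP[r0 rh] iN; have /andP[i1 iN'] := iN.
have [rh'|rh'|->] := ltgtP r h; last first.
- have := pad_integral iN'.
  rewrite (padT h iN).
  move=> H; apply: (@le_lt_trans _ _ (mu [set (i%:R * h)])).
    by rewrite -H leeDl// padfin.
  by rewrite -ge0_fin_numE//; exact: fin_num_measure.
- by rewrite leNgt rh' in rh.
have [r0'|r0'] := eqVneq r 0; last first.
  rewrite (ic_interior icw)//; last by rewrite lt_neqAle eq_sym r0' r0.
  by rewrite -ge0_fin_numE//; exact: fin_num_measure.
have iN2 : (i.-1 <= N)%N by rewrite (leq_trans (leq_pred _)).
have := pad_integral iN2; rewrite prednK//.
rewrite (padT 0 iN).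
move=> H; apply: (@le_lt_trans _ _ (mu [set (i.-1%:R * h)])).
  by rewrite -H r0' leeDr// padfin.
by rewrite -ge0_fin_numE//; exact: fin_num_measure.
Qed.

Let P_1 r i : 0 <= r <= h -> (1 <= i <= N)%N ->
  (\int[leb]_(s in `[0%R, 1%R]) (w r i s)%:E)%E = (P r i 1)%:E.
Proof. by move=> rh iN; apply: primitive01_1; [exact: wm|exact: w0|exact: wfin]. Qed.

Let P_nd r i s t : 0 <= r <= h -> (1 <= i <= N)%N -> 0 <= s -> s <= t -> t <= 1 ->
  P r i s <= P r i t.
Proof. by move=> rh iN; apply: primitive01_nondecreasing; [exact: wm|exact: w0|exact: wfin]. Qed.

Let P_ge0 r i s : 0 <= r <= h -> (1 <= i <= N)%N -> 0 <= s <= 1 -> 0 <= P r i s.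
Proof.
by move=> rh iN /andP[s_0 s_1]; rewrite -(primitive01_0 (w r i)); exact: P_nd.
Qed.

Let m_ge0 r : 0 <= r <= h -> 0 <= m r.
Proof.
by move=> rh; rewrite /m big_nat sumr_ge0// => i iN; apply: P_ge0; rewrite ?ler01 ?lexx.
Qed.

Let w_sum r : 0 <= r <= h -> {ae leb, forall s : R, 0 <= s <= 1 ->
  \sum_(1 <= i < N.+1) w r i s = m r}.
Proof.
move=> rh; have := ic_sum icw rh.
apply: filterS; first exact: (ae_filter_ringOfSetsType leb).
move=> s H s01; have := H s01.
rewrite [in X in _ = X -> _]big_nat (eq_bigr (fun i => (P r i 1)%:E)).
  by rewrite -big_nat sumEFin => -[].
by move=> i iN; exact: P_1.
Qed.

Let w_le r i : 0 <= r <= h -> (1 <= i <= N)%N ->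
  {ae leb, forall s : R, 0 <= s <= 1 -> w r i s <= m r}.
Proof.
move=> rh iN; have := w_sum rh.
apply: filterS; first exact: (ae_filter_ringOfSetsType leb).
move=> s H s01; rewrite -(H s01).
rewrite (bigD1_seq i)//= ?mem_index_iota ?iota_uniq//.
by rewrite lerDl big_nat_cond sumr_ge0// => k /andP[kN _]; exact: w0.
Qed.

Let P_lip r i s t : 0 <= r <= h -> (1 <= i <= N)%N -> 0 <= s -> s <= t -> t <= 1 ->
  P r i t - P r i s <= m r * (t - s).
Proof.
move=> rh iN; apply: primitive01_lipschitz; [exact: wm|exact: w0|exact: wfin|].
exact: w_le.
Qed.

(** The normalisation of the controls makes the total mass linear in s, which is why the affine
    [clock r] is the right clock inside a jump. *)
Let P_sum r s : 0 <= r <= h -> 0 <= s <= 1 ->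
  \sum_(1 <= i < N.+1) P r i s = m r * s.
Proof.
move=> rh /andP[s_0 s_1].
have F : Filter (almost_everywhere leb) by exact: (ae_filter_ringOfSetsType leb).
have sub : `[0, s]%classic `<=` `[0, 1]%classic.
  by apply: subset_itvl; rewrite bnd_simp.
have sub01 (u : R) : `[0, s]%classic u -> 0 <= u <= 1 by move=> /sub; rewrite /= in_itv.
apply: EFin_inj; rewrite -sumEFin.
rewrite big_nat (eq_bigr (fun i => \int[leb]_(u in `[0%R, s]) (pad N w r i u)%:E)%E); last first.
  move=> i iN; rewrite /primitive01 /Rintegral fineK; last first.
    apply: integrable_fin_num => //.
    by apply: integrable_unit_patch => //; [exact: wm|exact: w0|exact: wfin].
  apply: eq_integral => u; rewrite inE => us.
  by rewrite patchE mem_set ?padT//; exact: sub.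
rewrite -big_nat -ge0_integral_sum//; last 2 first.
- move=> i; apply/measurable_EFinP; apply: measurable_funS (padm i rh) => //.
- by move=> i u /sub01 u01; rewrite lee_fin pad0.
have -> : ((m r * s)%:E = \int[leb]_(u in `[0%R, s]) (m r)%:E)%E.
  rewrite integral_cst//= lebesgue_measure_itv/= lte_fin EFinM.
  move: s_0; rewrite le_eqVlt => /orP[/eqP <-|->]; first by rewrite ltxx.
  by rewrite oppr0 adde0.
apply: ge0_ae_eq_integral => //.
- apply: emeasurable_sum => i; apply/measurable_EFinP.
  by apply: measurable_funS (padm i rh).
- by move=> u /sub01 u01; rewrite sume_ge0// => i _; rewrite lee_fin pad0.
- by move=> u _; rewrite lee_fin m_ge0.
- apply: filterS (w_sum rh) => u H /sub01 u01; rewrite sumEFin -(H u01).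
  congr EFin; rewrite big_nat [RHS]big_nat; apply: eq_bigr => i iN.
  by rewrite padT.
Qed.

Let jump_est r i s t cg e : 0 <= r <= h -> (1 <= i <= N)%N ->
  0 <= s -> s <= t -> t <= 1 -> 0 <= e ->
  (forall u, s <= u <= t -> u < 1 -> `|g (zeta r i u, zeta r i.-1 u) - cg| <= e) ->
  `|zeta r i t - zeta r i s - (P r i t - P r i s) *: cg| <= e * (P r i t - P r i s).
Proof.
move=> rh iN s_0 st t_1 e0 H.
apply: rV_norm_le => [|k].
  by rewrite mulr_ge0// subr_ge0 P_nd.
rewrite !mxE [_ * cg _ _]mulrC.
apply: (@jump_estimate _ (w r i) (fun u => zeta r i u ord0 k)
  (fun u => g (zeta r i u, zeta r i.-1 u) ord0 k) (m r)) => //.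
- exact: wm.
- exact: w0.
- exact: wfin.
- exact: w_le.
- apply: (@ac_dominated _ _ _ _ _ 0 (zeta r i)); first exact: (af_ac af rh iN).
  move=> u v *; rewrite mul0r addr0.
  by have := rV_norm_ge (zeta r i v - zeta r i u) k; rewrite !mxE.
- have := af_ode af rh iN.
  apply: filterS; first exact: (ae_filter_ringOfSetsType leb).
  move=> u Hu /Hu /is_derive1P D; apply/is_derive1P => e' e'0.
  have [d d0 dP] := D e' e'0; exists d => // u' /dP; apply: le_trans.
  have := rV_norm_ge (zeta r i u' - zeta r i u
    - (u' - u) *: (w r i u *: g (zeta r i u, zeta r i.-1 u))) k.
  by rewrite !mxE.
- move=> u ust u1; apply: le_trans (H u ust u1).
  by have := rV_norm_ge (g (zeta r i u, zeta r i.-1 u) - cg) k; rewrite !mxE.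
Qed.

Let jump_lip r i s t : 0 <= r <= h -> (1 <= i <= N)%N ->
  0 <= s -> s <= t -> t <= 1 -> `|zeta r i t - zeta r i s| <= M * (P r i t - P r i s).
Proof.
move=> rh iN s_0 st t_1.
(* Against the vector 0 the tolerance M is always met. *)
have := @jump_est r i s t 0 M rh iN s_0 st t_1 M0.
by rewrite scaler0 subr0; apply => u _ _; rewrite subr0.
Qed.

(** Distinct s share a clock value when [m r] vanishes; mass and state do not move between them, so
    both are functions of the clock. *)
Let jump_stat r i s t : 0 <= r <= h -> (1 <= i <= N)%N ->
  0 <= s <= 1 -> 0 <= t <= 1 -> m r * s = m r * t ->
  P r i s = P r i t /\ zeta r i s = zeta r i t.
Proof.
move=> rh iN.
wlog st : s t / s <= t.
  move=> H s01 t01 mst; have [st|ts] := leP s t; first exact: H.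
  by have [-> ->] := H t s (ltW ts) t01 s01 (esym mst).
move=> /andP[s_0 s_1] /andP[t_0 t_1] mst.
have PP : P r i t - P r i s = 0.
  apply/eqP; rewrite eq_le subr_ge0 P_nd// andbT.
  by rewrite (le_trans (P_lip rh iN s_0 st t_1))// mulrBr mst subrr.
have := jump_lip rh iN s_0 st t_1; rewrite PP mulr0 normr_le0 subr_eq0 => /eqP ->.
by split=> //; apply/eqP; rewrite eq_sym -subr_eq0 PP.
Qed.

Let jmass r i : 0 < r < h -> (1 <= i <= N)%N -> P r i 1 = fine (mu [set r + c i]).
Proof.
move=> rh iN; rewrite -(ic_interior icw rh iN) P_1//.
by have /andP[? ?] := rh; rewrite !ltW.
Qed.

Hypothesis st2 : forall i (t : R), (1 <= i <= N)%N -> i.-1%:R * h < t < i%:R * h ->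
  x t = zeta 0 i 1
    + Rintegral_vec leb `[i.-1%:R * h, t] (fun t' => f (x t', x (t' - h)))
    + Rintegral_vec (cont_part mu) `[i.-1%:R * h, t]
        (fun t' => g (x t', x (t' - h)))
    + unordered_sum `]0, t - i.-1%:R * h]
        (fun r => zeta r i 1 - left_lim x (r + i.-1%:R * h)).
Hypothesis st3 : x T = zeta h N 1.

Local Notation jmp i := (fun r => zeta r i 1 - zeta r i 0).
Local Notation imp i := (impulse mu (c i) (fun t => f (x t, x (t - h)))
  (fun t => g (x t, x (t - h))) (jmp i)).

Let cS i : (1 <= i)%N -> c i + h = i%:R * h.
Proof. by move=> i1; rewrite -{2}(prednK i1) -natr1 mulrDl mul1r. Qed.

Let c_ge0 i : 0 <= c i. Proof. by rewrite mulr_ge0// ltW. Qed.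

Let cS_le i : (1 <= i <= N)%N -> c i + h <= T.
Proof. by move=> /andP[i1 iN]; rewrite cS// TE ler_wpM2r ?(ltW h0)// ler_nat. Qed.

Let Fmeas i (F : 'rV[R]_n * 'rV[R]_n -> 'rV[R]_n) : (1 <= i <= N)%N -> continuous F ->
  forall k, measurable_fun (`]c i, c i + h[ : set (measurableTypeR R))
    (fun t : R => F (x t, x (t - h)) ord0 k).
Proof.
move=> iN cF; move: (cS_le iN) (c_ge0 i); move: (c i) => ci ciT ci0.
apply: (delayed_measurable (a := - h) (b := T)) => //.
- by rewrite (lt_le_trans _ ciT)// (@lt_le_trans _ _ 0) ?oppr_lt0// addr_ge0// ltW.
- by rewrite lerDr.
- by rewrite (@le_trans _ _ 0)// oppr_le0 ltW.
- by rewrite addrK (le_trans _ ciT)// lerDl ltW.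
Qed.

Let jmp_bd i : (1 <= i <= N)%N ->
  forall r : R, 0 < r < h -> `|zeta r i 1 - zeta r i 0| <= M * fine (mu [set r + c i]).
Proof.
move=> iN r rh; have rh' : 0 <= r <= h by have /andP[? ?] := rh; rewrite !ltW.
rewrite -jmass//; have := jump_lip rh' iN (lexx 0) ler01 (lexx 1).
by rewrite primitive01_0 subr0.
Qed.

Let imp_bd i a b : (1 <= i <= N)%N -> 0 <= a -> a <= b -> b <= h ->
  `|imp i a b| <= M * (b - a + fine (mu `]a + c i, b + c i[%classic)).
Proof.
move=> iN a0 ab bh.
have := @impulse_estimate R n mu (c i) h M _ _ _ M0 (Fmeas iN fc) (Fmeas iN gc)
  (fun t _ => fM _) (fun t _ => gM _) (jmp_bd iN) a b M 0 0 a0 ab bh M0.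
rewrite !scaler0 !subr0; apply => r /andP[ar rb].
by rewrite !scaler0 !subr0 jmp_bd// (le_lt_trans a0 ar) (lt_le_trans rb bh).
Qed.

Let state_formula i b : (1 <= i <= N)%N -> 0 < b < h ->
  x (b + c i) = zeta 0 i 1 + imp i 0 b + (zeta b i 1 - zeta b i 0).
Proof.
move=> iN /andP[b0 bh]; have /andP[i1 _] := iN.
rewrite (st2 iN); last by rewrite ltrDr b0/= -(cS i1) addrC ltrD2l.
have E := impulse_closed M0 (Fmeas iN fc) (Fmeas iN gc)
  (fun t _ => fM _) (fun t _ => gM _) (jmp_bd iN) b0 bh.
rewrite addrK -[RHS]addrA -{}E -!addrA; congr (_ + (_ + (_ + _))).
apply: eq_unordered_sum => r /=; rewrite in_itv/= => /andP[r0 rb].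
by rewrite (af_start af)// r0 (le_trans rb (ltW bh)).
Qed.

(** At a time t shortly before b + c_i the state differs from the claimed limit by the impulse over
    the remaining interval. This is at most M times its length plus its mass, both small by
    [thin_interval]. *)
Let left_limit i b : (1 <= i <= N)%N -> 0 < b <= h ->
  zeta b i 0 = zeta 0 i 1 + imp i 0 b.
Proof.
move=> iN bh; rewrite (af_start af)//; have /andP[b0 bh'] := bh.
apply: cvg_lim => //; apply/cvgrPdist_le => e e0.
have M1 : 0 < M + 1 by rewrite ltr_wpDl.
have e20 : 0 < e / (M + 1) / 2 by rewrite !divr_gt0.
have [d d0 dmu] := thin_interval mu (b + c i) e20.
near=> t.
have tb : t < b + c i by near: t; exact: nbhs_left_lt.
have t0 : c i < t by near: t; apply: nbhs_left_gt; rewrite ltrDr.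
have td : b + c i - d < t by near: t; apply: nbhs_left_gt; rewrite ltrBlDr ltrDl.
have te : b + c i - e / (M + 1) / 2 < t.
  by near: t; apply: nbhs_left_gt; rewrite ltrBlDr ltrDl.
pose a := t - c i; have ta : t = a + c i by rewrite subrK.
have a0 : 0 < a by rewrite subr_gt0.
have ab : a < b by rewrite /a ltrBlDr.
rewrite ta state_formula//; last by rewrite a0 (lt_le_trans ab).
rewrite (impulse_split M0 (Fmeas iN fc) (Fmeas iN gc) (fun t _ => fM _) (fun t _ => gM _)
  (jmp_bd iN) (lexx 0) a0 ab bh').
set I1 := imp i 0 a; set I2 := imp i a b; set J := zeta a i 1 - zeta a i 0.
have -> : zeta 0 i 1 + (I1 + J + I2) - (zeta 0 i 1 + I1 + J) = I2.
  by apply/rowP => k; rewrite !mxE; ring.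
apply: le_trans (imp_bd iN (ltW a0) (ltW ab) bh') _.
rewrite -ta.
have mle : fine (mu `]t, b + c i[%classic) <= fine (mu `]b + c i - d, b + c i[%classic).
  apply: fine_le; rewrite ?fin_num_measure//; apply: le_measure; rewrite ?inE//.
  by apply: subset_itvr; rewrite bnd_simp ltW.
have mge : 0 <= fine (mu `]b + c i, b + c i + d[%classic) by exact: fine_ge0.
have : b - a + fine (mu `]t, b + c i[%classic) <= e / (M + 1).
  rewrite (splitr (e / (M + 1))) lerD//; first by rewrite /a; lra.
  by apply: (le_trans mle); move: dmu; lra.
rewrite ler_pdivlMr// mulrC; apply: le_trans.
apply: ler_wpM2r; last by rewrite lerDl.
by rewrite addr_ge0 ?fine_ge0// subr_ge0 ltW.
Unshelve. all: by end_near. Qed.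

Let state_value i b : (1 <= i <= N)%N -> 0 < b < h -> x (b + c i) = zeta b i 1.
Proof.
move=> iN bh; rewrite state_formula// -left_limit ?subrKC//.
by have /andP[-> /ltW->] := bh.
Qed.

(** In the first window the delayed state is the history, and b < h makes [zeta b 0 1] equal to xi0
    rather than x0. *)
Let delayed_value i b : (1 <= i <= N)%N -> 0 < b < h -> x (b + c i - h) = zeta b i.-1 1.
Proof.
move=> /andP[i1 iN] bh; have /andP[b0 bh'] := bh; have [i_1|i_1] := eqVneq i 1%N.
  rewrite i_1/= mul0r addr0 hist; last by rewrite ltrBlDr add0r bh' andbT; lra.
  by rewrite (af_initial af) ?bh' ?orbT ?ler01 ?lexx//; rewrite !ltW.
have i2 : (1 < i)%N by rewrite ltn_neqAle eq_sym i_1.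
have i1N : (1 <= i.-1 <= N)%N by rewrite -ltnS prednK// i2 (leq_trans (leq_pred _)).
have -> : b + c i - h = b + c i.-1.
  have /andP[i11 _] := i1N; have := cS i11; lra.
exact: state_value.
Qed.

Let imp_identity i a b : (1 <= i <= N)%N -> 0 <= a -> a < b -> b <= h ->
  zeta b i 0 = zeta a i 1 + imp i a b.
Proof.
move=> iN a0 ab bh; rewrite left_limit//; last by rewrite (le_lt_trans a0 ab).
move: a0; rewrite le_eqVlt => /orP[/eqP <-//|a0].
rewrite (impulse_split M0 (Fmeas iN fc) (Fmeas iN gc) (fun t _ => fM _) (fun t _ => gM _)
  (jmp_bd iN) (lexx 0) a0 ab bh) addrA; congr (_ + _).
rewrite addrA -left_limit; last 2 first.
- by [].
- by rewrite a0 (le_trans (ltW ab)).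
by rewrite addrC subrK.
Qed.

(** The integrals only see the value of zeta at s = 1, whereas each jump strictly between a and b
    runs through all s; hence the quantification over s in the hypothesis. *)
Let imp_est i a b cf cg e : (1 <= i <= N)%N -> 0 <= a -> a < b -> b <= h -> 0 <= e ->
  (forall r s, a < r < b -> 0 <= s <= 1 ->
     `|f (zeta r i s, zeta r i.-1 s) - cf| <= e /\
     `|g (zeta r i s, zeta r i.-1 s) - cg| <= e) ->
  `|zeta b i 0 - zeta a i 1 - (b - a) *: cf - fine (mu `]a + c i, b + c i[%classic) *: cg|
    <= e * (b - a + fine (mu `]a + c i, b + c i[%classic)).
Proof.
move=> iN a0 ab bh e0 H.
rewrite (imp_identity iN a0 ab bh) [_ + imp i a b]addrC addrK.
apply: (impulse_estimate M0 (Fmeas iN fc) (Fmeas iN gc)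
  (fun t _ => fM _) (fun t _ => gM _) (jmp_bd iN) a0 (ltW ab) bh e0) => r rab.
have /andP[ar rb] := rab.
have rh : 0 < r < h by rewrite (le_lt_trans a0 ar) (lt_le_trans rb bh).
have rh' : 0 <= r <= h by have /andP[? ?] := rh; rewrite !ltW.
have [H1 H2] := H r 1 rab (introT andP (conj ler01 (lexx 1))).
rewrite state_value// delayed_value//; split=> //.
rewrite -jmass//; have := @jump_est r i 0 1 cg e rh' iN (lexx 0) ler01 (lexx 1) e0.
rewrite primitive01_0 subr0; apply => u u01 _.
by have [] := H r u rab u01.
Qed.

(** The mass of window i strictly before the jump at r. For r > 0 it starts with [P 0 i 1], the
    share of the atom at the grid point c_i that falls to window i; the other share belongs to
    window i.-1. *)
Definition mass_before i r : R :=
  if r <= 0 then 0 else P 0 i 1 + fine (mu `]c i, c i + r[%classic).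
Local Notation A := mass_before.

Let A_split i a b : (1 <= i <= N)%N -> 0 <= a -> a < b -> b <= h ->
  A i b = A i a + P a i 1 + fine (mu `]a + c i, b + c i[%classic).
Proof.
move=> iN a0 ab bh; rewrite /A leNgt (le_lt_trans a0 ab)/=.
move: a0; rewrite le_eqVlt => /orP[/eqP <-|a0].
  by rewrite lexx add0r add0r [c i + b]addrC.
rewrite leNgt a0/= -!addrA; congr (_ + _).
rewrite jmass//; last by rewrite a0 (lt_le_trans ab bh).
rewrite (addrC a) (addrC b) -fineD ?fin_num_measure//.
have ca : c i < c i + a by rewrite ltrDl.
have cab : c i + a < c i + b by rewrite ltrD2l.
have D : (`]c i, c i + b[ = `]c i, c i + a[ `|` ([set c i + a] `|` `]c i + a, c i + b[))%classic.
  by rewrite setUA (setUC _ [set _]) -setUA; apply/seteqP; split=> r /=; rewrite !in_itv/=;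
    [|move=> [->|[/andP[h1 h2]|/andP[h1 h2]]]; rewrite ?ca ?cab ?h1 ?h2 ?(lt_trans h2)//
      ?(lt_trans ca)//]; move=> /andP[h1 h2];
    have [ra|ra|->] := ltgtP r (c i + a); [right; left; rewrite h1|right; right; rewrite h2|left].
rewrite D measureU//=; last 2 first.
- by apply: measurableU.
- apply/seteqP; split=> // r /= []; rewrite !in_itv/= => /andP[_ ra] [rr|/andP[ra' _]].
    by rewrite rr ltxx in ra.
  by have := lt_trans ra ra'; rewrite ltxx.
rewrite fineD ?fin_num_measure//; last by apply: measurableU.
congr (_ + fine _); rewrite measureU//.
apply/seteqP; split=> // r /= [->]; rewrite in_itv/= ltxx//.
Qed.

(* The point s of the jump at time r, simultaneous in all windows, is reached at
   the value [clock r s] of the common parameter. *)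
Definition clock r s : R := r + \sum_(1 <= i < N.+1) A i r + m r * s.
Local Notation S := (clock h 1).

Let clock00 : clock 0 0 = 0.
Proof.
by rewrite /clock mulr0 addr0 add0r big1// => i _; rewrite /A lexx.
Qed.

Let clock_split a b : 0 <= a -> a < b -> b <= h ->
  clock b 0 = clock a 1 + (b - a)
    + \sum_(1 <= i < N.+1) fine (mu `]a + c i, b + c i[%classic).
Proof.
move=> a0 ab bh; rewrite /clock mulr0 addr0 mulr1.
have -> : \sum_(1 <= i < N.+1) A i b = \sum_(1 <= i < N.+1)
    (A i a + P a i 1 + fine (mu `]a + c i, b + c i[%classic)).
  by rewrite big_nat [RHS]big_nat; apply: eq_bigr => i iN; exact: A_split.
by rewrite !big_split/= -/(m a); ring.
Qed.

Let clock_nd r s t : 0 <= r <= h -> s <= t -> clock r s <= clock r t.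
Proof. by move=> rh st; rewrite /clock lerD2l ler_wpM2l// m_ge0. Qed.

Let clock_lt a b s t : 0 <= a -> a < b -> b <= h -> 0 <= s <= 1 -> 0 <= t <= 1 ->
  clock a s < clock b t.
Proof.
move=> a0 ab bh /andP[_ s1] /andP[t0 _].
have ah : 0 <= a <= h by rewrite a0 (le_trans (ltW ab)).
have b0h : 0 <= b <= h by rewrite (le_trans a0 (ltW ab)).
apply: (le_lt_trans (clock_nd ah s1)); apply: (lt_le_trans _ (clock_nd b0h t0)).
rewrite (clock_split a0 ab bh) -addrA ltrDl ltr_wpDr ?subr_gt0// sumr_ge0// => i _.
exact: fine_ge0.
Qed.

Let grid_mass i : (i <= N)%N ->
  (if (1 <= i <= N)%N then P h i 1 else 0) + (if (1 <= i.+1 <= N)%N then P 0 i.+1 1 else 0)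
  = fine (mu [set i%:R * h]).
Proof.
move=> iN; rewrite -pad_integral//.
have E r k : 0 <= r <= h -> (\int[leb]_(s in `[0%R, 1%R]) (pad N w r k s)%:E
    = (if (1 <= k <= N)%N then P r k 1 else 0)%:E)%E.
  move=> rh; case: ifPn => kN; first by rewrite padT// P_1.
  by rewrite padF//= integral0.
by rewrite !E.
Qed.

(** Induction over the windows. The sum carries along [P 0 k.+1 1], the share of the atom at kh that
    falls to the next window; only with it is the mass of a closed interval obtained. *)
Let total_mass : S = h + fine (mu `[0, T]%classic).
Proof.
rewrite /clock mulr1 -addrA /m -big_split/=; congr (_ + _).
have H k : (k <= N)%N -> \sum_(1 <= i < k.+1) (A i h + P h i 1)
    + (if (1 <= k.+1 <= N)%N then P 0 k.+1 1 else 0) = fine (mu `[0, k%:R * h]%classic).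
  elim: k => [_|k IH kN].
    rewrite big_geq// add0r mul0r set_itv1.
    by have := grid_mass (leq0n N); rewrite /= add0r mul0r.
  have := grid_mass kN; rewrite /= kN => gk.
  have := IH (ltnW kN); rewrite /= kN => {}IH.
  rewrite big_nat_recr//=.
  have Ah : A k.+1 h = P 0 k.+1 1 + fine (mu `]k%:R * h, k%:R * h + h[%classic).
    by rewrite /A leNgt h0.
  rewrite Ah; set sm := \sum_(1 <= i < k.+1) _ in IH *.
  set mm := fine (mu `]_, _[%classic); set ql := if _ then _ else _ in gk *.
  have -> : sm + (P 0 k.+1 1 + mm + P h k.+1 1) + ql =
      (sm + P 0 k.+1 1) + (mm + (P h k.+1 1 + ql)) by ring.
  rewrite IH gk /mm.
  have kh : k%:R * h < k.+1%:R * h by rewrite ltr_pM2r// ltr_nat.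
  have kh0 : 0 <= k%:R * h by rewrite mulr_ge0// ltW.
  have -> : k%:R * h + h = k.+1%:R * h by rewrite -[k]/(k.+1.-1) cS.
  have D : (`[0, k.+1%:R * h] = `[0, k%:R * h] `|` (`]k%:R * h, k.+1%:R * h[
       `|` [set k.+1%:R * h]))%classic.
    apply/seteqP; split=> r /=; rewrite !in_itv/=.
      move=> /andP[r0 rk]; have [rk'|rk'] := leP r (k%:R * h); first by left; rewrite r0.
      move: rk; rewrite le_eqVlt => /orP[/eqP rk|rk]; first by right; right.
      by right; left; apply/andP.
    move=> [/andP[r0 rk]|[/andP[rk rk']|->]].
    - by rewrite r0 (le_trans rk (ltW kh)).
    - by rewrite (ltW rk') (le_trans kh0 (ltW rk)).
    - by rewrite lexx (le_trans kh0 (ltW kh)).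
  rewrite D measureU//=; last 2 first.
  - by apply: measurableU.
  - apply/seteqP; split=> // r /= []; rewrite !in_itv/= => /andP[_ rk] [/andP[kr _]|rr].
      by have := le_lt_trans rk kr; rewrite ltxx.
    by rewrite rr in rk; have := le_lt_trans rk kh; rewrite ltxx.
  rewrite fineD ?fin_num_measure//; last by apply: measurableU.
  congr (_ + _); rewrite measureU//.
    by rewrite fineD ?fin_num_measure.
  by apply/seteqP; split=> // r /= [+ rr]; rewrite rr in_itv/= ltxx andbF.
by have := H N (leqnn N); rewrite ltnn addr0 -TE => <-.
Qed.

(** The clock has no gaps apart from the jumps, since thin punctured neighbourhoods of the points q
    + c_i carry little mass. At the supremum q of the r with [clock r 0 <= z], the value z thus lies
    between [clock q 0] and [clock q 1], where the clock is affine in s. *)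
Let clock_surj z : 0 <= z <= S -> exists p : R * R,
  [/\ 0 <= p.1 <= h, 0 <= p.2 <= 1 & clock p.1 p.2 = z].
Proof.
move=> /andP[z0 zS].
pose E := [set r | 0 <= r <= h /\ clock r 0 <= z].
have E0 : E 0 by split; [rewrite lexx ltW|rewrite clock00].
have ubE : ubound E h by move=> r [/andP[]].
have supE : has_sup E by split; [exists 0|exists h].
set q := sup E.
have q0 : 0 <= q by apply: ub_le_sup => //; exists h.
have qh : q <= h by apply: ge_sup => //; exists 0.
have qq : 0 <= q <= h by rewrite q0.
have small (e : R) : 0 < e -> exists2 d, 0 < d <= e &
    (forall a, 0 <= a -> q - d < a -> a < q -> clock q 0 <= clock a 1 + e + e) /\
    (forall b, b <= h -> q < b -> b < q + d -> clock b 0 <= clock q 1 + e + e).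
  move=> e0; have [d d0 [H1 H2]] := thin_intervals_sum mu N (fun i => q + c i) e0.
  exists (Num.min d e); first by rewrite lt_min d0 e0 ge_min lexx orbT.
  split=> [a a0 qa aq|b bh qb bq].
    rewrite (clock_split a0 aq qh) -addrA -[leRHS]addrA lerD2l lerD//.
      by move: qa; rewrite ltrBlDr minEle; case: ifP; lra.
    apply: le_trans H1; apply: ler_sum => i _.
    apply: fine_le; rewrite ?fin_num_measure//; apply: le_measure; rewrite ?inE//.
    apply: subset_itvr; rewrite bnd_simp lerBlDr.
    have : q - d < a by rewrite (le_lt_trans _ qa)// lerD2l lerN2 ge_min lexx.
    by move: (c i) => ci; lra.
  rewrite (clock_split q0 qb bh) -addrA -[leRHS]addrA lerD2l lerD//.
    by move: bq; rewrite minEle; case: ifP; lra.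
  apply: le_trans H2; apply: ler_sum => i _.
  apply: fine_le; rewrite ?fin_num_measure//; apply: le_measure; rewrite ?inE//.
  apply: subset_itvl; rewrite bnd_simp.
  have : b < q + d by rewrite (lt_le_trans bq)// lerD2l ge_min lexx.
  by move: (c i) => ci; lra.
have c1 : clock q 0 <= z.
  have [->|qn0] := eqVneq q 0; first by rewrite clock00.
  have {}q0 : 0 < q by rewrite lt_neqAle eq_sym qn0.
  apply/ler_addgt0Pr => e e0; have e20 : 0 < e / 2 by rewrite divr_gt0.
  have [d /andP[d0 _] [H _]] := small _ e20.
  pose a := Num.max (q - d / 2) (q / 2).
  have a0 : 0 < a by rewrite lt_max divr_gt0 ?orbT.
  have aq : a < q by rewrite gt_max; apply/andP; split; lra.
  have qa : q - d < a by rewrite lt_max; apply/orP; left; lra.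
  have := H a (ltW a0) qa aq; rewrite -addrA -splitr => /le_trans; apply.
  rewrite lerD2r.
  have qa0 : 0 < q - a by rewrite subr_gt0.
  have [b [/andP[b0 bh] bz]] := sup_adherent qa0 supE; rewrite -/q subKr => ab.
  apply: le_trans bz; apply: ltW; apply: clock_lt => //; first exact: ltW.
    by rewrite ler01 lexx.
  by rewrite lexx ler01.
have c2 : z <= clock q 1.
  have [->//|qnh] := eqVneq q h.
  have {}qh : q < h by rewrite lt_neqAle qnh.
  apply/ler_addgt0Pr => e e0; have e20 : 0 < e / 2 by rewrite divr_gt0.
  have [d /andP[d0 _] [_ H]] := small _ e20.
  pose b := Num.min (q + d / 2) h.
  have bh : b <= h by rewrite ge_min lexx orbT.
  have qb : q < b by rewrite lt_min qh andbT; lra.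
  have bq : b < q + d by rewrite gt_min; apply/orP; left; lra.
  have := H b bh qb bq; rewrite -addrA -splitr; apply: le_trans.
  rewrite leNgt; apply/negP => bz.
  have : E b by split; [rewrite (le_trans q0 (ltW qb))|exact: ltW].
  by move=> /(ub_le_sup (ex_intro _ h ubE)); rewrite -/q leNgt qb.
have cq : clock q 1 = clock q 0 + m q by rewrite /clock mulr0 mulr1 addr0.
(* Without mass at q both ends of the jump have the clock value z, and s = 0 will do. *)
have [mq|mq] := eqVneq (m q) 0.
  exists (q, 0); split => //=; first by rewrite lexx ler01.
  by apply/eqP; rewrite eq_le c1/=; move: c2; rewrite cq mq addr0.
have mq0 : 0 < m q by rewrite lt_neqAle eq_sym mq m_ge0.
exists (q, (z - clock q 0) / m q); split => //=.
  by rewrite divr_ge0 ?subr_ge0 ?(ltW mq0)//= ler_pdivrMr// mul1r lerBlDl -cq.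
rewrite /clock mulrCA divff// mulr1.
by rewrite mulr0 addr0 addrC subrK.
Qed.

Let same_clock r s r' s' : 0 <= r <= h -> 0 <= s <= 1 -> 0 <= r' <= h -> 0 <= s' <= 1 ->
  clock r s = clock r' s' -> r = r' /\ m r * s = m r * s'.
Proof.
move=> rh s01 r'h s'01 cc; have /andP[r0 rh'] := rh; have /andP[r'0 r'h'] := r'h.
have [rr'|rr'|rr'] := ltgtP r r'.
- by have := clock_lt r0 rr' r'h' s01 s'01; rewrite cc ltxx.
- by have := clock_lt r'0 rr' rh' s'01 s01; rewrite cc ltxx.
- by split=> //; move: cc; rewrite /clock rr' => /addrI.
Qed.

Lemma process_arc K : fine (mu `[0, T]%classic) <= K -> (0 < N)%N ->
  exists S th eta y, [/\ space_time_arc N h K M x0 xi0 S th eta y,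
    arc_dynamics N f g th eta y & y N 1 = x T].
Proof.
move=> muK N0.
have S0 : 0 < S.
  by rewrite total_mass ltr_pwDl// fine_ge0.
have zS u : 0 <= u <= 1 -> 0 <= S * u <= S.
  by move=> /andP[u0 u1]; rewrite mulr_ge0 ?(ltW S0)//= ler_piMr// ltW.
have /choice[pt ptP] : forall u, exists p : R * R, 0 <= u <= 1 ->
    [/\ 0 <= p.1 <= h, 0 <= p.2 <= 1 & clock p.1 p.2 = S * u].
  move=> u; have [u01|u01] := pselect (0 <= u <= 1); last by exists (0, 0).
  by have [p pP] := clock_surj (zS u u01); exists p.
pose th u := (pt u).1.
pose eta i u := A i (pt u).1 + P (pt u).1 i (pt u).2.
(* For i = 0 the arc keeps xi0 throughout, whereas [zeta h 0 1] is x0. *)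
pose y i u := if i == 0%N then xi0 else zeta (pt u).1 i (pt u).2.
(* The choice of pt is harmless: the clock determines r, and determines s up to values between which
   mass and state rest. *)
have value u r s : 0 <= u <= 1 -> 0 <= r <= h -> 0 <= s <= 1 -> clock r s = S * u ->
    th u = r /\ forall i, (1 <= i <= N)%N -> eta i u = A i r + P r i s /\ y i u = zeta r i s.
  move=> u01 rh s01 cu; have [p1 p2 pu] := ptP u u01.
  have [pr ps] := same_clock p1 p2 rh s01 (etrans pu (esym cu)).
  split=> // i iN; have /andP[i1 _] := iN.
  have [e1 e2] := jump_stat p1 iN p2 s01 ps.
  by rewrite /eta /y gtn_eqF// e1 e2 pr.
have rh1 : 0 <= h <= h by rewrite lexx ltW.
have s00 : 0 <= (0 : R) <= 1 by rewrite lexx ler01.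
have s11 : 0 <= (1 : R) <= 1 by rewrite lexx ler01.
have r00 : 0 <= (0 : R) <= h by rewrite lexx ltW.
have cl0 : clock 0 0 = S * 0 by rewrite clock00 mulr0.
have cl1 : clock h 1 = S * 1 by rewrite mulr1.
have [th0 v0] := value 0 0 0 s00 r00 s00 cl0.
have [th1 v1] := value 1 h 1 s11 rh1 s11 cl1.
have two u v : 0 <= u -> u <= v -> v <= 1 -> exists r s r' s',
    [/\ 0 <= r <= h, 0 <= s <= 1, 0 <= r' <= h & 0 <= s' <= 1] /\
    [/\ clock r s = S * u, clock r' s' = S * v & (r < r' \/ (r = r' /\ s <= s'))].
  move=> u0 uv v1'.
  have u01 : 0 <= u <= 1 by rewrite u0 (le_trans uv).
  have v01 : 0 <= v <= 1 by rewrite v1' (le_trans u0).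
  have [p1 p2 pu] := ptP u u01; have [q1 q2 qv] := ptP v v01.
  have Suv : S * u <= S * v by rewrite ler_pM2l.
  have [pq|pq|pq] := ltgtP (pt u).1 (pt v).1.
  - exists (pt u).1, (pt u).2, (pt v).1, (pt v).2; split=> //; split=> //; by left.
  - have /andP[q0 _] := q1; have /andP[_ ph] := p1.
    have := clock_lt q0 pq ph q2 p2.
    by rewrite pu qv ltNge Suv.
  - have [ss|ss] := leP (pt u).2 (pt v).2.
      exists (pt u).1, (pt u).2, (pt v).1, (pt v).2; split=> //; split=> //; by right.
    (* Here the chosen points are in the wrong order, which forces [S * u = S * v]; a single point
       then serves for both. *)
    exists (pt v).1, (pt v).2, (pt v).1, (pt v).2; split=> //; split=> //; last by right.
    apply/eqP; rewrite eq_le -{1}pu -{1}pq clock_nd ?(ltW ss)//=.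
    by rewrite qv Suv.
have mono i u v : (1 <= i <= N)%N -> 0 <= u -> u <= v -> v <= 1 ->
    th u <= th v /\ eta i u <= eta i v.
  move=> iN u0 uv v1'.
  have u01 : 0 <= u <= 1 by rewrite u0 (le_trans uv).
  have v01 : 0 <= v <= 1 by rewrite v1' (le_trans u0).
  have [r [s [r' [s' [[rh s01 r'h s'01] [cu cv rr']]]]]] := two u v u0 uv v1'.
  have [thu vu] := value u r s u01 rh s01 cu; have [thv vv] := value v r' s' v01 r'h s'01 cv.
  have [-> _] := vu i iN; have [-> _] := vv i iN; rewrite thu thv.
  have /andP[s_0 s_1] := s01; have /andP[s'_0 s'_1] := s'01.
  have /andP[r_0 r_h] := rh; have /andP[r'_0 r'_h] := r'h.
  case: rr' => [rr'|[<- ss']]; last by rewrite lexx lerD2l P_nd.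
  rewrite (ltW rr') (A_split iN r_0 rr' r'_h); split=> //.
  rewrite -!addrA lerD2l (@le_trans _ _ (P r i 1))//; first exact: P_nd.
  by rewrite lerDl; apply: addr_ge0; [exact: fine_ge0|exact: P_ge0].
have dyn : arc_dynamics N f g th eta y.
  move=> i u v cf cg e iN u0 uv v1' e0 H.
  have u01 : 0 <= u <= 1 by rewrite u0 (le_trans uv).
  have v01 : 0 <= v <= 1 by rewrite v1' (le_trans u0).
  have [r [s [r' [s' [[rh s01 r'h s'01] [cu cv rr']]]]]] := two u v u0 uv v1'.
  have [thu vu] := value u r s u01 rh s01 cu; have [thv vv] := value v r' s' v01 r'h s'01 cv.
  have [-> ->] := vu i iN; have [-> ->] := vv i iN; rewrite thu thv.
  have /andP[s_0 s_1] := s01; have /andP[s'_0 s'_1] := s'01.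
  have /andP[r_0 r_h] := rh; have /andP[r'_0 r'_h] := r'h.
  have /andP[i1 iN'] := iN.
  (* The side condition on t and q excludes only the end of the jump at h, where [zeta h 0 1] and
     [y 0] disagree. *)
  have close q t : 0 <= q <= h -> 0 <= t <= 1 -> (t < 1) || (q < h) ->
      clock r s <= clock q t -> clock q t <= clock r' s' ->
      `|f (zeta q i t, zeta q i.-1 t) - cf| <= e /\ `|g (zeta q i t, zeta q i.-1 t) - cg| <= e.
    move=> qh t01 tq; rewrite cu cv => h1 h2.
    pose z := clock q t / S.
    have zE : clock q t = S * z by rewrite /z mulrC divfK// gt_eqF.
    have uz : u <= z <= v by rewrite -(ler_pM2l S0) -(ler_pM2l S0 z v) -zE h1.
    have z01 : 0 <= z <= 1.
      by have /andP[uz1 zv1] := uz; rewrite (le_trans u0 uz1) (le_trans zv1).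
    have [_ vz] := value z q t z01 qh t01 zE.
    have := H z uz; have [_ ->] := vz i iN.
    suff -> : y i.-1 z = zeta q i.-1 t by [].
    have [i_1|i_1] := eqVneq i.-1 0%N.
      by rewrite i_1 /y/= (af_initial af)// tq.
    have i1N : (1 <= i.-1 <= N)%N by rewrite lt0n i_1 (leq_trans (leq_pred _)).
    by have [_ ->] := vz _ i1N.
  (* Inside one jump [jump_est] suffices. Otherwise the path consists of the rest of the jump at r,
     the open interval ]r, r'[ and the beginning of the jump at r', and the three estimates add up
     exactly. *)
  case: rr' => [rr'|[rr ss']]; last first.
    clear thv; subst r'; have -> : r - r = 0 by exact: subrr.
    have -> : A i r + P r i s' - (A i r + P r i s) = P r i s' - P r i s by ring.
    rewrite scale0r subr0 add0r.
    apply: jump_est => // t /andP[st ts'] t1.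
    have t01 : 0 <= t <= 1 by rewrite (le_trans s_0 st) ltW.
    by have [] := close r t rh t01 (introT orP (or_introl t1)) (clock_nd rh st) (clock_nd rh ts').
  rewrite (A_split iN r_0 rr' r'_h).
  have E1 := @jump_est r i s 1 cg e rh iN s_0 s_1 (lexx 1) e0.
  have E2 := @jump_est r' i 0 s' cg e r'h iN (lexx 0) s'_0 s'_1 e0.
  have E3 := @imp_est i r r' cf cg e iN r_0 rr' r'_h e0.
  have {}E1 : `|zeta r i 1 - zeta r i s - (P r i 1 - P r i s) *: cg| <= e * (P r i 1 - P r i s).
    apply: E1 => t /andP[st ts'] t1.
    have t01 : 0 <= t <= 1 by rewrite (le_trans s_0 st) ltW.
    have [] // := close r t rh t01 (introT orP (or_introl t1)) (clock_nd rh st).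
    exact: ltW (clock_lt r_0 rr' r'_h t01 s'01).
  have {}E2 : `|zeta r' i s' - zeta r' i 0 - (P r' i s' - P r' i 0) *: cg|
      <= e * (P r' i s' - P r' i 0).
    apply: E2 => t /andP[st ts'] t1.
    have t01 : 0 <= t <= 1 by rewrite st ltW.
    have [] // := close r' t r'h t01 (introT orP (or_introl t1)) _ (clock_nd r'h ts').
    exact: ltW (clock_lt r_0 rr' r'_h s01 t01).
  have {}E3 := E3 _.
  set mm := fine _ in E3 *.
  have {}E3 : `|zeta r' i 0 - zeta r i 1 - (r' - r) *: cf - mm *: cg| <= e * (r' - r + mm).
    apply: E3 => q t /andP[rq qr'] t01.
    have q_0 : 0 <= q by rewrite (le_trans r_0) ?ltW.
    have qh : q < h by exact: lt_le_trans r'_h.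
    have qhh : 0 <= q <= h by rewrite q_0 ltW.
    apply: close => //; first by rewrite qh orbT.
      by apply: ltW; apply: clock_lt => //; exact: ltW.
    by apply: ltW; apply: clock_lt.
  have -> : zeta r' i s' - zeta r i s - (r' - r) *: cf
      - (A i r + P r i 1 + mm + P r' i s' - (A i r + P r i s)) *: cg
    = (zeta r i 1 - zeta r i s - (P r i 1 - P r i s) *: cg)
      + (zeta r' i 0 - zeta r i 1 - (r' - r) *: cf - mm *: cg)
      + (zeta r' i s' - zeta r' i 0 - (P r' i s' - P r' i 0) *: cg).
    by apply/rowP => k; rewrite !mxE primitive01_0; ring.
  rewrite (le_trans (ler_normD _ _))//.
  rewrite (le_trans (lerD (le_trans (ler_normD _ _) (lerD E1 E3)) E2))//.
  rewrite -!mulrDr ler_wpM2l// primitive01_0.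
  by rewrite le_eqVlt; apply/orP; left; apply/eqP; ring.
exists S, th, eta, y; split=> //; last first.
  by have [_ ->] := v1 N (introT andP (conj N0 (leqnn N))); rewrite st3.
split=> //.
- by rewrite total_mass lerDl fine_ge0//= lerD2l.
- by move=> i iN; have [-> _] := v0 i iN; rewrite /A lexx primitive01_0 addr0.
- move=> u v u0 uv v1'; have N1 : (1 <= N <= N)%N by rewrite N0 leqnn.
  by have [] := mono N u v N1 u0 uv v1'.
- by move=> i u v iN u0 uv v1'; have [] := mono i u v iN u0 uv v1'.
- move=> u u01; have [p1 p2 <-] := ptP u u01.
  rewrite /th /eta big_split/= P_sum// /clock addrA//.
- have N1 : (1 <= 1 <= N)%N by rewrite N0.
  have [_ ->] := v0 1%N N1; rewrite (af_start0 af)// (af_initial af)//.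
  by rewrite !ltxx.
- move=> i /andP[i1 iN].
  have iN1 : (1 <= i.+1 <= N)%N by [].
  have iN2 : (1 <= i <= N)%N by rewrite i1 ltnW.
  have [_ ->] := v0 i.+1 iN1; have [_ ->] := v1 i iN2.
  by rewrite (af_start0 af).
- move=> i u v iN u0 uv v1'.
  have := dyn i u v 0 0 M iN u0 uv v1' M0.
  rewrite !scaler0 !subr0; apply=> t _; by rewrite !subr0.
Qed.

End forward.

(** * Limits of arcs *)

(** Compactness gives a cluster point, and an ultrafilter converges to each of its cluster points
    because it contains every set or its complement. *)
Lemma ultra_cvg_real (R : realType) (I : Type) (U : set_system I) (FU : UltraFilter U)
    (a b : R) (phi : I -> R) :
  U [set k | a <= phi k <= b] -> exists l : R, phi @ U --> l.
Proof.
move=> Uab.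
have : (phi @ U) `[a, b]%classic.
  change (U (phi @^-1` `[a, b]%classic)).
  by apply: filterS Uab => k /= kab; rewrite in_itv.
have PF : ProperFilter (phi @ U) by exact: fmap_proper_filter.
move=> /(@segment_compact R a b _ PF)[l [_ cl]]; exists l => V nV.
have [//|UV] := in_ultra_setVsetC (phi @^-1` V) FU.
by have [y []] := cl (~` V) V UV nV.
Qed.

Lemma ultra_cvg_rV (R : realType) (n : nat) (I : Type) (U : set_system I)
    (FU : UltraFilter U) (B : R) (phi : I -> 'rV[R]_n) :
  U [set k | `|phi k| <= B] -> exists l : 'rV[R]_n, phi @ U --> l.
Proof.
move=> UB.
have /choice[l lP] : forall j, exists l : R, (fun k => phi k ord0 j) @ U --> l.
  move=> j; apply: (@ultra_cvg_real _ _ _ _ (- B) B).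
  apply: filterS UB => k /= kB; rewrite -ler_norml.
  by apply: le_trans kB; exact: rV_norm_ge.
by exists (\row_j l j); apply: rV_cvg => j; rewrite mxE.
Qed.

Lemma cvg_le_near (R : realType) (I : Type) (U : set_system I) (FU : ProperFilter U)
    (phi psi : I -> R) (a b : R) :
  phi @ U --> a -> psi @ U --> b -> U [set k | phi k <= psi k] -> a <= b.
Proof.
move=> pa pb le; rewrite -subr_le0; apply: (cvgr_to_le (cvgB pa pb)).
by apply: filterS le => k /=; rewrite subr_le0.
Qed.

Lemma cvg_eq_near (R : realType) (V : normedModType R) (I : Type) (U : set_system I)
    (FU : ProperFilter U) (phi psi : I -> V) (a b : V) :
  phi @ U --> a -> psi @ U --> b -> U [set k | phi k = psi k] -> a = b.
Proof.
move=> pa pb eq; apply: (cvg_unique _ pa) => //.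
apply: cvg_trans pb; apply: near_eq_cvg.
by apply: filterS eq => k.
Qed.

Section arc_bounds.
Context (R : realType) (n N : nat) (h K M : R) (x0 xi0 : 'rV[R]_n) (S : R)
  (th : R -> R) (eta : nat -> R -> R) (y : nat -> R -> 'rV[R]_n).
Hypothesis h0 : 0 < h.
Hypothesis M0 : 0 <= M.
Hypothesis arc : space_time_arc N h K M x0 xi0 S th eta y.

Lemma arc_S_gt0 : 0 < S.
Proof. by have /andP[hS _] := sta_S arc; exact: lt_le_trans hS. Qed.

(** All terms of the clock identity are nondecreasing, so any two of them grow together by no more
    than the whole. *)
Lemma arc_increments i u v : (1 <= i <= N)%N -> 0 <= u -> u <= v -> v <= 1 ->
  th v - th u + (eta i v - eta i u) <= S * (v - u).
Proof.
move=> iN u0 uv v1.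
have u01 : 0 <= u <= 1 by rewrite u0 (le_trans uv).
have v01 : 0 <= v <= 1 by rewrite v1 (le_trans u0).
rewrite mulrBr -(sta_sum arc u01) -(sta_sum arc v01) opprD [leRHS]addrACA lerD2l -sumrB.
rewrite (bigD1_seq i)//= ?mem_index_iota ?iota_uniq//.
rewrite lerDl big_nat_cond sumr_ge0// => k /andP[kN _].
by rewrite subr_ge0 (sta_eta_nd arc).
Qed.

Lemma arc_lipschitz i u v : (1 <= i <= N)%N -> 0 <= u -> u <= v -> v <= 1 ->
  `|y i v - y i u| <= M * (S * (v - u)).
Proof.
move=> iN u0 uv v1; apply: (le_trans (sta_lip arc iN u0 uv v1)).
by rewrite ler_wpM2l// arc_increments.
Qed.

Lemma arc_eta_bounds i u : (1 <= i <= N)%N -> 0 <= u <= 1 -> 0 <= eta i u <= h + K.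
Proof.
move=> iN /andP[u0 u1].
rewrite -{1}(sta_eta0 arc iN) (sta_eta_nd arc)//=.
have := arc_increments iN (lexx 0) u0 u1.
rewrite (sta_th0 arc) (sta_eta0 arc iN) !subr0.
have thu : 0 <= th u by rewrite -(sta_th0 arc) (sta_th_nd arc).
have : S * u <= S by rewrite ler_piMr// ltW// arc_S_gt0.
by have /andP[_ SK] := sta_S arc; lra.
Qed.

Lemma arc_th_bounds u : 0 <= u <= 1 -> 0 <= th u <= h.
Proof.
move=> /andP[u0 u1].
have := sta_th_nd arc (lexx 0) u0 u1; have := sta_th_nd arc u0 u1 (lexx 1).
by rewrite (sta_th0 arc) (sta_th1 arc) => -> ->.
Qed.

(** Each window moves the state by at most [M * (h + K)] and starts where the previous one ends; the
    norm of xi0 accounts for index 0. *)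
Lemma arc_y_bound i u : (i <= N)%N -> 0 <= u <= 1 ->
  `|y i u| <= `|x0| + `|xi0| + N%:R * (M * (h + K)).
Proof.
have hK0 : 0 <= h + K.
  by have /andP[hS SK] := sta_S arc; rewrite (le_trans (ltW arc_S_gt0)).
have MhK : 0 <= M * (h + K) by rewrite mulr_ge0.
case: i => [_ u01|i].
  rewrite (sta_y0 arc u01) addrAC lerDr addr_ge0// mulr_ge0//.
move=> iN u01.
suff : `|y i.+1 u| <= `|x0| + i.+1%:R * (M * (h + K)).
  move=> /le_trans; apply.
  by rewrite lerD ?lerDl// ler_wpM2r// ler_nat.
have step k v : (1 <= k <= N)%N -> 0 <= v <= 1 -> `|y k v| <= `|y k 0| + M * (h + K).
  move=> kN /andP[v0 v1].
  have -> : y k v = y k 0 + (y k v - y k 0) by rewrite addrC subrK.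
  rewrite (le_trans (ler_normD _ _))// lerD2l.
  rewrite (le_trans (arc_lipschitz kN (lexx 0) v0 v1))// ler_wpM2l// subr0.
  have /andP[_ SK] := sta_S arc; apply: le_trans SK.
  by rewrite ler_piMr// ltW// arc_S_gt0.
elim: i u u01 iN => [|i IH] u u01 iN.
  by rewrite (le_trans (step _ _ _ u01))// (sta_start arc) mul1r.
rewrite (le_trans (step _ _ _ u01))// (sta_link arc)//.
rewrite -natr1 mulrDl mul1r addrA lerD2r IH ?ler01 ?lexx//.
exact: ltnW.
Qed.

End arc_bounds.

Section arc_limit.
Context (R : realType) (n N : nat) (h K M : R) (x0 xi0 : 'rV[R]_n)
  (f g : 'rV[R]_n * 'rV[R]_n -> 'rV[R]_n).
Hypothesis h0 : 0 < h.
Hypothesis M0 : 0 <= M.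
Hypothesis N0 : (0 < N)%N.
Hypothesis fc : continuous f.
Hypothesis gc : continuous g.
Context (I : Type) (U : set_system I) (FU : UltraFilter U).
Context (S_ : I -> R) (th_ : I -> R -> R) (eta_ : I -> nat -> R -> R)
  (y_ : I -> nat -> R -> 'rV[R]_n).
Hypothesis arcs : U [set k | space_time_arc N h K M x0 xi0 (S_ k) (th_ k) (eta_ k) (y_ k)
  /\ arc_dynamics N f g (th_ k) (eta_ k) (y_ k)].

Let PU : ProperFilter U := ultra_proper.

Let Sl := lim (S_ @ U).
Let th u := lim (th_ k u @[k --> U]).
Let eta i u := lim (eta_ k i u @[k --> U]).
Let y i u := lim (y_ k i u @[k --> U]).

Let arcsU (P : I -> Prop) :
  (forall k, space_time_arc N h K M x0 xi0 (S_ k) (th_ k) (eta_ k) (y_ k) -> P k) ->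
  U [set k | P k].
Proof. by move=> H; apply: filterS arcs => k [/H]. Qed.

Let S_cvg : S_ @ U --> Sl.
Proof.
apply/cvg_ex; apply: (@ultra_cvg_real _ _ _ _ h (h + K)).
by apply: arcsU => k ak; exact: sta_S ak.
Qed.

Let th_cvg u : 0 <= u <= 1 -> th_ k u @[k --> U] --> th u.
Proof.
move=> u01; apply/cvg_ex; apply: (@ultra_cvg_real _ _ _ _ 0 h).
by apply: arcsU => k ak; exact: (arc_th_bounds ak).
Qed.

Let eta_cvg i u : (1 <= i <= N)%N -> 0 <= u <= 1 -> eta_ k i u @[k --> U] --> eta i u.
Proof.
move=> iN u01; apply/cvg_ex; apply: (@ultra_cvg_real _ _ _ _ 0 (h + K)).
by apply: arcsU => k ak; exact: (arc_eta_bounds h0 ak).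
Qed.

Let y_cvg i u : (i <= N)%N -> 0 <= u <= 1 -> y_ k i u @[k --> U] --> y i u.
Proof.
move=> iN u01; apply/cvg_ex.
apply: (@ultra_cvg_rV _ _ _ _ _ (`|x0| + `|xi0| + N%:R * (M * (h + K)))).
by apply: arcsU => k ak; exact: (arc_y_bound h0 M0 ak).
Qed.

Let cst_cvg (V : normedModType R) (v : V) : (cst v : I -> V) @ U --> v.
Proof. exact: cvg_cst. Qed.

Let cst_cvgR (r : R) : (cst r : I -> R) @ U --> r.
Proof. exact: cvg_cst. Qed.

Let arc_limit_arc : space_time_arc N h K M x0 xi0 Sl th eta y.
Proof.
have u00 : 0 <= (0 : R) <= 1 by rewrite lexx ler01.
have u11 : 0 <= (1 : R) <= 1 by rewrite lexx ler01.
split.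
- apply/andP; split.
    apply: (cvg_le_near PU (@cst_cvgR (h)) S_cvg).
    by apply: arcsU => k ak /=; have /andP[] := sta_S ak.
  apply: (cvg_le_near PU S_cvg (@cst_cvgR (h + K))).
  by apply: arcsU => k ak /=; have /andP[] := sta_S ak.
- apply: (cvg_eq_near (V := R^o) PU (th_cvg u00) (@cst_cvgR (0))).
  by apply: arcsU => k ak /=; exact: sta_th0 ak.
- apply: (cvg_eq_near (V := R^o) PU (th_cvg u11) (@cst_cvgR (h))).
  by apply: arcsU => k ak /=; exact: sta_th1 ak.
- move=> i iN; apply: (cvg_eq_near (V := R^o) PU (eta_cvg iN u00) (@cst_cvgR (0))).
  by apply: arcsU => k ak /=; exact: (sta_eta0 ak).
- move=> u v u0 uv v1.
  have u01 : 0 <= u <= 1 by rewrite u0 (le_trans uv).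
  have v01 : 0 <= v <= 1 by rewrite v1 (le_trans u0).
  apply: (cvg_le_near PU (th_cvg u01) (th_cvg v01)).
  by apply: arcsU => k ak /=; exact: (sta_th_nd ak).
- move=> i u v iN u0 uv v1.
  have u01 : 0 <= u <= 1 by rewrite u0 (le_trans uv).
  have v01 : 0 <= v <= 1 by rewrite v1 (le_trans u0).
  apply: (cvg_le_near PU (eta_cvg iN u01) (eta_cvg iN v01)).
  by apply: arcsU => k ak /=; exact: (sta_eta_nd ak).
- move=> u u01.
  have c1 : th_ k u + \sum_(1 <= i < N.+1) eta_ k i u @[k --> U] -->
      th u + \sum_(1 <= i < N.+1) eta i u.
    apply: cvgD; first exact: th_cvg.
    have H m : (m <= N)%N -> \sum_(1 <= i < m.+1) eta_ k i u @[k --> U] -->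
        \sum_(1 <= i < m.+1) eta i u.
      elim: m => [_|m IH mN].
        by rewrite big_geq//; under eq_fun do rewrite big_geq//; exact: cvg_cst.
      rewrite big_nat_recr//=; under eq_fun do rewrite big_nat_recr//=.
      by apply: cvgD; [apply: IH; exact: ltnW|exact: eta_cvg].
    exact: H.
  have c2 : S_ k * u @[k --> U] --> Sl * u by apply: cvgMr_tmp.
  apply: (cvg_eq_near (V := R^o) PU c1 c2).
  by apply: arcsU => k ak /=; exact: (sta_sum ak).
- move=> u u01; apply: (cvg_eq_near PU (y_cvg (leq0n N) u01) (@cst_cvg _ xi0)).
  by apply: arcsU => k ak /=; exact: (sta_y0 ak).
- apply: (cvg_eq_near PU (y_cvg N0 u00) (@cst_cvg _ x0)).
  by apply: arcsU => k ak /=; exact: (sta_start ak).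
- move=> i iN; have /andP[i1 iN'] := iN.
  apply: (cvg_eq_near PU (y_cvg iN' u00) (y_cvg (ltnW iN') u11)).
  by apply: arcsU => k ak /=; exact: (sta_link ak).
- move=> i u v iN u0 uv v1; have /andP[i1 iN'] := iN.
  have u01 : 0 <= u <= 1 by rewrite u0 (le_trans uv).
  have v01 : 0 <= v <= 1 by rewrite v1 (le_trans u0).
  have c1 : `|y_ k i v - y_ k i u| @[k --> U] --> `|y i v - y i u|.
    by apply: cvg_norm; apply: cvgB; exact: y_cvg.
  have c2 : M * (th_ k v - th_ k u + (eta_ k i v - eta_ k i u)) @[k --> U] -->
      M * (th v - th u + (eta i v - eta i u)).
    by apply: cvgMl_tmp; apply: cvgD; apply: cvgB; (exact: th_cvg || exact: eta_cvg).
  apply: (cvg_le_near PU c1 c2).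
  by apply: arcsU => k ak /=; exact: (sta_lip ak).
Qed.

(** The common Lipschitz constant [M * (h + K)] allows pointwise limits to be taken along moving
    parameters. *)
Let equi_cvg i (t_ : I -> R) (t : R) : (i <= N)%N -> (forall k, 0 <= t_ k <= 1) ->
  0 <= t <= 1 -> t_ @ U --> t -> y_ k i (t_ k) @[k --> U] --> y i t.
Proof.
move=> iN t_01 t01 t_t; apply/cvgrPdist_le => e e0.
have e20 : 0 < e / 2 by rewrite divr_gt0.
have hK : 0 < M * (h + K) + 1.
  have /andP[hS SK] := sta_S arc_limit_arc.
  by rewrite ltr_wpDl// mulr_ge0// (le_trans _ SK)// (le_trans _ hS)// ltW.
have d0 : 0 < e / 2 / (M * (h + K) + 1) by rewrite divr_gt0.
have n1 : U [set k | `|y i t - y_ k i t| <= e / 2].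
  exact: ((cvgrPdist_le _ _).1 (y_cvg iN t01) _ e20).
have n2 : U [set k | `|t - t_ k| <= e / 2 / (M * (h + K) + 1)].
  exact: ((cvgrPdist_le _ _).1 t_t _ d0).
apply: (@filterS3 _ U _ _ _ _ _ _ arcs n1 n2) => k [ak _] /= yk tk.
have -> : y i t - y_ k i (t_ k) = (y i t - y_ k i t) + (y_ k i t - y_ k i (t_ k)).
  by rewrite addrA subrK.
rewrite (le_trans (ler_normD _ _))// [leRHS]splitr lerD//.
have [i_0|i_0] := eqVneq i 0%N.
  by rewrite i_0 !(sta_y0 ak)// subrr normr0 ltW.
have i1N : (1 <= i <= N)%N by rewrite lt0n i_0.
have lip (u v : R) : 0 <= u <= 1 -> 0 <= v <= 1 -> u <= v ->
    `|u - v| <= e / 2 / (M * (h + K) + 1) ->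
    `|y_ k i v - y_ k i u| <= e / 2.
  move=> /andP[u0 u1] /andP[v0 v1] uv; rewrite distrC ger0_norm ?subr_ge0// => uvd.
  rewrite (le_trans (arc_lipschitz M0 ak i1N u0 uv v1))//.
  have /andP[_ SK] := sta_S ak.
  rewrite (@le_trans _ _ ((M * (h + K) + 1) * (v - u)))//; last by rewrite mulrC -ler_pdivlMr.
  rewrite mulrA ler_wpM2r ?subr_ge0// (@le_trans _ _ (M * (h + K)))//.
    by rewrite ler_wpM2l.
  by rewrite lerDl.
have [tt|tt] := leP t (t_ k); first by rewrite distrC; exact: lip.
by apply: lip => //; [exact: ltW|rewrite distrC].
Qed.

Let arc_limit_dynamics : arc_dynamics N f g th eta y.
Proof.
move=> i u v cf cg e iN u0 uv v1 e0 H; have /andP[i1 iN'] := iN.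
have u01 : 0 <= u <= 1 by rewrite u0 (le_trans uv).
have v01 : 0 <= v <= 1 by rewrite v1 (le_trans u0).
have iN1 : (i.-1 <= N)%N by rewrite (leq_trans (leq_pred _)).
(* Pointwise convergence has to give a bound uniform in t. If it failed on a set of the ultrafilter,
   the failing parameters [t_ k] would converge to some t in [u, v], and [equi_cvg] would contradict
   H at t. *)
have near_e (d : R) : 0 < d -> U [set k | forall t, u <= t <= v ->
    `|f (y_ k i t, y_ k i.-1 t) - cf| <= e + d /\ `|g (y_ k i t, y_ k i.-1 t) - cg| <= e + d].
  move=> d0; set G := [set k | _].
  have [//|UG] := in_ultra_setVsetC G FU.
  have /choice[t_ t_P] : forall k, exists t, u <= t <= v /\ (~ G k ->
      ~ (`|f (y_ k i t, y_ k i.-1 t) - cf| <= e + d /\ `|g (y_ k i t, y_ k i.-1 t) - cg| <= e + d)).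
    move=> k; have [Gk|Gk] := pselect (G k); first by exists u; rewrite lexx uv.
    apply: contrapT => nt; apply: Gk => t tuv; apply: contrapT => bad; apply: nt.
    by exists t.
  have [t tt] : exists t : R, t_ @ U --> t.
    apply: (@ultra_cvg_real _ _ _ _ u v); apply: filterE => k /=.
    by have [] := t_P k.
  have tuv : u <= t <= v.
    apply/andP; split.
      apply: (cvg_le_near PU (@cst_cvgR (u)) tt); apply: filterE => k /=.
      by have [/andP[]] := t_P k.
    apply: (cvg_le_near PU tt (@cst_cvgR (v))); apply: filterE => k /=.
    by have [/andP[]] := t_P k.
  have t01 : 0 <= t <= 1.
    by have /andP[ut tv] := tuv; rewrite (le_trans u0 ut) (le_trans tv).
  have t_01 k : 0 <= t_ k <= 1.
    by have [/andP[ut tv] _] := t_P k; rewrite (le_trans u0 ut) (le_trans tv).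
  have c1 := equi_cvg iN' t_01 t01 tt.
  have c2 := equi_cvg iN1 t_01 t01 tt.
  have c3 : (y_ k i (t_ k), y_ k i.-1 (t_ k)) @[k --> U] --> (y i t, y i.-1 t).
    exact: (@cvg_pair _ _ _ U (nbhs (y i t)) (nbhs (y i.-1 t)) _ _ _ _ _ c1 c2).
  have cF (F : 'rV[R]_n * 'rV[R]_n -> 'rV[R]_n) (c : 'rV[R]_n) : continuous F ->
      `|F (y i t, y i.-1 t) - c| <= e ->
      U [set k | `|F (y_ k i (t_ k), y_ k i.-1 (t_ k)) - c| <= e + d].
    move=> Fc Fe.
    have c4 : F (y_ k i (t_ k), y_ k i.-1 (t_ k)) @[k --> U] --> F (y i t, y i.-1 t).
      exact: (cvg_comp _ _ c3 (Fc _)).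
    have : U [set k | `|F (y i t, y i.-1 t) - F (y_ k i (t_ k), y_ k i.-1 (t_ k))| <= d].
      exact: ((cvgrPdist_le _ _).1 c4 d d0).
    apply: filterS => k /= kd.
    move: Fe kd; move: (F (y i t, y i.-1 t)) (F (y_ k i (t_ k), y_ k i.-1 (t_ k))) => Ft Fk Fe kd.
    have -> : Fk - c = (Ft - c) - (Ft - Fk) by apply/rowP => j; rewrite !mxE; ring.
    by rewrite (le_trans (ler_normB _ _))// lerD.
  have [Hf Hg] := H t tuv.
  have [k [Gk fk gk]] : exists k, [/\ ~ G k,
      `|f (y_ k i (t_ k), y_ k i.-1 (t_ k)) - cf| <= e + d &
      `|g (y_ k i (t_ k), y_ k i.-1 (t_ k)) - cg| <= e + d].
    apply: (@filter_ex _ U).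
    by apply: (@filterS3 _ U _ _ _ _ _ _ UG (cF f cf fc Hf) (cF g cg gc Hg)) => k ? ? ?; split.
  by exfalso; have [_ /(_ Gk)] := t_P k; apply.
have main (d : R) : 0 < d ->
    `|y i v - y i u - (th v - th u) *: cf - (eta i v - eta i u) *: cg|
    <= (e + d) * (th v - th u + (eta i v - eta i u)).
  move=> d0.
  have cth : th_ k v - th_ k u @[k --> U] --> th v - th u by apply: cvgB; exact: th_cvg.
  have ceta : eta_ k i v - eta_ k i u @[k --> U] --> eta i v - eta i u.
    by apply: cvgB; exact: eta_cvg.
  have c1 : `|y_ k i v - y_ k i u - (th_ k v - th_ k u) *: cf - (eta_ k i v - eta_ k i u) *: cg|
      @[k --> U] --> `|y i v - y i u - (th v - th u) *: cf - (eta i v - eta i u) *: cg|.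
    apply: cvg_norm; apply: cvgB; last exact: cvgZr_tmp.
    by apply: cvgB; [apply: cvgB; exact: y_cvg|exact: cvgZr_tmp].
  have c2 : (e + d) * (th_ k v - th_ k u + (eta_ k i v - eta_ k i u)) @[k --> U] -->
      (e + d) * (th v - th u + (eta i v - eta i u)).
    by apply: cvgMl_tmp; exact: cvgD.
  apply: (cvg_le_near PU c1 c2).
  apply: (@filterS2 _ U _ _ _ _ _ arcs (near_e d d0)) => k [ak dk] Hk /=.
  by apply: dk => //; rewrite addr_ge0// ltW.
have z0 : 0 <= th v - th u + (eta i v - eta i u).
  by rewrite addr_ge0// subr_ge0 ?(sta_th_nd arc_limit_arc)// (sta_eta_nd arc_limit_arc).
set z := _ + _ in z0 main *.
apply/ler_addgt0Pr => d d0.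
have z1 : 0 < z + 1 by rewrite ltr_wpDl.
apply: (le_trans (main (d / (z + 1)) (divr_gt0 d0 z1))).
rewrite mulrDl lerD2l mulrAC ler_pdivrMr//.
by rewrite ler_wpM2l ?(ltW d0)// lerDl.
Qed.

Lemma arc_limit : exists S th eta y, [/\ space_time_arc N h K M x0 xi0 S th eta y,
  arc_dynamics N f g th eta y & y_ k N 1 @[k --> U] --> y N 1].
Proof.
exists Sl, th, eta, y; split=> //; apply: y_cvg => //.
by rewrite lexx ler01.
Qed.

End arc_limit.

(* An ultrafilter containing all the sublevel sets of the cost replaces the
   extraction of a convergent minimizing sequence. *)
Lemma arc_minimum (R : realType) (n N : nat) (h K M : R) (x0 xi0 : 'rV[R]_n)
  (f g : 'rV[R]_n * 'rV[R]_n -> 'rV[R]_n) (target : set 'rV[R]_n) (Psi : 'rV[R]_n -> R) :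
  0 < h -> 0 <= M -> (0 < N)%N -> continuous f -> continuous g -> closed target ->
  lower_semicontinuous (fun y => (Psi y)%:E) ->
  let arc S th eta y := space_time_arc N h K M x0 xi0 S th eta y /\
    arc_dynamics N f g th eta y /\ target (y N 1) in
  (exists S th eta y, arc S th eta y) ->
  exists S th eta y, arc S th eta y /\
    forall S' th' eta' y', arc S' th' eta' y' -> Psi (y N 1) <= Psi (y' N 1).
Proof.
move=> h0 M0 N0 fc gc ctarget lsc arc [S0 [th0 [eta0 [y0 arc0]]]].
pose I : Type := (R * (R -> R) * (nat -> R -> R) * (nat -> R -> 'rV[R]_n))%type.
pose isarc (k : I) := arc k.1.1.1 k.1.1.2 k.1.2 k.2.
pose lower (k : I) := [set k' : I | isarc k' /\ Psi (k'.2 N 1) <= Psi (k.2 N 1)].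
(* Costs are totally ordered, so the sublevel sets are nested and form a filter base; each contains
   the arc that defines it. *)
have FF : ProperFilter (filter_from isarc lower).
  apply: filter_from_proper; last by move=> k ak; exists k.
  apply: filter_from_filter; first by exists (S0, th0, eta0, y0).
  move=> k l ak al; have [kl|lk] := leP (Psi (k.2 N 1)) (Psi (l.2 N 1)).
    by exists k => // k' [? k'k]; split; split=> //; exact: le_trans kl.
  by exists l => // k' [? k'k]; split; split=> //; exact: le_trans (ltW lk).
have [U [FU FFU]] := ultraFilterLemma FF.
have Uarc : U [set k | isarc k].
  by apply: FFU; exists (S0, th0, eta0, y0) => // k [].
have Uarc' : U [set k : I | space_time_arc N h K M x0 xi0 k.1.1.1 k.1.1.2 k.1.2 k.2
    /\ arc_dynamics N f g k.1.1.2 k.1.2 k.2].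
  by apply: filterS Uarc => k [? []].
have [S [th [eta [y [ay dy cy]]]]] := arc_limit h0 M0 N0 fc gc FU Uarc'.
have PU : ProperFilter U by exact: ultra_proper.
exists S, th, eta, y; split.
  split=> //; split=> //.
  apply: (closed_cvg _ ctarget _ _ cy).
  by apply: filterS Uarc => k [? []].
move=> S' th' eta' y' ak'.
rewrite leNgt; apply/negP => lt.
(* Lower semicontinuity keeps the cost above [Psi (y' N 1)] on V, yet the ultrafilter provides an
   arc ending in V whose cost is at most that. *)
have [V nV HV] := lsc (y N 1) (Psi (y' N 1)) lt.
have UV : U [set k : I | V (k.2 N 1)] by exact: cy.
have Ulow : U (lower (S', th', eta', y')) by apply: FFU; exists (S', th', eta', y').
have [k [Vk [_ lk]]] := filter_ex (filterI UV Ulow).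
have := HV _ Vk; rewrite lte_fin ltNge.
by move: lk => /= ->.
Qed.

(** * From arcs to processes *)

(** Arcs are controlled on [0, 1] only. Composition with the clamp extends them by constants and
    preserves monotonicity and Lipschitz constants. *)
Definition clamp01 (R : realType) (u : R) : R := Num.max 0 (Num.min u 1).

Section clamp01.
Context (R : realType).
Implicit Types u v : R.

Lemma clamp01_itv u : 0 <= clamp01 u <= 1.
Proof. by rewrite /clamp01 le_max lexx/= ge_max ler01 ge_min lexx orbT. Qed.

Lemma clamp01_id u : 0 <= u <= 1 -> clamp01 u = u.
Proof. by move=> /andP[u0 u1]; rewrite /clamp01 (min_idPl u1) (max_idPr u0). Qed.

Lemma clamp01_le0 u : u <= 0 -> clamp01 u = 0.
Proof. by move=> u0; rewrite /clamp01; apply/max_idPl; rewrite ge_min u0. Qed.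

Lemma clamp01_ge1 u : 1 <= u -> clamp01 u = 1.
Proof. by move=> u1; rewrite /clamp01 (min_idPr u1); apply/max_idPr. Qed.

Lemma clamp01_le_lip u v : u <= v ->
  clamp01 u <= clamp01 v /\ clamp01 v - clamp01 u <= v - u.
Proof.
move=> uv.
have [u0|u0] := leP u 0; have [u1|u1] := leP 1 u; have [v0|v0] := leP v 0;
  have [v1|v1] := leP 1 v; try (exfalso; lra);
  rewrite ?(clamp01_le0 u0) ?(clamp01_ge1 u1) ?(clamp01_le0 v0) ?(clamp01_ge1 v1);
  rewrite ?(@clamp01_id u) ?(@clamp01_id v) ?(ltW u0) ?(ltW u1) ?(ltW v0) ?(ltW v1)//;
  by split; lra.
Qed.

Lemma clamp01_le u v : u <= v -> clamp01 u <= clamp01 v.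
Proof. by move=> /clamp01_le_lip[]. Qed.

Lemma clamp01_lip u v : u <= v -> clamp01 v - clamp01 u <= v - u.
Proof. by move=> /clamp01_le_lip[]. Qed.

End clamp01.

Lemma level_set (R : realType) (C h : R) (th : R -> R) : 0 <= C ->
  th 0 = 0 -> th 1 = h ->
  (forall u v, 0 <= u -> u <= v -> v <= 1 -> th u <= th v) ->
  (forall u v, 0 <= u -> u <= v -> v <= 1 -> th v - th u <= C * (v - u)) ->
  forall r, 0 <= r <= h -> exists p : R * R,
    [/\ 0 <= p.1, p.1 <= p.2, p.2 <= 1, th p.1 = r & th p.2 = r] /\
    forall u, 0 <= u <= 1 -> th u = r -> p.1 <= u <= p.2.
Proof.
move=> C0 th0 th1 nd lip r /andP[r0 rh].
have C1 : 0 < C + 1 by rewrite ltr_wpDl.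
(* Sublevel and superlevel sets are non-empty by the values at 0 and 1; continuity of th places sup
   E and inf F on the level r itself. *)
pose E := [set u | 0 <= u <= 1 /\ th u <= r].
pose F := [set u | 0 <= u <= 1 /\ r <= th u].
have E0 : E 0 by split; rewrite ?lexx ?ler01 ?th0.
have F1 : F 1 by split; rewrite ?lexx ?ler01 ?th1.
have ubE : ubound E 1 by move=> u [/andP[]].
have lbF : lbound F 0 by move=> u [/andP[]].
have supE : has_sup E by split; [exists 0|exists 1].
have infF : has_inf F by split; [exists 1|exists 0].
set q := sup E; set p := inf F.
have q0 : 0 <= q by apply: ub_le_sup => //; exists 1.
have q1 : q <= 1 by apply: ge_sup => //; exists 0.
have p0 : 0 <= p by apply: lb_le_inf => //; exists 1.
have p1 : p <= 1 by apply: ge_inf => //; exists 0.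
have lip' u v : 0 <= u -> u <= v -> v <= 1 -> th v - th u <= (C + 1) * (v - u).
  move=> u0 uv v1; apply: (le_trans (lip _ _ u0 uv v1)).
  by rewrite ler_wpM2r ?subr_ge0// lerDl.
have thq : th q = r.
  apply/eqP; rewrite eq_le; apply/andP; split; apply/ler_addgt0Pr => e e0.
    have d0 : 0 < e / (C + 1) by rewrite divr_gt0.
    have [u [/andP[u0 u1] ur] qu] := sup_adherent d0 supE; rewrite -/q in qu.
    have uq : u <= q by apply: ub_le_sup; [exists 1|split=> //; rewrite u0].
    have := lip' _ _ u0 uq q1.
    have : (C + 1) * (q - u) <= e by rewrite mulrC -ler_pdivlMr//; lra.
    by lra.
  have [q1'|q1'] := eqVneq q 1; first by rewrite q1' th1; lra.
  have {}q1' : q < 1 by rewrite lt_neqAle q1'.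
  pose u := Num.min 1 (q + e / (C + 1)).
  have d0 : 0 < e / (C + 1) by rewrite divr_gt0.
  have qu : q < u by rewrite lt_min q1' ltrDl.
  have u1 : u <= 1 by rewrite ge_min lexx.
  have uq : u - q <= e / (C + 1) by rewrite lerBlDl ge_min lexx orbT.
  have : (C + 1) * (u - q) <= e by rewrite mulrC -ler_pdivlMr.
  have := lip' _ _ q0 (ltW qu) u1.
  have ru : r < th u.
    rewrite ltNge; apply/negP => ur.
    have : u <= q by apply: ub_le_sup; [exists 1|split=> //; rewrite u1 (le_trans q0 (ltW qu))].
    by rewrite leNgt qu.
  by lra.
have thp : th p = r.
  apply/eqP; rewrite eq_le; apply/andP; split; apply/ler_addgt0Pr => e e0; last first.
    have d0 : 0 < e / (C + 1) by rewrite divr_gt0.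
    have [u [/andP[u0 u1] ur] pu] := inf_adherent d0 infF; rewrite -/p in pu.
    have up : p <= u by apply: ge_inf; [exists 0|split=> //; rewrite u0].
    have := lip' _ _ p0 up u1.
    have : (C + 1) * (u - p) <= e by rewrite mulrC -ler_pdivlMr//; lra.
    by lra.
  have [p0'|p0'] := eqVneq p 0; first by rewrite p0' th0; lra.
  have {}p0' : 0 < p by rewrite lt_neqAle eq_sym p0'.
  pose u := Num.max 0 (p - e / (C + 1)).
  have d0 : 0 < e / (C + 1) by rewrite divr_gt0.
  have up : u < p by rewrite gt_max p0' ltrBlDr ltrDl.
  have u0 : 0 <= u by rewrite le_max lexx.
  have pu : p - u <= e / (C + 1) by rewrite lerBlDr -lerBlDl le_max lexx orbT.
  have : (C + 1) * (p - u) <= e by rewrite mulrC -ler_pdivlMr.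
  have := lip' _ _ u0 (ltW up) p1.
  have ru : th u < r.
    rewrite ltNge; apply/negP => ur.
    have : p <= u by apply: ge_inf; [exists 0|split=> //; rewrite u0 (le_trans (ltW up))].
    by rewrite leNgt up.
  by lra.
exists (p, q); split=> [|u u01 ur]/=.
  split=> //; apply: ge_inf; first by exists 0.
  by split; [rewrite q0 q1|rewrite thq].
apply/andP; split.
  by apply: ge_inf; [exists 0|split=> //; rewrite ur].
by apply: ub_le_sup; [exists 1|split=> //; rewrite ur].
Qed.

(* The measure is the image of d eta under th + c; d eta has no atoms, so whether
   p and q themselves are mapped into A is irrelevant. *)
Lemma clamped_measure_exists (R : realType) (C : R) (eta th : R -> R) (c : R) :
  (forall u v, 0 <= u -> u <= v -> v <= 1 -> eta u <= eta v) ->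
  (forall u v, 0 <= u -> u <= v -> v <= 1 -> eta v - eta u <= C * (v - u)) ->
  (forall u v, 0 <= u -> u <= v -> v <= 1 -> th u <= th v) ->
  0 <= C ->
  exists nu : {measure set (measurableTypeR R) -> \bar R},
    forall (A : set R) p q, measurable (A : set (measurableTypeR R)) ->
      0 <= p -> p <= q -> q <= 1 ->
      (forall u, 0 < u < 1 -> (p < u < q -> A (th u + c)) /\ (A (th u + c) -> p <= u <= q)) ->
      nu A = (eta q - eta p)%:E.
Proof.
move=> end_ elip thnd C0.
pose phi u := eta (clamp01 u).
have pnd : {homo phi : s t / s <= t}.
  move=> s t st; have /andP[s0 s1] := clamp01_itv s; have /andP[t0 t1] := clamp01_itv t.
  by apply: end_ => //; exact: clamp01_le.
have plip s t : s <= t -> phi t - phi s <= C * (t - s).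
  move=> st; have /andP[s0 s1] := clamp01_itv s; have /andP[t0 t1] := clamp01_itv t.
  apply: (le_trans (elip _ _ s0 (clamp01_le st) t1)).
  by rewrite ler_wpM2l// clamp01_lip.
have p0 s : s <= 0 -> phi s = phi 0 by move=> s0; rewrite /phi !clamp01_le0.
have p1 s : 1 <= s -> phi s = phi 1 by move=> s0; rewrite /phi !clamp01_ge1.
have [nu [nuE nuT nuac]] := lipschitz_measure pnd plip p0 p1.
have nu1 x : nu [set x] = 0%E.
  have ns : (@lebesgue_measure R).-null_set [set x].
    by move=> B mB Bx; apply: subset_measure0 Bx _ => //; exact: lebesgue_measure_set1.
  have mx : measurable ([set x] : set (measurableTypeR R)) by [].
  exact: (nuac _ ns _ mx (fun t => id)).
have nuoo p q : p <= q -> nu `]p, q[%classic = (phi q - phi p)%:E.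
  rewrite le_eqVlt => /orP[/eqP ->|pq]; first by rewrite set_itvoo0 measure0 subrr.
  rewrite -nuE; last exact: ltW.
  rewrite -(setUitv1 true)//.
  by rewrite measureU0//; exact: nu1.
have nucc p q : p <= q -> nu `[p, q]%classic = (phi q - phi p)%:E.
  move=> pq; rewrite -nuE// -(setU1itv false)//.
  by rewrite setUC measureU0//; exact: nu1.
(* All the mass of nu lies in ]0, 1[, where the clamp is the identity, so A has to be described
   through such parameters only. *)
have nu01 : nu (~` `]0, 1[%classic) = 0%E.
  have : nu setT = (nu `]0%R, 1%R[%classic + nu (~` `]0%R, 1%R[%classic))%E.
    pose J : set (measurableTypeR R) := `]0%R, 1%R[%classic.
    have mJ : measurable J by exact: measurable_itv.
    by rewrite -(setUv J) measureU ?setICr//; exact: measurableC.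
  rewrite nuT nuoo// => H; apply/eqP.
  have fin : nu (~` `]0, 1[%classic) \is a fin_num by apply: fin_num_measure; exact: measurableC.
  move: H; rewrite -(fineK fin) -EFinD => -[/eqP].
  by rewrite -subr_eq0 opprD addrA subrr sub0r oppr_eq0 => /eqP ->.
have mth : measurable_fun (setT : set (measurableTypeR R))
    (fun u : measurableTypeR R => th (clamp01 u) + c : measurableTypeR R).
  apply: nondecreasing_measurable => // s t st; rewrite lerD2r.
  have /andP[s0 s1] := clamp01_itv s; have /andP[t0 t1] := clamp01_itv t.
  by apply: thnd => //; exact: clamp01_le.
exists (pushforward nu (fun u : measurableTypeR R => th (clamp01 u) + c : measurableTypeR R)).
move=> A p q mA p_0 pq q_1 AE.
set B := (fun u : measurableTypeR R => th (clamp01 u) + c : measurableTypeR R) @^-1` A.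
change (nu B = (eta q - eta p)%:E).
have mB : measurable (B : set (measurableTypeR R)).
  by rewrite -[B]setTI; exact: mth.
have m01 : measurable (`]0, 1[%classic : set (measurableTypeR R)) by [].
have mB01 : measurable (B `&` `]0, 1[%classic) by exact: measurableI.
have e1 : nu B = nu (B `&` `]0, 1[%classic).
  have -> : B = (B `&` `]0, 1[) `|` (B `\` `]0, 1[) by rewrite setUIDK.
  rewrite measureU0//; first by rewrite setUIDK.
    by exact: measurableD.
  by apply: subset_measure0 nu01; [exact: measurableD|exact: measurableC|move=> u []].
have phiE u : 0 <= u <= 1 -> phi u = eta u by move=> u01; rewrite /phi clamp01_id.
have pqE : (phi q - phi p)%:E = (eta q - eta p)%:E.
  by rewrite !phiE// ?p_0 ?q_1 ?(le_trans p_0 pq) ?(le_trans pq q_1).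
rewrite -pqE e1; apply/eqP; rewrite eq_le; apply/andP; split.
  rewrite -(nucc _ _ pq); apply: le_measure; rewrite ?inE//.
  move=> u [Bu] /=; rewrite !in_itv/= => u01; have /andP[u0 u1] := u01.
  apply: (AE u u01).2; move: Bu; rewrite /B/= clamp01_id//.
  by rewrite !ltW.
rewrite -(nuoo _ _ pq); apply: le_measure; rewrite ?inE//.
move=> u /=; rewrite !in_itv/= => upq; have /andP[pu uq] := upq.
have u01 : 0 < u < 1 by rewrite (le_lt_trans p_0 pu) (lt_le_trans uq).
split=> //; rewrite /B/= clamp01_id; first exact: (AE u u01).1.
by have /andP[? ?] := u01; rewrite !ltW.
Unshelve. all: exact: mth. Qed.

Lemma sum_nat_single (R : realType) (N i : nat) (X : R) :
  \sum_(1 <= j < N.+1) (if j == i then X else 0) = if (1 <= i <= N)%N then X else 0.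
Proof.
case: ifPn => iN.
  rewrite (bigD1_seq i)//= ?mem_index_iota ?iota_uniq// eqxx big1 ?addr0// => j.
  by move=> /negbTE ->.
rewrite big_nat big1// => j jN; case: ifPn => // /eqP ji.
by rewrite -ji jN in iN.
Qed.

Section level_sets.
Context (R : realType) (h : R) (th sm sp : R -> R).
Hypothesis h0 : 0 < h.
Hypothesis th0 : th 0 = 0.
Hypothesis th1 : th 1 = h.
Hypothesis thnd : forall u v, 0 <= u -> u <= v -> v <= 1 -> th u <= th v.
Hypothesis lev : forall r, 0 <= r <= h ->
  [/\ 0 <= sm r, sm r <= sp r, sp r <= 1, th (sm r) = r & th (sp r) = r] /\
  forall u, 0 <= u <= 1 -> th u = r -> sm r <= u <= sp r.

Lemma level_bounds r : 0 <= r <= h -> 0 <= sm r <= 1 /\ 0 <= sp r <= 1.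
Proof.
by move=> /lev[[a b c _ _] _]; split; apply/andP; split=> //;
  [exact: le_trans b c|exact: le_trans a b].
Qed.

Lemma level_lt a b : 0 <= a -> a < b -> b <= h -> sp a < sm b.
Proof.
move=> a0 ab bh.
have ah : 0 <= a <= h by rewrite a0 (le_trans (ltW ab)).
have bh' : 0 <= b <= h by rewrite bh (le_trans a0 (ltW ab)).
have [[_ _ pa1 _ tpa] _] := lev ah; have [[mb0 _ _ tmb _] _] := lev bh'.
rewrite ltNge; apply/negP => /(fun H => thnd mb0 H pa1).
by rewrite tmb tpa leNgt ab.
Qed.

Lemma level_sm0 : sm 0 = 0.
Proof.
have h00 : 0 <= (0 : R) <= h by rewrite lexx ltW.
have [[m0 _ _ _ _] /(_ 0)] := lev h00.
by rewrite lexx ler01 => /(_ isT th0)/andP[m0' _]; apply/eqP; rewrite eq_le m0' m0.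
Qed.

Lemma level_sph : sp h = 1.
Proof.
have hh : 0 <= h <= h by rewrite lexx ltW.
have [[_ _ p1 _ _] /(_ 1)] := lev hh.
by rewrite lexx ler01 => /(_ isT th1)/andP[_ p1']; apply/eqP; rewrite eq_le p1' p1.
Qed.

Lemma th_bounds u : 0 <= u <= 1 -> 0 <= th u <= h.
Proof.
move=> /andP[u0 u1]; have := thnd (lexx 0) u0 u1; have := thnd u0 u1 (lexx 1).
by rewrite th0 th1 => -> ->.
Qed.

(** Weak inequalities are enough in the converse directions, as [clamped_measure_exists] tolerates
    both endpoints. *)
Lemma between_levels a b u : 0 <= a <= h -> 0 <= b <= h -> 0 <= u <= 1 ->
  (sp a < u -> a < th u) /\ (a < th u -> sp a <= u) /\
  (u < sm b -> th u < b) /\ (th u < b -> u <= sm b).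
Proof.
move=> ah bh u01; have /andP[u0 u1] := u01.
have [[_ _ pa1 _ tpa] La] := lev ah; have [[mb0 _ _ tmb _] Lb] := lev bh.
have [/andP[_ mb1] /andP[pa0 _]] := (proj1 (level_bounds bh), proj2 (level_bounds ah)).
split; [|split; [|split]] => H.
- rewrite lt_neqAle -[X in X <= _]tpa thnd ?(ltW H)// andbT.
  apply/eqP => /esym /(La u u01)/andP[_]; by rewrite leNgt H.
- rewrite leNgt; apply/negP => /ltW /(fun K => thnd u0 K pa1).
  by rewrite tpa leNgt H.
- rewrite lt_neqAle -[X in _ <= X]tmb thnd ?(ltW H)// andbT.
  apply/eqP => /(Lb u u01)/andP[]; by rewrite leNgt H.
- rewrite leNgt; apply/negP => /ltW /(fun K => thnd mb0 K u1).
  by rewrite tmb leNgt H.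
Qed.

End level_sets.

(** Between the levels a < b the parameters run from [sp a], the end of the jump at a, to [sm b],
    the start of the jump at b; at a single interior time they fill the level set. Each mass is
    therefore a sum of increments of the [eta i]. *)
Lemma arc_measure (R : realType) (N : nat) (h T C : R) (th sm sp : R -> R)
    (eta : nat -> R -> R) :
  0 < h -> T = N%:R * h -> 0 <= C -> th 0 = 0 -> th 1 = h ->
  (forall u v, 0 <= u -> u <= v -> v <= 1 -> th u <= th v) ->
  (forall r, 0 <= r <= h ->
    [/\ 0 <= sm r, sm r <= sp r, sp r <= 1, th (sm r) = r & th (sp r) = r] /\
    forall u, 0 <= u <= 1 -> th u = r -> sm r <= u <= sp r) ->
  (forall i, (1 <= i <= N)%N -> eta i 0 = 0) ->
  (forall i u v, (1 <= i <= N)%N -> 0 <= u -> u <= v -> v <= 1 -> eta i u <= eta i v) ->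
  (forall i u v, (1 <= i <= N)%N -> 0 <= u -> u <= v -> v <= 1 ->
    eta i v - eta i u <= C * (v - u)) ->
  exists mu : {finite_measure set (measurableTypeR R) -> \bar R},
    [/\ mu (~` `[0, T]%classic) = 0%E,
        mu `[0, T]%classic = (\sum_(1 <= i < N.+1) eta i 1)%:E,
        forall i a b, (1 <= i <= N)%N -> 0 <= a -> a < b -> b <= h ->
          mu `]a + i.-1%:R * h, b + i.-1%:R * h[%classic = (eta i (sm b) - eta i (sp a))%:E,
        forall i r, (1 <= i <= N)%N -> 0 < r < h ->
          mu [set r + i.-1%:R * h] = (eta i (sp r) - eta i (sm r))%:E &
        forall i, (i <= N)%N -> mu [set i%:R * h] =
          ((if (1 <= i <= N)%N then eta i 1 - eta i (sm h) else 0) +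
           (if (1 <= i.+1 <= N)%N then eta i.+1 (sp 0) - eta i.+1 0 else 0))%:E].
Proof.
move=> h0 TE C0 th0 th1 thnd lev eta0 etand etalip.
have /choice[nu_ nuP] : forall i, exists nu : {measure set (measurableTypeR R) -> \bar R},
    (1 <= i <= N)%N ->
    forall (A : set R) p q, measurable (A : set (measurableTypeR R)) ->
      0 <= p -> p <= q -> q <= 1 ->
      (forall u, 0 < u < 1 -> (p < u < q -> A (th u + i.-1%:R * h))
         /\ (A (th u + i.-1%:R * h) -> p <= u <= q)) ->
      nu A = (eta i q - eta i p)%:E.
  move=> i; have [iN|iN] := boolP (1 <= i <= N)%N; last by exists mzero.
  have [nu nuP] := clamped_measure_exists (i.-1%:R * h) (fun u v => etand i u v iN)
    (fun u v => etalip i u v iN) thnd C0.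
  by exists nu.
pose m := msum (fun k => nu_ k.+1) N.
have mE A p q : measurable (A : set (measurableTypeR R)) ->
    (forall i, (1 <= i <= N)%N -> 0 <= p i /\ p i <= q i /\ q i <= 1) ->
    (forall i u, (1 <= i <= N)%N -> 0 < u < 1 -> (p i < u < q i -> A (th u + i.-1%:R * h))
         /\ (A (th u + i.-1%:R * h) -> p i <= u <= q i)) ->
    m A = (\sum_(1 <= i < N.+1) (eta i (q i) - eta i (p i)))%:E.
  move=> mA pq AE; rewrite /m /msum -sumEFin big_add1/= big_mkord; apply: eq_bigr => k _.
  have kN : (1 <= k.+1 <= N)%N by exact: (ltn_ord k).
  have [p0 [pq' q1]] := pq _ kN.
  by apply: (nuP _ kN) => // u u01; exact: AE.
have cN i : (1 <= i)%N -> i.-1%:R * h + h = i%:R * h.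
  by move=> i1; rewrite -{2}(prednK i1) -natr1 mulrDl mul1r.
have cle i j : (1 <= i)%N -> (i < j)%N -> i.-1%:R * h + h <= j.-1%:R * h.
  by move=> i1 ij; rewrite cN// ler_wpM2r ?(ltW h0)// ler_nat -ltnS prednK// (leq_trans _ ij).
have c0 i : 0 <= i.-1%:R * h by rewrite mulr_ge0// ltW.
have h00 : 0 <= (0 : R) <= h by rewrite lexx ltW.
have hh : 0 <= h <= h by rewrite lexx ltW.
have thb u : 0 < u < 1 -> 0 <= th u <= h.
  by move=> /andP[u0 u1]; apply: (th_bounds th0 th1 thnd); rewrite !ltW.
have mT : m setT = (\sum_(1 <= i < N.+1) (eta i 1 - eta i 0))%:E.
  apply: (mE setT (fun=> 0) (fun=> 1)) => [//|i iN|i u iN /andP[u0 u1]].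
    by rewrite !lexx ?ler01.
  by split=> [//|uT]; apply/andP; split; exact: ltW.
have [mu muE] : exists mu : {finite_measure set (measurableTypeR R) -> \bar R},
    forall A, mu A = m A.
  have mTy : (m setT < +oo)%E by rewrite mT ltry.
  exact: (finite_measure_of_setT mTy).
exists mu; split.
- rewrite muE (mE _ (fun=> 0) (fun=> 0)).
  + by rewrite big1// => i _; rewrite subrr.
  + by apply: measurableC.
  + by move=> i _; rewrite !lexx ?ler01.
  + move=> i u /andP[i1 iN] u01; have /andP[u0 u1] := u01; split.
      by move=> /andP[h1 h2]; have := lt_trans h1 h2; rewrite ltxx.
    move=> /= nT; exfalso; apply: nT; rewrite /= in_itv/=.
    have /andP[t0 t1] := thb u u01.
    rewrite addr_ge0//= (@le_trans _ _ (h + i.-1%:R * h))// ?lerD2r//.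
    by rewrite addrC cN// TE ler_wpM2r ?(ltW h0)// ler_nat.
- rewrite muE (mE _ (fun=> 0) (fun=> 1)).
  + congr EFin; rewrite big_nat [RHS]big_nat; apply: eq_bigr => i iN.
    by rewrite eta0// subr0.
  + by [].
  + by move=> i _; rewrite !lexx ?ler01.
  + move=> i u /andP[i1 iN] u01; have /andP[u0 u1] := u01; split; last by rewrite !ltW.
    move=> _; rewrite /= in_itv/=.
    have /andP[t0 t1] := thb u u01.
    rewrite addr_ge0//= (@le_trans _ _ (h + i.-1%:R * h))// ?lerD2r//.
    by rewrite addrC cN// TE ler_wpM2r ?(ltW h0)// ler_nat.
- move=> i a b iN a0 ab bh; have /andP[i1 iN'] := iN.
  have ah : 0 <= a <= h by rewrite a0 (le_trans (ltW ab)).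
  have bh' : 0 <= b <= h by rewrite bh (le_trans a0 (ltW ab)).
  have lt_ab := level_lt thnd lev a0 ab bh.
  (* Every other window gets the degenerate interval at 0, since its parameters inside ]0, 1[ are
     mapped outside the set. *)
  rewrite muE (mE _ (fun j => if j == i then sp a else 0) (fun j => if j == i then sm b else 0)).
  + rewrite -[X in _ = X%:E](_ : (if (1 <= i <= N)%N then eta i (sm b) - eta i (sp a) else 0) = _);
      last by rewrite iN.
    rewrite -sum_nat_single; congr EFin; apply: eq_bigr => j _.
    by case: ifPn => [/eqP ->//|_]; rewrite subrr.
  + by [].
  + move=> j _; case: ifPn => _; last by rewrite !lexx ?ler01.
    have [/andP[_ mb1] /andP[pa0 _]] := (proj1 (level_bounds lev bh'), proj2 (level_bounds lev ah)).
    by split=> //; split=> //; exact: ltW.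
  + move=> j u /andP[j1 jN] u01; have /andP[t0 t1] := thb u u01.
    have u01' : 0 <= u <= 1 by have /andP[? ?] := u01; rewrite !ltW.
    have [-> | ji] := eqVneq j i; last first.
      split; first by move=> /andP[h1 h2]; have := lt_trans h1 h2; rewrite ltxx.
      rewrite /= in_itv/= => /andP[H1 H2]; exfalso.
      move: ji; rewrite neq_lt => /orP[ji|ij].
        have := cle _ _ j1 ji; move: H1 H2 t0 t1 a0 bh; clear.
        by move: (i.-1%:R * h) (j.-1%:R * h) => ci cj; lra.
      have := cle _ _ i1 ij; move: H1 H2 t0 t1 a0 bh; clear.
      by move: (i.-1%:R * h) (j.-1%:R * h) => ci cj; lra.
    have [B1 [B2 [B3 B4]]] := between_levels thnd lev ah bh' u01'.
    rewrite /= in_itv/= !ltrD2r; split=> /andP[H1 H2]; apply/andP; split; tauto.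
- move=> i r iN rh; have /andP[i1 iN'] := iN.
  have rh' : 0 <= r <= h by have /andP[? ?] := rh; rewrite !ltW.
  have [[m0 mp p1 tm tp] L] := lev _ rh'.
  rewrite muE (mE _ (fun j => if j == i then sm r else 0) (fun j => if j == i then sp r else 0)).
  + rewrite -[X in _ = X%:E](_ : (if (1 <= i <= N)%N then eta i (sp r) - eta i (sm r) else 0) = _);
      last by rewrite iN.
    rewrite -sum_nat_single; congr EFin; apply: eq_bigr => j _.
    by case: ifPn => [/eqP ->//|_]; rewrite subrr.
  + by [].
  + by move=> j _; case: ifPn => _; rewrite ?lexx ?ler01.
  + move=> j u /andP[j1 jN] u01; have /andP[t0 t1] := thb u u01.
    have u01' : 0 <= u <= 1 by have /andP[? ?] := u01; rewrite !ltW.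
    have /andP[r0 r1] := rh.
    have [-> | ji] := eqVneq j i; last first.
      split; first by move=> /andP[h1 h2]; have := lt_trans h1 h2; rewrite ltxx.
      move=> /= H; exfalso.
      move: ji; rewrite neq_lt => /orP[ji|ij].
        have := cle _ _ j1 ji; move: H t0 t1 r0 r1; clear.
        by move: (i.-1%:R * h) (j.-1%:R * h) => ci cj; lra.
      have := cle _ _ i1 ij; move: H t0 t1 r0 r1; clear.
      by move: (i.-1%:R * h) (j.-1%:R * h) => ci cj; lra.
    split=> [/andP[H1 H2]/=|/= /addIr]; last exact: L.
    have /andP[u0 u1] := u01'.
    have := thnd _ _ m0 (ltW H1) u1; have := thnd _ _ u0 (ltW H2) p1.
    rewrite tm tp => ur ru; congr (_ + _); apply/eqP; by rewrite eq_le ur ru.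
- move=> i iN.
  have [[m0h mph p1h tmh tph] Lh] := lev _ hh; have [[m00 mp0 p10 tm0 tp0] L0] := lev _ h00.
  have sph := level_sph h0 th1 lev; have sm0 := level_sm0 h0 th0 lev.
  (* The grid point ih is occupied twice: at the end of window i, from [sm h] to 1, and at the start
     of window i.+1, from 0 to [sp 0]. *)
  rewrite muE (mE _ (fun j => if j == i then sm h else 0)
    (fun j => if j == i then 1 else if j == i.+1 then sp 0 else 0)).
  + congr EFin; rewrite -!sum_nat_single -big_split/=; apply: eq_bigr => j _.
    case: ifPn => [/eqP ->|_]; first by rewrite ltn_eqF// addr0.
    by rewrite add0r; case: ifPn => [/eqP ->//|_]; rewrite subrr.
  + by [].
  + move=> j _; case: ifPn => _; first by rewrite m0h (le_trans mph).
    by case: ifPn => _; rewrite lexx ?ler01// (le_trans m00 mp0).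
  + move=> j u /andP[j1 jN] u01; have /andP[t0 t1] := thb u u01.
    have u01' : 0 <= u <= 1 by have /andP[? ?] := u01; rewrite !ltW.
    have /andP[u0 u1] := u01.
    have [ji|ji] := eqVneq j i.
      rewrite ji in j1 *; split=> [/andP[H1 _]/=|/= H].
        rewrite -(cN _ j1) addrC; congr (_ + _); apply/eqP; rewrite eq_le t1/=.
        by have := thnd _ _ m0h (ltW H1) (ltW u1); rewrite tmh.
      rewrite (ltW u1) andbT.
      have thu : th u = h.
        have := cN _ j1; move: H; clear; move: (i.-1%:R * h) (i%:R * h) => ci cj; lra.
      by have /andP[] := Lh u u01' thu.
    have [ji1|ji1] := eqVneq j i.+1.
      rewrite ji1 /=; split=> [/andP[_ H2]/=|/= H].
        suff -> : th u = 0 by rewrite add0r.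
        apply/eqP; rewrite eq_le t0 andbT.
        by have := thnd _ _ (ltW u0) (ltW H2) p10; rewrite tp0.
      have thu : th u = 0.
        by move: H; clear; move: (i%:R * h) => ci; lra.
      by have := L0 u u01' thu; rewrite sm0.
    split; first by move=> /andP[h1 h2]; have := lt_trans h1 h2; rewrite ltxx.
    move=> /= H; exfalso.
    have [jlt|jge] := ltnP j i.
      have : j%:R * h + h <= i%:R * h.
        by rewrite -[X in _ + X]mul1r -mulrDl natr1 ler_wpM2r ?(ltW h0)// ler_nat.
      have := cN _ j1; move: H t0 t1 h0; clear.
      by move: (i%:R * h) (j%:R * h) (j.-1%:R * h) => ci cj cj'; lra.
    have ij : (i.+2 <= j)%N.
      by rewrite ltn_neqAle eq_sym ji1/= ltn_neqAle eq_sym ji.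
    have : i%:R * h + h <= j.-1%:R * h.
      rewrite -[X in _ + X]mul1r -mulrDl natr1 ler_wpM2r ?(ltW h0)// ler_nat.
      by rewrite -ltnS prednK.
    move: H t0 t1 h0; clear.
    by move: (i%:R * h) (j.-1%:R * h) => ci cj; lra.
Qed.

(** Jordan decomposition: phi is the difference of the nondecreasing functions phi + G and G. *)
Lemma dominated_bounded_variation (R : realType) (a b : R) (phi G : R -> R) : a < b ->
  (forall s t, a <= s -> s <= t -> t <= b -> `|phi t - phi s| <= G t - G s) ->
  bounded_variation a b phi.
Proof.
move=> ab H.
have mG : {in `[a, b] &, nondecreasing_fun G}.
  move=> s t /[!in_itv]/= /andP[sa _] /andP[_ tb] st.
  by rewrite -subr_ge0 (le_trans _ (H _ _ sa st tb)).
have mGf : {in `[a, b] &, nondecreasing_fun (phi \+ G)}.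
  move=> s t /[!in_itv]/= /andP[sa _] /andP[_ tb] st.
  have := H _ _ sa st tb; rewrite ler_norml => /andP[+ _].
  by rewrite /=; lra.
have -> : phi = (phi \+ G) \+ (\- G) by apply/funext => t /=; rewrite addrK.
apply: bounded_variationD => //; first exact: nondecreasing_bounded_variation.
by apply: bounded_variationN; exact: nondecreasing_bounded_variation.
Qed.

Lemma sum_is_derive (R : realType) (I : eqType) (s : seq I) (phi : I -> R -> R)
    (l : I -> R) (t : R) :
  (forall i, i \in s -> is_derive t (1 : R) (phi i) (l i)) ->
  is_derive t (1 : R) (fun u => \sum_(i <- s) phi i u) (\sum_(i <- s) l i).
Proof.
elim: s => [|i s IH] H.
  rewrite big_nil (_ : (fun u => _) = cst 0)//; first exact: is_derive_cst.
  by apply/funext => u; rewrite big_nil.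
rewrite big_cons (_ : (fun u => _) = phi i \+ (fun u => \sum_(i <- s) phi i u)).
  apply: is_deriveD; first by apply: H; rewrite mem_head.
  by apply: IH => k ks; apply: H; rewrite in_cons ks orbT.
by apply/funext => u; rewrite big_cons.
Qed.

Section backward.
Context (R : realType) (n N : nat) (h T K M : R) (x0 xi0 : 'rV[R]_n)
  (f g : 'rV[R]_n * 'rV[R]_n -> 'rV[R]_n) (S : R) (th sm sp : R -> R)
  (eta : nat -> R -> R) (y : nat -> R -> 'rV[R]_n)
  (mu : {finite_measure set (measurableTypeR R) -> \bar R}).
Local Notation leb := (@lebesgue_measure R).
Hypothesis h0 : 0 < h.
Hypothesis TE : T = N%:R * h.
Hypothesis N0 : (0 < N)%N.
Hypothesis fc : continuous f.
Hypothesis gc : continuous g.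
Hypothesis M0 : 0 <= M.
Hypothesis fM : forall z, `|f z| <= M.
Hypothesis gM : forall z, `|g z| <= M.
Hypothesis arc : space_time_arc N h K M x0 xi0 S th eta y.
Hypothesis dyn : arc_dynamics N f g th eta y.
Hypothesis lev : forall r, 0 <= r <= h ->
  [/\ 0 <= sm r, sm r <= sp r, sp r <= 1, th (sm r) = r & th (sp r) = r] /\
  forall u, 0 <= u <= 1 -> th u = r -> sm r <= u <= sp r.
Hypothesis mu_out : mu (~` `[0, T]%classic) = 0%E.
Hypothesis mu_open : forall i a b, (1 <= i <= N)%N -> 0 <= a -> a < b -> b <= h ->
  mu `]a + i.-1%:R * h, b + i.-1%:R * h[%classic = (eta i (sm b) - eta i (sp a))%:E.
Hypothesis mu_atom : forall i r, (1 <= i <= N)%N -> 0 < r < h ->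
  mu [set r + i.-1%:R * h] = (eta i (sp r) - eta i (sm r))%:E.
Hypothesis mu_grid : forall i, (i <= N)%N -> mu [set i%:R * h] =
  ((if (1 <= i <= N)%N then eta i 1 - eta i (sm h) else 0) +
   (if (1 <= i.+1 <= N)%N then eta i.+1 (sp 0) - eta i.+1 0 else 0))%:E.

Local Notation c i := (i.-1%:R * h).
Local Notation L := (M * S).

Let S0 : 0 < S. Proof. exact: arc_S_gt0 h0 arc. Qed.
Let L0 : 0 <= L. Proof. by rewrite mulr_ge0// ltW. Qed.

Let y_lip i u v : (1 <= i <= N)%N -> 0 <= u -> u <= v -> v <= 1 ->
  `|y i v - y i u| <= L * (v - u).
Proof. by move=> iN u0 uv v1; rewrite -mulrA; apply: (arc_lipschitz M0 arc). Qed.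

Let y_lip0 i u v : (i <= N)%N -> 0 <= u <= 1 -> 0 <= v <= 1 ->
  `|y i v - y i u| <= L * `|v - u|.
Proof.
move=> iN u01 v01; have [i0|i0] := posnP i.
  by rewrite i0 !(sta_y0 arc)// subrr normr0 mulr_ge0.
have iN' : (1 <= i <= N)%N by rewrite i0.
have /andP[u0 u1] := u01; have /andP[v0 v1] := v01.
have [uv|vu] := leP u v; first by rewrite ger0_norm ?subr_ge0// y_lip.
by rewrite -normrN opprB ltr0_norm ?subr_lt0// opprB y_lip// ltW.
Qed.

(* The concatenation of the [y i] is Lipschitz on the total clock [i.-1 + u]. *)
Let y_chain d i u v : (1 <= i)%N -> (i + d <= N)%N -> 0 <= u <= 1 -> 0 <= v <= 1 ->
  (d = 0%N -> u <= v) -> `|y (i + d)%N v - y i u| <= L * (d%:R + v - u).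
Proof.
move=> i1; elim: d v => [|d IH] v.
  rewrite addn0 => iN /andP[u0 u1] /andP[v0 v1] /(_ erefl) uv.
  by rewrite add0r y_lip// i1.
rewrite addnS => dN u01 v01 _; have /andP[u0 u1] := u01; have /andP[v0 v1] := v01.
have dN' : (1 <= i + d < N)%N by rewrite (leq_trans i1 (leq_addr _ _)).
have H1 : `|y (i + d)%N 1 - y i u| <= L * (d%:R + 1 - u).
  by apply: IH => //; [exact: ltnW|rewrite ler01 lexx].
have H2 : `|y (i + d).+1 v - y (i + d).+1 0| <= L * (v - 0) by apply: y_lip.
rewrite (sta_link arc dN') subr0 in H2.
rewrite (_ : _ - _ = (y (i + d).+1 v - y (i + d)%N 1) + (y (i + d)%N 1 - y i u)); last first.
  by rewrite addrA subrK.
rewrite (le_trans (ler_normD _ _))// (le_trans (lerD H2 H1))//.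
by rewrite -mulrDr ler_wpM2l// -natr1; lra.
Qed.

(* The window and the arc parameter at which the trajectory is read at time t:
   the last parameter of the level set of [th]. *)
Definition arc_index (t : R) : nat * R :=
  if t <= 0 then (1%N, 0) else if T <= t then (N, 1)
  else ((Num.truncn (t / h)).+1, sp (t - (Num.truncn (t / h))%:R * h)).

Definition arc_trajectory (t : R) : 'rV[R]_n :=
  if t < 0 then xi0 else y (arc_index t).1 (arc_index t).2.

Local Notation x := arc_trajectory.

Let cS i : (1 <= i)%N -> c i + h = i%:R * h.
Proof. by move=> i1; rewrite -{2}(prednK i1) -natr1 mulrDl mul1r. Qed.

Let c_ge0 i : 0 <= c i. Proof. by rewrite mulr_ge0// ltW. Qed.

Let cS_le i : (1 <= i <= N)%N -> c i + h <= T.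
Proof. by move=> /andP[i1 iN]; rewrite cS// TE ler_wpM2r ?(ltW h0)// ler_nat. Qed.

Let index_at i r : (1 <= i <= N)%N -> 0 <= r -> r < h -> 0 < r + c i ->
  arc_index (r + c i) = (i, sp r).
Proof.
move=> iN r0 rh rc; have /andP[i1 iN'] := iN.
have -> : arc_index (r + c i) =
    ((Num.truncn ((r + c i) / h)).+1, sp (r + c i - (Num.truncn ((r + c i) / h))%:R * h)).
  rewrite /arc_index leNgt rc/= leNgt (_ : _ < T)//.
  by rewrite (lt_le_trans _ (cS_le iN))// addrC ltrD2l.
have -> : Num.truncn ((r + c i) / h) = i.-1.
  apply: truncn_def; rewrite ler_pdivlMr// ltr_pdivrMr// -natr1 mulrDl mul1r.
  by rewrite lerDr r0 addrC ltrD2l.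
by rewrite addrK prednK.
Qed.

Let index_cases t : 0 <= t <= T -> [\/ t = 0, t = T |
  exists i r, [/\ (1 <= i <= N)%N, 0 <= r, r < h, t = r + c i & 0 < r + c i]].
Proof.
move=> /andP[t0 tT]; have [->|tn0] := eqVneq t 0; first by constructor 1.
have [->|tnT] := eqVneq t T; first by constructor 2.
have tp : 0 < t by rewrite lt_neqAle eq_sym tn0.
have ltT : t < T by rewrite lt_neqAle tnT.
constructor 3; have := truncn_itv (divr_ge0 t0 (ltW h0)).
set k := Num.truncn _; rewrite ler_pdivlMr// ltr_pdivrMr// -natr1 mulrDl mul1r => /andP[k1 k2].
exists k.+1, (t - k%:R * h); split => //=.
- rewrite -(ltr_nat R) -(ltr_pM2r h0) -TE; exact: le_lt_trans ltT.
- by rewrite subr_ge0.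
- by rewrite ltrBlDl.
- by rewrite subrK.
- by rewrite subrK.
Qed.

Let h00 : 0 <= (0 : R) <= h. Proof. by rewrite lexx ltW. Qed.
Let hh : 0 <= h <= h. Proof. by rewrite lexx ltW. Qed.
Let sp01 r : 0 <= r <= h -> 0 <= sp r <= 1. Proof. by move=> /(level_bounds lev)[]. Qed.
Let sm01 r : 0 <= r <= h -> 0 <= sm r <= 1. Proof. by move=> /(level_bounds lev)[]. Qed.
Let smsp r : 0 <= r <= h -> sm r <= sp r. Proof. by move=> /lev[[]]. Qed.
Let th_sm r : 0 <= r <= h -> th (sm r) = r. Proof. by move=> /lev[[]]. Qed.
Let th_sp r : 0 <= r <= h -> th (sp r) = r. Proof. by move=> /lev[[]]. Qed.
Let sp_lt_sm a b : 0 <= a -> a < b -> b <= h -> sp a < sm b.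
Proof. exact: (level_lt (sta_th_nd arc) lev). Qed.
Let sm_0 : sm 0 = 0. Proof. exact: level_sm0 h0 (sta_th0 arc) lev. Qed.
Let sp_h : sp h = 1. Proof. exact: level_sph h0 (sta_th1 arc) lev. Qed.

Let index_bounds t : 0 <= t <= T ->
  [/\ (1 <= (arc_index t).1)%N, ((arc_index t).1 <= N)%N & 0 <= (arc_index t).2 <= 1].
Proof.
move=> /index_cases[->|->|[i [r [iN r0 rh -> rc]]]].
- by rewrite /arc_index lexx/= ler01 lexx.
- have T0 : 0 < T by rewrite TE mulr_gt0// ltr0n.
  by rewrite /arc_index leNgt T0/= lexx/= ler01 lexx.
- rewrite index_at//=; have /andP[-> ->] := iN; split=> //.
  by apply: sp01; rewrite r0 ltW.
Qed.

(** The reading position advances in lexicographic order, the order along which [y_chain] controls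
    the state. *)
Let index_mono s t : 0 <= s -> s <= t -> t <= T ->
  ((arc_index s).1 < (arc_index t).1)%N \/
  (arc_index s).1 = (arc_index t).1 /\ (arc_index s).2 <= (arc_index t).2.
Proof.
move=> s0 st tT.
have T0 : 0 < T by rewrite TE mulr_gt0// ltr0n.
have sT : 0 <= s <= T by rewrite s0 (le_trans st).
have tT' : 0 <= t <= T by rewrite tT (le_trans s0).
have [s1 s2 /andP[s3 s4]] := index_bounds sT; have [t1 t2 /andP[t3 t4]] := index_bounds tT'.
have [sE|sE|[i [r [iN r0 rh sE rc]]]] := index_cases sT.
- have -> : arc_index s = (1%N, 0) by rewrite sE /arc_index lexx.
  by rewrite /=; move: t1; rewrite leq_eqVlt => /orP[/eqP <-|]; [right|left].
- suff -> : t = s by right.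
  by apply/eqP; rewrite eq_le st sE tT.
have [tE|tE|[j [q [jN q0 qh tE qc]]]] := index_cases tT'.
- suff -> : t = s by right.
  by apply/eqP; rewrite eq_le st tE s0.
- have tI : arc_index t = (N, 1) by rewrite tE /arc_index leNgt T0/= lexx.
  rewrite tI/= in t3 *; move: s2; rewrite leq_eqVlt => /orP[/eqP ->|]; [right|left] => //.
rewrite sE tE !index_at//=.
have /andP[i1 iN'] := iN; have /andP[j1 jN'] := jN.
have [|ji|ij] := ltngtP i j; first by left.
  exfalso; move: st; rewrite sE tE leNgt => /negP; apply.
  apply: (@lt_le_trans _ _ (c j + h)); first by rewrite addrC ltrD2l.
  rewrite cS// (@le_trans _ _ (c i))// ?lerDr//.
  by rewrite ler_wpM2r ?(ltW h0)// ler_nat -ltnS prednK.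
right; split=> //; move: st; rewrite sE tE ij lerD2r le_eqVlt => /orP[/eqP ->//|rq].
apply: ltW; apply: lt_le_trans (sp_lt_sm r0 rq (ltW qh)) _.
by apply: smsp; rewrite q0 ltW.
Qed.

Let xT : x T = y N 1.
Proof.
have T0 : 0 < T by rewrite TE mulr_gt0// ltr0n.
by rewrite /x ltNge (ltW T0)/= /arc_index leNgt T0/= lexx.
Qed.

Let x0E : x 0 = x0.
Proof. by rewrite /x ltxx /arc_index lexx/= (sta_start arc). Qed.

Let xE i r : (1 <= i <= N)%N -> 0 <= r -> r < h -> 0 < r + c i -> x (r + c i) = y i (sp r).
Proof. by move=> iN r0 rh rc; rewrite /x ltNge (ltW rc)/= index_at. Qed.

Let x_neg t : t < 0 -> x t = xi0. Proof. by rewrite /x => ->. Qed.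

Let x_delay i r : (1 <= i <= N)%N -> 0 < r -> r < h -> x (r + c i - h) = y i.-1 (sp r).
Proof.
move=> iN r0 rh; have rh' : 0 <= r <= h by rewrite !ltW.
have /andP[i1 iN'] := iN.
have [->|i1'] := eqVneq i 1%N.
  by rewrite mul0r addr0 x_neg ?subr_lt0// (sta_y0 arc)// sp01.
have i2 : (1 <= i.-1)%N by rewrite -ltnS prednK// ltn_neqAle eq_sym i1'.
rewrite -(cS i2) addrA addrK xE ?(ltW r0)//.
- by rewrite i2 (leq_trans (leq_pred _)).
- by rewrite ltr_wpDr.
Qed.

Let x_bv : BV_vec (- h) T x.
Proof.
have T0 : 0 < T by rewrite TE mulr_gt0// ltr0n.
(* L times the total clock, preceded by a jump at 0 that pays for the passage from xi0 to x0. *)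
pose G t := if t < 0 then 0 else `|x0 - xi0| + L * ((arc_index t).1.-1%:R + (arc_index t).2).
move=> k; apply: (@dominated_bounded_variation _ _ _ _ G).
  by rewrite (@lt_trans _ _ 0)// oppr_lt0.
move=> s t s0 st tT.
suff H : `|x t - x s| <= G t - G s.
  apply: le_trans H; by have := rV_norm_ge (x t - x s) k; rewrite !mxE.
rewrite /G; have [t0|t0] := ltP t 0.
  by rewrite (le_lt_trans st t0) !x_neg ?subrr ?normr0// (le_lt_trans st).
have tT' : 0 <= t <= T by rewrite t0.
have [t1 t2 t3] := index_bounds tT'.
have chain s' : 0 <= s' -> s' <= t -> `|x t - x s'| <= L * ((arc_index t).1.-1%:R
    + (arc_index t).2 - ((arc_index s').1.-1%:R + (arc_index s').2)).
  move=> s'0 s't; have s'T : 0 <= s' <= T by rewrite s'0 (le_trans s't).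
  have [s1 s2 s3] := index_bounds s'T.
  rewrite /x !ltNge t0 s'0/=.
  have H : ((arc_index s').1 <= (arc_index t).1)%N.
    by have [/ltnW//|[-> _]] := index_mono s'0 s't tT.
  have := @y_chain ((arc_index t).1 - (arc_index s').1)%N _ _ (arc_index t).2 s1 _ s3 t3.
  rewrite subnKC// => /(_ t2) H0; apply: le_trans (H0 _) _.
    move=> D; have [|[_ //]] := index_mono s'0 s't tT.
    by rewrite -subn_gt0 D.
  apply: ler_wpM2l => //.
  rewrite natrB// -(prednK t1) -(prednK s1) -!natr1/=.
  set a := (_.-1)%:R; set b := (_.-1)%:R; lra.
have [s0'|s0'] := ltP s 0; last first.
  by apply: (le_trans (chain s s0' st)); rewrite mulrBr; lra.
rewrite subr0 (x_neg s0').
have := chain 0 (lexx _) t0; rewrite x0E {3 4}/arc_index lexx/= addr0 subr0 => H.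
rewrite (_ : x t - xi0 = (x0 - xi0) + (x t - x0)); last by rewrite [RHS]addrC addrA subrK.
by rewrite (le_trans (ler_normD _ _))// lerD2l.
Qed.

(** Just before r the trajectory is read at the parameter [sp (t - c i)]. It lies between u and
    [sm r] as soon as t - c_i exceeds [th u], for any u < [sm r], and such a u may be taken close to
    [sm r]. *)
Let left_limit i r : (1 <= i <= N)%N -> 0 < r <= h -> left_lim x (r + c i) = y i (sm r).
Proof.
move=> iN rh; have /andP[r0 rh'] := rh; have rh2 : 0 <= r <= h by rewrite ltW.
have /andP[m0 m1] := sm01 rh2.
have mp : 0 < sm r.
  rewrite lt_neqAle m0 andbT; apply/eqP => E; have := th_sm rh2.
  by rewrite -E (sta_th0 arc) => r0'; rewrite -r0' ltxx in r0.
apply: cvg_lim => //; apply/cvgrPdist_le => e e0.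
have L1 : 0 < L + 1 by rewrite ltr_wpDl.
pose u := Num.max (sm r / 2) (sm r - e / (L + 1)).
have eL : 0 < e / (L + 1) by rewrite divr_gt0.
have u0 : 0 < u by rewrite lt_max divr_gt0.
have um : u < sm r by rewrite gt_max ltrBlDr ltrDl eL andbT; lra.
have u01 : 0 <= u <= 1 by rewrite (ltW u0) (le_trans (ltW um)).
have thu : 0 <= th u <= h by exact: (th_bounds (sta_th0 arc) (sta_th1 arc) (sta_th_nd arc)).
have /andP[thu0 thu1] := thu.
have thur : th u < r.
  by have [_ [_ [H _]]] := between_levels (sta_th_nd arc) lev h00 rh2 u01; exact: H.
exists (r - th u); first by rewrite /= subr_gt0.
move=> t /= tb tr.
have rt : r + c i - t < r - th u by rewrite gtr0_norm ?subr_gt0// in tb.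
have [q1 q2] : th u < t - c i /\ t - c i < r by split; lra.
have q0 : 0 < t - c i by exact: le_lt_trans q1.
have qh : 0 <= t - c i <= h by rewrite !ltW// (lt_le_trans q2).
rewrite -[t](subrK (c i)) xE//; last 3 first.
- exact: ltW.
- exact: lt_le_trans rh'.
- by rewrite subrK (lt_le_trans q0)// gerBl.
have /andP[p0 p1] := sp01 qh.
have pm := ltW (sp_lt_sm (ltW q0) q2 rh').
have up : u <= sp (t - c i).
  rewrite leNgt; apply/negP => /ltW /(fun K => sta_th_nd arc p0 K (proj2 (andP u01))).
  by rewrite th_sp// leNgt q1.
rewrite (le_trans (y_lip iN p0 pm m1))//.
apply: (@le_trans _ _ ((L + 1) * (e / (L + 1)))); last by rewrite mulrC divfK// gt_eqF.
apply: ler_pM => //; first by rewrite subr_ge0.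
  by rewrite lerDl.
have : sm r - e / (L + 1) <= u by rewrite le_max lexx orbT.
by move: up; move: (e / (L + 1)) => q; lra.
Qed.

Local Notation jmp i := (fun r => y i (sp r) - y i (sm r)).
Local Notation Ff := (fun t => f (x t, x (t - h))).
Local Notation Fg := (fun t => g (x t, x (t - h))).
Local Notation imp i := (impulse mu (c i) Ff Fg (jmp i)).

Let Fmeas i (F : 'rV[R]_n * 'rV[R]_n -> 'rV[R]_n) : (1 <= i <= N)%N -> continuous F ->
  forall k, measurable_fun (`]c i, c i + h[ : set (measurableTypeR R))
    (fun t : R => F (x t, x (t - h)) ord0 k).
Proof.
move=> iN cF; move: (cS_le iN) (c_ge0 i); move: (c i) => ci ciT ci0.
apply: (delayed_measurable (a := - h) (b := T)) => //.
- by rewrite (lt_le_trans _ ciT)// (@lt_le_trans _ _ 0) ?oppr_lt0// addr_ge0// ltW.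
- by rewrite lerDr.
- by rewrite (@le_trans _ _ 0)// oppr_le0 ltW.
- by rewrite addrK (le_trans _ ciT)// lerDl ltW.
Qed.

Let atomE i r : (1 <= i <= N)%N -> 0 < r < h ->
  fine (mu [set r + c i]) = eta i (sp r) - eta i (sm r).
Proof. by move=> iN rh; rewrite mu_atom. Qed.

Let jmp_bd i : (1 <= i <= N)%N ->
  forall r : R, 0 < r < h -> `|y i (sp r) - y i (sm r)| <= M * fine (mu [set r + c i]).
Proof.
move=> iN r rh; have rh' : 0 <= r <= h by have /andP[? ?] := rh; rewrite !ltW.
rewrite atomE//; have /andP[m0 _] := sm01 rh'; have /andP[_ p1] := sp01 rh'.
apply: le_trans (sta_lip arc iN m0 (smsp rh') p1) _.
by rewrite th_sm// th_sp// subrr add0r.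
Qed.

Let delay_at i r : (1 <= i <= N)%N -> 0 < r -> r < h ->
  (x (r + c i), x (r + c i - h)) = (y i (sp r), y i.-1 (sp r)).
Proof. by move=> iN r0 rh; rewrite x_delay// xE ?(ltW r0)// ltr_wpDr. Qed.

(** The parameters [sp (th p)] and [sm (th q)] lie in [p, q]. Between them the change of y, by
    [dyn], and the impulse, by [impulse_estimate], are both within e times the clock increment of
    one and the same vector; hence the factor 2. *)
Let local_estimate i p q e cf cg : (1 <= i <= N)%N -> 0 <= p -> p <= q -> q <= 1 -> 0 <= e ->
  (forall t, p <= t <= q -> `|f (y i t, y i.-1 t) - cf| <= e /\
                            `|g (y i t, y i.-1 t) - cg| <= e) ->
  th p < th q ->
  `|y i (sm (th q)) - y i (sp (th p)) - imp i (th p) (th q)| <= 2 * e * (S * (q - p)).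
Proof.
move=> iN p0 pq q1 e0 H.
have p01 : 0 <= p <= 1 by rewrite p0 (le_trans pq).
have q01 : 0 <= q <= 1 by rewrite q1 (le_trans p0).
have thb u : 0 <= u <= 1 -> 0 <= th u <= h.
  exact: (th_bounds (sta_th0 arc) (sta_th1 arc) (sta_th_nd arc)).
have /lev[_ /(_ p p01 erefl)/andP[_ pa]] := thb p p01.
have /lev[_ /(_ q q01 erefl)/andP[bq _]] := thb q q01.
have /andP[a0 ah] := thb p p01; have /andP[b0 bh] := thb q q01.
move: (th p) (th q) a0 ah b0 bh pa bq => a b a0 ah b0 bh pa bq ab.
have sab := sp_lt_sm a0 ab bh.
have ah' : 0 <= a <= h by rewrite a0.
have bh' : 0 <= b <= h by rewrite b0.
have /andP[pa0 _] := sp01 ah'; have /andP[_ mb1] := sm01 bh'.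
have H' t : sp a <= t <= sm b -> `|f (y i t, y i.-1 t) - cf| <= e /\
                            `|g (y i t, y i.-1 t) - cg| <= e.
  by move=> /andP[t1 t2]; apply: H; rewrite (le_trans pa t1) (le_trans t2).
have D := dyn iN pa0 (ltW sab) mb1 e0 H'.
have mE : fine (mu `]a + c i, b + c i[%classic) = eta i (sm b) - eta i (sp a).
  by rewrite mu_open.
have I : `|imp i a b - (b - a) *: cf - (eta i (sm b) - eta i (sp a)) *: cg| <=
    e * (b - a + (eta i (sm b) - eta i (sp a))).
  rewrite -mE.
  apply: (@impulse_estimate R n mu (c i) h M _ _ _ M0 (Fmeas iN fc) (Fmeas iN gc)
    (fun t _ => fM _) (fun t _ => gM _) (jmp_bd iN) a b e cf cg a0 (ltW ab) bh e0).
  move=> r /andP[ar rb]; have r0 := le_lt_trans a0 ar; have rh := lt_le_trans rb bh.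
  have rh' : 0 <= r <= h by rewrite !ltW.
  have rh'' : 0 < r < h by rewrite r0.
  have ra := ltW (sp_lt_sm a0 ar (ltW rh)); have rb' := ltW (sp_lt_sm (ltW r0) rb bh).
  have mp := smsp rh'.
  have [Hf Hg] : `|f (y i (sp r), y i.-1 (sp r)) - cf| <= e /\
                            `|g (y i (sp r), y i.-1 (sp r)) - cg| <= e.
    by apply: H'; rewrite rb' (le_trans ra).
  rewrite delay_at//; split=> //.
  have /andP[m0 _] := sm01 rh'; have /andP[_ p1] := sp01 rh'.
  have := @dyn i (sm r) (sp r) cf cg e iN m0 mp p1 e0.
  rewrite th_sm// th_sp// subrr scale0r subr0 add0r atomE//; apply.
  by move=> t /andP[t1 t2]; apply: H'; rewrite (le_trans ra t1) (le_trans t2).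
have incr : b - a + (eta i (sm b) - eta i (sp a)) <= S * (q - p).
  have := arc_increments arc iN pa0 (ltW sab) mb1.
  rewrite th_sm// th_sp// => /le_trans; apply.
  by apply: ler_wpM2l; [exact: ltW|lra].
rewrite th_sm// th_sp// in D.
rewrite (_ : _ - imp i a b = (y i (sm b) - y i (sp a) - (b - a) *: cf
   - (eta i (sm b) - eta i (sp a)) *: cg)
   - (imp i a b - (b - a) *: cf - (eta i (sm b) - eta i (sp a)) *: cg)); last first.
  by apply/rowP => k; rewrite !mxE; ring.
rewrite (le_trans (ler_normB _ _))// (le_trans (lerD D I))//.
by rewrite -mulrDr -mulrA mulrCA ler_wpM2l//; lra.
Qed.

Let y_cont i t e (F : 'rV[R]_n * 'rV[R]_n -> 'rV[R]_n) : continuous F ->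
  (1 <= i <= N)%N -> 0 <= t <= 1 -> 0 < e ->
  exists2 d, 0 < d & forall s, 0 <= s <= 1 -> `|s - t| < d ->
    `|F (y i s, y i.-1 s) - F (y i t, y i.-1 t)| <= e.
Proof.
move=> cF /andP[i1 iN] t01 e0.
have /cvgrPdist_le/(_ e e0) := cF (y i t, y i.-1 t).
move=> /nbhs_ballP[r /= r0 Hr].
have L1 : 0 < L + 1 by rewrite ltr_wpDl.
exists (r / (L + 1)) => [|s s01 st]; first by rewrite divr_gt0.
rewrite distrC; apply: Hr.
have H j : (j <= N)%N -> ball (y j t) r (y j s).
  move=> jN; rewrite -ball_normE/= distrC (le_lt_trans (y_lip0 jN t01 s01))//.
  apply: (@le_lt_trans _ _ ((L + 1) * `|s - t|)).
    by rewrite ler_wpM2r// lerDl.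
  by rewrite mulrC -ltr_pdivlMr.
by split; apply: H => //; rewrite (leq_trans (leq_pred _)).
Qed.

(* The jumps make the estimate additive, so it passes from small intervals to
   [0, 1] with an error proportional to the arbitrary [e]. *)
Let state_identity i b : (1 <= i <= N)%N -> 0 < b < h ->
  y i (sm b) = y i (sp 0) + imp i 0 b.
Proof.
move=> iN /andP[b0 bh].
have bh' : 0 <= b <= h by rewrite !ltW.
have /andP[m0 m1] := sm01 bh'.
have small e : 0 < e -> `|y i (sm b) - y i (sp 0) - imp i 0 b| <= 2 * e * (S * (sm b - 0)).
  move=> e0.
  (* Q is void where th is constant, and such a piece is dropped when intervals are joined.
     Otherwise the jump at [th v] produced by [impulse_split] is exactly the gap between the two
     changes of y. *)
  pose Q u v := th u < th v ->
    `|y i (sm (th v)) - y i (sp (th u)) - imp i (th u) (th v)| <= 2 * e * (S * (v - u)).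
  suff : Q 0 (sm b) by rewrite /Q (sta_th0 arc) th_sm//; apply.
  have mono a d : a <= d -> 2 * e * (S * a) <= 2 * e * (S * d).
    by move=> ad; rewrite !ler_wpM2l// ?mulr_ge0// ltW.
  apply: (cousin m0) => [u v w u0 uv vw wb Quv Qvw|t /andP[t0 tb]].
    have v0 := le_trans u0 uv; have w1 := le_trans wb m1.
    have v1 := le_trans vw w1; have w0 := le_trans v0 vw; have u1 := le_trans uv v1.
    rewrite /Q => uw.
    have thuv := sta_th_nd arc u0 uv v1; have thvw := sta_th_nd arc v0 vw w1.
    have [Euv|uv'] := eqVneq (th u) (th v).
      rewrite Euv; rewrite Euv in uw; apply: le_trans (Qvw uw) _; apply: mono; lra.
    have [Evw|vw'] := eqVneq (th v) (th w).
      rewrite -Evw; rewrite -Evw in uw; apply: le_trans (Quv uw) _; apply: mono; lra.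
    have ltuv : th u < th v by rewrite lt_neqAle uv'.
    have ltvw : th v < th w by rewrite lt_neqAle vw'.
    have thb s : 0 <= s <= 1 -> 0 <= th s <= h.
      exact: (th_bounds (sta_th0 arc) (sta_th1 arc) (sta_th_nd arc)).
    have /andP[a0 _] : 0 <= th u <= h by apply: thb; rewrite u0.
    have /andP[_ dh] : 0 <= th w <= h by apply: thb; rewrite w0.
    have := impulse_split M0 (Fmeas iN fc) (Fmeas iN gc)
      (fun t _ => fM _) (fun t _ => gM _) (jmp_bd iN) a0 ltuv ltvw dh.
    move=> ->; move: (Quv ltuv) (Qvw ltvw) => /=.
    set I1 := imp i _ _; set I2 := imp i _ _ => H1 H2.
    rewrite (_ : _ - _ = (y i (sm (th v)) - y i (sp (th u)) - I1)
       + (y i (sm (th w)) - y i (sp (th v)) - I2)); last first.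
      by apply/rowP => k; rewrite !mxE; ring.
    rewrite (le_trans (ler_normD _ _))// (le_trans (lerD H1 H2))//.
    by rewrite -!mulrDr; apply: mono; lra.
  have t01 : 0 <= t <= 1 by rewrite t0 (le_trans tb).
  have [d1 d10 Hf] := y_cont fc iN t01 e0.
  have [d2 d20 Hg] := y_cont gc iN t01 e0.
  exists (Num.min d1 d2); first by rewrite lt_min d10.
  have loc p q : 0 <= p -> p <= q -> q <= 1 -> t - Num.min d1 d2 < p -> q < t + Num.min d1 d2 ->
      Q p q.
    move=> p0 pq q1 pd qd thpq.
    apply: (local_estimate iN p0 pq q1 (ltW e0)
      (cf := f (y i t, y i.-1 t)) (cg := g (y i t, y i.-1 t))) => // s /andP[ps sq].
    have s01 : 0 <= s <= 1 by rewrite (le_trans p0 ps) (le_trans sq q1).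
    have : `|s - t| < Num.min d1 d2.
      by rewrite ltr_distl (lt_le_trans pd)// (le_lt_trans sq).
    by rewrite lt_min => /andP[sd1 sd2]; split; [exact: Hf|exact: Hg].
  move=> s /andP[s0 sb].
  have dpos : 0 < Num.min d1 d2 by rewrite lt_min d10.
  have /andP[_ t1] := t01.
  split=> /andP[H1 H2]; apply: loc => //; first by rewrite ltrDl.
    exact: le_trans sb m1.
  by rewrite ltrBlDr ltrDl.
suff : y i (sm b) - y i (sp 0) - imp i 0 b = 0.
  by move=> /subr0_eq /eqP; rewrite subr_eq addrC => /eqP.
apply/eqP; rewrite -normr_le0; apply/ler_addgt0Pl => e e0; rewrite addr0.
have S21 : 0 < 2 * (S * (sm b - 0)) + 1.
  by rewrite ltr_wpDl// !mulr_ge0// ?subr0// ltW.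
apply: le_trans (small (e / (2 * (S * (sm b - 0)) + 1)) (divr_gt0 e0 S21)) _.
move: S21; set X := S * _ => S21; set Y := _ + 1 in S21 *.
rewrite (_ : 2 * (e / Y) * X = e * (2 * X) / Y); last by ring.
by rewrite ler_pdivrMr// ler_wpM2l ?(ltW e0)// lerDl.
Qed.

(** The affine parametrisation of the level set of th at r by [0, 1], constant when that set is a
    single point. *)
Let pos r s := sm r + s * (sp r - sm r).

(** For i = 0 the convention of attached families is reproduced, with x0 at the end of the jump at
    h, although [y 0] is xi0 throughout. *)
Definition arc_attached (r : R) (i : nat) (s : R) : 'rV[R]_n :=
  if i == 0%N then (if (s < 1) || (r < h) then xi0 else x0) else y i (pos r s).

Let pos0 r : pos r 0 = sm r. Proof. by rewrite /pos mul0r addr0. Qed.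
Let pos1 r : pos r 1 = sp r. Proof. by rewrite /pos mul1r addrC subrK. Qed.

Let pos_le r s t : 0 <= r <= h -> s <= t -> pos r s <= pos r t.
Proof. by move=> rh st; rewrite lerD2l ler_wpM2r// subr_ge0 smsp. Qed.

Let pos_range r s : 0 <= r <= h -> 0 <= s <= 1 -> sm r <= pos r s <= sp r.
Proof.
move=> rh /andP[s0 s1]; have := pos_le rh s0; have := pos_le rh s1.
by rewrite pos0 pos1 => -> ->.
Qed.

Let pos01 r s : 0 <= r <= h -> 0 <= s <= 1 -> 0 <= pos r s <= 1.
Proof.
move=> rh s01; have /andP[a b] := pos_range rh s01.
have /andP[m0 _] := sm01 rh; have /andP[_ p1] := sp01 rh.
by rewrite (le_trans m0 a) (le_trans b p1).
Qed.

Let th_pos r s : 0 <= r <= h -> 0 <= s <= 1 -> th (pos r s) = r.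
Proof.
move=> rh s01; have /andP[a b] := pos_range rh s01; have /andP[q0 q1] := pos01 rh s01.
have /andP[m0 _] := sm01 rh; have /andP[_ p1] := sp01 rh.
have := sta_th_nd arc m0 a q1; have := sta_th_nd arc q0 b p1.
by rewrite th_sm// th_sp// => A B; apply/eqP; rewrite eq_le A B.
Qed.

Let posB r s t : pos r t - pos r s = (t - s) * (sp r - sm r).
Proof. by rewrite /pos; ring. Qed.

Let eta_lip i u v : (1 <= i <= N)%N -> 0 <= u -> u <= v -> v <= 1 ->
  eta i v - eta i u <= S * (v - u).
Proof.
move=> iN u0 uv v1; apply: le_trans (arc_increments arc iN u0 uv v1).
by rewrite lerDr subr_ge0 (sta_th_nd arc).
Qed.

Let spm1 r : 0 <= r <= h -> 0 <= sp r - sm r <= 1.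
Proof.
move=> rh; have /andP[m0 _] := sm01 rh; have /andP[_ p1] := sp01 rh.
by rewrite subr_ge0 smsp//; lra.
Qed.

(** The mass of window i along the jump at r, whose density will be the control; the clamp makes it
    constant outside [0, 1], as [lipschitz_density] asks. *)
Let phi r i (s : R) := eta i (pos r (clamp01 s)).

Let phi_lip r i s t : 0 <= r <= h -> (1 <= i <= N)%N -> s <= t ->
  0 <= phi r i t - phi r i s <= S * (t - s).
Proof.
move=> rh iN st; have /andP[q0 q1] := pos01 rh (clamp01_itv s).
have /andP[q0' q1'] := pos01 rh (clamp01_itv t).
have ple := pos_le rh (clamp01_le st).
rewrite subr_ge0 (sta_eta_nd arc)//=.
rewrite (le_trans (eta_lip iN q0 ple q1'))// ler_wpM2l ?(ltW S0)// posB.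
have /andP[d0 d1] := spm1 rh.
rewrite -[leRHS]mulr1 ler_pM ?subr_ge0 ?clamp01_le//.
  by rewrite -subr_ge0.
exact: clamp01_lip.
Qed.

Let weight_exists : exists w : R -> nat -> R -> R, forall r i, 0 <= r <= h -> (1 <= i <= N)%N ->
  [/\ measurable_fun (setT : set (measurableTypeR R)) (w r i),
      forall s, 0 <= w r i s,
      (\int[leb]_(s in `[0%R, 1%R]) (w r i s)%:E = (eta i (sp r) - eta i (sm r))%:E)%E &
      {ae leb, forall s : R, 0 <= s <= 1 -> is_derive s (1 : R) (phi r i) (w r i s)}].
Proof.
have /choice[w wP] : forall q : R * nat, exists w : R -> R,
    0 <= q.1 <= h -> (1 <= q.2 <= N)%N ->
  [/\ measurable_fun (setT : set (measurableTypeR R)) w,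
      forall s, 0 <= w s,
      (\int[leb]_(s in `[0%R, 1%R]) (w s)%:E = (eta q.2 (sp q.1) - eta q.2 (sm q.1))%:E)%E &
      {ae leb, forall s : R, 0 <= s <= 1 -> is_derive s (1 : R) (phi q.1 q.2) (w s)}].
  move=> [r i]/=; have [rh|] := boolP (0 <= r <= h); last by exists (cst 0).
  have [iN|] := boolP (1 <= i <= N)%N; last by exists (cst 0).
  have [|||s s1|w [w1 w2 w3 w4]] := @lipschitz_density R S (phi r i).
  - by move=> s t st; have /andP[] := phi_lip rh iN st; rewrite subr_ge0.
  - by move=> s t st; have /andP[] := phi_lip rh iN st.
  - by move=> s s0; rewrite /phi (clamp01_le0 s0) (clamp01_le0 (lexx 0)).
  - by rewrite /phi (clamp01_ge1 s1) (clamp01_ge1 (lexx 1)).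
  exists w => _ _; split=> //.
  by rewrite w3 /phi (clamp01_ge1 (lexx 1)) (clamp01_le0 (lexx 0)) pos0 pos1.
by exists (fun r i => w (r, i)) => r i rh iN; have [] := wP (r, i) rh iN.
Qed.

Section with_weights.
Context (w : R -> nat -> R -> R).
Hypothesis wP : forall r i, 0 <= r <= h -> (1 <= i <= N)%N ->
  [/\ measurable_fun (setT : set (measurableTypeR R)) (w r i),
      forall s, 0 <= w r i s,
      (\int[leb]_(s in `[0%R, 1%R]) (w r i s)%:E = (eta i (sp r) - eta i (sm r))%:E)%E &
      {ae leb, forall s : R, 0 <= s <= 1 -> is_derive s (1 : R) (phi r i) (w r i s)}].

Let attachedE r i s : (1 <= i)%N -> arc_attached r i s = y i (pos r s).
Proof. by case: i. Qed.

Let attached_pred r i s : (1 <= i <= N)%N -> 0 <= r <= h -> 0 <= s < 1 ->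
  arc_attached r i.-1 s = y i.-1 (pos r s).
Proof.
move=> /andP[i1 iN] rh /andP[s0 s1]; rewrite /arc_attached s1/=.
by case: eqP => // ->; rewrite (sta_y0 arc)// pos01// s0 ltW.
Qed.

Let attached_lip r i s t : (1 <= i <= N)%N -> 0 <= r <= h -> 0 <= s -> s <= t -> t <= 1 ->
  `|arc_attached r i t - arc_attached r i s| <= L * (t - s).
Proof.
move=> iN rh s0 st t1; have /andP[i1 _] := iN; rewrite !attachedE//.
have s01 : 0 <= s <= 1 by rewrite s0 (le_trans st).
have t01 : 0 <= t <= 1 by rewrite t1 (le_trans s0).
have /andP[q0 _] := pos01 rh s01; have /andP[_ q1] := pos01 rh t01.
rewrite (le_trans (y_lip iN q0 (pos_le rh st) q1))// ler_wpM2l// posB.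
by have /andP[_ d1] := spm1 rh; rewrite -[leRHS]mulr1 ler_wpM2l// subr_ge0.
Qed.

(** On a level set th does not move, so [dyn] bounds the change of y minus the change of mass times
    G. The derivative of the mass then gives that of y, at each s where the former exists. *)
Let attached_ode (r : R) i (s l : R) : (1 <= i <= N)%N -> 0 <= r <= h -> 0 < s < 1 ->
  is_derive s (1 : R) (phi r i) l ->
  is_derive s (1 : R) (arc_attached r i) (l *: g (arc_attached r i s, arc_attached r i.-1 s)).
Proof.
move=> iN rh /andP[s0 s1] /is_derive1P D; apply/is_derive1P => e e0.
have /andP[i1 _] := iN.
rewrite (attached_pred iN rh) ?(ltW s0)// [in g _]attachedE//.
have s01 : 0 <= s <= 1 by rewrite !ltW.
set p := pos r s; set G := g _.
have p01 : 0 <= p <= 1 by exact: pos01.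
(* Each takes half of e: e1 compensates the Lipschitz constant S of phi, e2 the norm of G, with 1
   added in case G vanishes. *)
pose e1 := e / (2 * S); pose e2 := e / (2 * (`|G| + 1)).
have G1 : 0 < `|G| + 1 by rewrite ltr_wpDl.
have e10 : 0 < e1 by rewrite divr_gt0// mulr_gt0.
have e20 : 0 < e2 by rewrite divr_gt0// mulr_gt0.
have [df df0 Hf] := y_cont fc iN p01 e10.
have [dg dg0 Hg] := y_cont gc iN p01 e10.
have [dd dd0 Hd] := D e2 e20.
have key u v : 0 <= u -> u <= v -> v <= 1 -> s - Num.min df dg < u -> v < s + Num.min df dg ->
    `|arc_attached r i v - arc_attached r i u - (phi r i v - phi r i u) *: G| <= e1 * (S * (v - u)).
  move=> u0 uv v1 ud vd; rewrite !attachedE//.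
  have u01 : 0 <= u <= 1 by rewrite u0 (le_trans uv).
  have v01 : 0 <= v <= 1 by rewrite v1 (le_trans u0).
  rewrite /phi !clamp01_id//.
  have /andP[q0 _] := pos01 rh u01; have /andP[_ q1] := pos01 rh v01.
  have close t : pos r u <= t <= pos r v -> `|f (y i t, y i.-1 t) - f (y i p, y i.-1 p)| <= e1 /\
      `|g (y i t, y i.-1 t) - G| <= e1.
    move=> /andP[t1 t2]; have t01 : 0 <= t <= 1 by rewrite (le_trans q0 t1) (le_trans t2).
    have /andP[c0 c1] := spm1 rh.
    have m0 : 0 < Num.min df dg by rewrite lt_min df0.
    have : `|t - p| < Num.min df dg.
      rewrite ltr_norml; apply/andP; split.
        have : pos r u - p <= t - p by rewrite lerD2r.
        apply: lt_le_trans; rewrite posB.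
        have [us|su] := leP u s; last first.
          by rewrite (@lt_le_trans _ _ 0) ?oppr_lt0// mulr_ge0// subr_ge0 ltW.
        apply: (@lt_le_trans _ _ (u - s)); first lra.
        rewrite -subr_ge0 (_ : _ - _ = (s - u) * (1 - (sp r - sm r))); last by ring.
        by rewrite mulr_ge0// subr_ge0.
      have : t - p <= pos r v - p by rewrite lerD2r.
      move=> /le_lt_trans; apply; rewrite posB.
      have [vs|sv] := leP v s.
        by rewrite (@le_lt_trans _ _ 0)// mulr_le0_ge0// subr_le0.
      apply: (@le_lt_trans _ _ (v - s)); last lra.
      by rewrite -[leRHS]mulr1 ler_wpM2l// subr_ge0 ltW.
    by rewrite lt_min => /andP[d1 d2]; split; [exact: Hf|exact: Hg].
  have := dyn iN q0 (pos_le rh uv) q1 (ltW e10) close.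
  rewrite !th_pos// subrr scale0r subr0 add0r => /le_trans; apply.
  rewrite ler_wpM2l ?(ltW e10)//; have := phi_lip rh iN uv.
  by rewrite /phi !clamp01_id// => /andP[].
exists (Num.min (Num.min df dg) (Num.min dd (Num.min s (1 - s)))).
  by rewrite !lt_min df0 dg0 dd0 s0 subr_gt0.
move=> t; rewrite lt_min => /andP[t1]; rewrite lt_min => /andP[/Hd t2].
rewrite lt_min => /andP[t3 t4].
have t0 : 0 <= t by move: t3; rewrite ltr_norml => /andP[? ?]; lra.
have t01 : t <= 1 by move: t4; rewrite ltr_norml => /andP[? ?]; lra.
have K1 : `|arc_attached r i t - arc_attached r i s - (phi r i t - phi r i s) *: G|
    <= e1 * (S * `|t - s|).
  have m0 : 0 < Num.min df dg by rewrite lt_min df0.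
  move: t1; rewrite ltr_distl => /andP[t11 t12].
  have [ts|st] := leP t s; last first.
    by rewrite gtr0_norm ?subr_gt0//; apply: key; rewrite ?(ltW s0) ?(ltW st)// ltrBlDr ltrDl.
  rewrite [X in S * X]distrC ger0_norm ?subr_ge0//; have := key t s t0 ts (ltW s1) t11.
  rewrite ltrDl => /(_ m0); apply: le_trans.
  rewrite -[leLHS]normrN le_eqVlt; apply/orP; left; apply/eqP; congr (`|_|).
  by apply/rowP => k; rewrite !mxE; ring.
rewrite (_ : _ - _ = (arc_attached r i t - arc_attached r i s - (phi r i t - phi r i s) *: G)
   + (phi r i t - phi r i s - (t - s) * l) *: G); last first.
  by apply/rowP => k; rewrite !mxE; ring.
rewrite (le_trans (ler_normD _ _))// normrZ.
have K2 : `|phi r i t - phi r i s - (t - s) * l| * `|G| <= e2 * `|t - s| * (`|G| + 1).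
  by rewrite ler_pM// lerDl.
rewrite (le_trans (lerD K1 K2))// le_eqVlt; apply/orP; left; apply/eqP.
rewrite /e1 /e2; move: (`|t - s|) G1 => q; move: (`|G|) => q' G1.
by field; rewrite !gt_eqF.
Qed.

Let attached : attached_family N h x0 xi0 g x w arc_attached.
Proof.
split.
- by move=> r s rh s01; rewrite /arc_attached.
- by move=> r i rh iN; apply: (@lipschitz_ac _ _ _ _ L) => s t *; exact: attached_lip.
- move=> r i rh iN; have [_ _ _ D] := wP rh iN.
  have F : Filter (almost_everywhere leb) by exact: (ae_filter_ringOfSetsType leb).
  apply: filterS3 D (ae_neq 0) (ae_neq 1) => s H s0 s1 /[dup] s01 /H.
  apply: attached_ode => //; have /andP[? ?] := s01.
  by rewrite lt_neqAle eq_sym s0/= lt_neqAle s1.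
- move=> r i rh iN; have /andP[i1 _] := iN.
  by rewrite attachedE// pos0 left_limit.
- move=> i iN; have /andP[i1 iN'] := iN; rewrite attachedE// pos0 sm_0.
  rewrite /arc_attached ltxx ltxx/= pos1 sp_h.
  case: eqP => [|/eqP i0]; first by case: i iN i1 iN' => // -[]// *; rewrite (sta_start arc).
  by rewrite -(sta_link arc) prednK ?i1 ?lt0n ?i0.
Qed.

Let control : impulsive_control N h T mu w.
Proof.
have F : Filter (almost_everywhere leb) by exact: (ae_filter_ringOfSetsType leb).
split.
- exact: mu_out.
- by move=> r i rh iN; have [m _ _ _] := wP rh iN; exact: measurable_funS m.
- by move=> r i s rh iN _; have [_ + _ _] := wP rh iN.
- move=> r rh.
  have intE : (\sum_(1 <= i < N.+1) \int[leb]_(s' in `[0%R, 1%R]) (w r i s')%:E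
      = (S * (sp r - sm r))%:E)%E.
    rewrite big_nat (eq_bigr (fun i => (eta i (sp r) - eta i (sm r))%:E)).
      rewrite -big_nat sumEFin sumrB mulrBr -!(sta_sum arc) ?sp01 ?sm01// th_sm// th_sp//.
      by congr EFin; ring.
    by move=> i iN; have [] := wP rh iN.
  have D : {ae leb, forall s : R, forall i, (1 <= i <= N)%N -> 0 <= s <= 1 ->
      is_derive s (1 : R) (phi r i) (w r i s)}.
    apply: ae_foralln => i; have [iN|iN] := boolP (1 <= i <= N)%N; last by apply: aeW.
    by have [_ _ _ D] := wP rh iN; apply: filterS D => s H _.
  apply: filterS2 D (ae_neq 1) => s Hs s1 s01; rewrite intE; congr EFin.
  have /andP[s0' s1'] := s01; have slt : s < 1 by rewrite lt_neqAle s1.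
  have : is_derive s (1 : R) (fun u => \sum_(1 <= i < N.+1) phi r i u)
      (\sum_(1 <= i < N.+1) w r i s).
    by apply: sum_is_derive => i; rewrite mem_index_iota => iN; exact: Hs.
  (* Since th equals r along the level set, the clock identity makes the total mass affine in the
     parameter. The sum of the derivatives is its slope [S * (sp r - sm r)]. *)
  have phiE u : 0 <= u <= 1 -> \sum_(1 <= i < N.+1) phi r i u = S * pos r u - r.
    move=> u01; have := sta_sum arc (pos01 rh u01); rewrite th_pos// => <-.
    by rewrite addrC addKr; apply: eq_bigr => i _; rewrite /phi clamp01_id.
  move=> /is_derive1P H; apply/eqP; rewrite eq_sym -subr_eq0 -normr_le0.
  apply/ler_addgt0Pl => e e0; rewrite addr0.
  have [d d0 Hd] := H e e0.
  (* One difference quotient determines the slope of an affine function; q is small enough for the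
     derivative bound and keeps s + q in [0, 1]. *)
  pose q := Num.min d (1 - s) / 2.
  have m0 : 0 < Num.min d (1 - s) by rewrite lt_min d0 subr_gt0.
  have q0 : 0 < q by rewrite divr_gt0.
  have qm : q < Num.min d (1 - s) by rewrite /q; lra.
  have /andP[qd qs] : (q < d) && (q < 1 - s) by rewrite -lt_min.
  have sq01 : 0 <= s + q <= 1 by apply/andP; split; lra.
  have := Hd (s + q); rewrite [s + q - s]addrC addrA addNr add0r (gtr0_norm q0) => /(_ qd).
  rewrite !phiE// (_ : S * pos r (s + q) - r - (S * pos r s - r) = q * (S * (sp r - sm r))).
    by rewrite -mulrBr normrM (gtr0_norm q0) mulrC ler_pM2r.
  by rewrite /pos; ring.
- move=> r i rh iN; rewrite mu_atom//; have rh' : 0 <= r <= h.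
    by have /andP[? ?] := rh; rewrite !ltW.
  by have [] := wP rh' iN.
- move=> i iN; rewrite mu_grid//.
  have pm r k : 0 <= r <= h -> measurable_fun (`[0, 1] : set (measurableTypeR R)) (pad N w r k).
    move=> rh; have [kN|/negbTE kN] := boolP (1 <= k <= N)%N; last first.
      by rewrite (_ : pad N w r k = cst 0)//; apply/funext => s; rewrite /pad kN.
    rewrite (_ : pad N w r k = w r k); last by apply/funext => s; rewrite /pad kN.
    by have [m _ _ _] := wP rh kN; exact: measurable_funS m.
  have p0 r k s : 0 <= r <= h -> 0 <= pad N w r k s.
    by move=> rh; rewrite /pad; case: ifPn => // kN; have [] := wP rh kN.
  have pI r k : 0 <= r <= h -> (\int[leb]_(s in `[0%R, 1%R]) (pad N w r k s)%:E
      = (if (1 <= k <= N)%N then eta k (sp r) - eta k (sm r) else 0)%:E)%E.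
    move=> rh; rewrite /pad.
    have [kN|kN] := boolP (1 <= k <= N)%N; last by rewrite integral0.
    by have [] := wP rh kN.
  under eq_integral do rewrite EFinD.
  rewrite ge0_integralD//=.
  + by rewrite !pI// sp_h sm_0 EFinD.
  + by move=> s _; rewrite lee_fin p0.
  + by apply/measurable_EFinP; exact: pm.
  + by move=> s _; rewrite lee_fin p0.
  + by apply/measurable_EFinP; exact: pm.
Qed.

Lemma arc_extended_process : extended_process N h T x0 xi0 f g x mu w.
Proof.
split.
- exact: x_bv.
- exact: control.
- by move=> t /andP[_ t0]; exact: x_neg.
exists arc_attached; first exact: attached.
split.
- move=> i iN; have /andP[i1 _] := iN; rewrite attachedE// pos1.
  case: eqP => [->|/eqP i1']; first by rewrite mul0r x0E.
  rewrite -[c i]add0r xE// add0r mulr_gt0// ltr0n -ltnS prednK//.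
  by rewrite ltn_neqAle eq_sym i1'.
- move=> i t iN /andP[t1 t2]; have /andP[i1 _] := iN; rewrite attachedE// pos1.
  pose b := t - c i; have tE : t = b + c i by rewrite subrK.
  have b0 : 0 < b by rewrite subr_gt0.
  have bh : b < h by rewrite ltrBlDl cS.
  have bh' : 0 < b < h by rewrite b0.
  rewrite -/b tE xE ?(ltW b0)//; last by rewrite ltr_wpDr.
  have E := impulse_closed M0 (Fmeas iN fc) (Fmeas iN gc)
    (fun t _ => fM _) (fun t _ => gM _) (jmp_bd iN) b0 bh.
  rewrite (@eq_unordered_sum _ _ _ _ (jmp i)); last first.
    move=> r /=; rewrite in_itv/= => /andP[r0 rb].
    by rewrite attachedE// pos1 left_limit// r0 (le_trans rb (ltW bh)).
  rewrite -2!addrA [X in _ + X]addrA.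
  by rewrite E addrA -state_identity// addrC subrK.
- by rewrite xT attachedE// pos1 sp_h.
Qed.

End with_weights.

Lemma arc_process : exists w, extended_process N h T x0 xi0 f g x mu w.
Proof. by have [w wP] := weight_exists; exists w; exact: arc_extended_process. Qed.

Lemma arc_trajectory_end : x T = y N 1. Proof. exact: xT. Qed.

End backward.

Lemma C1_continuous (R : realType) (U V : normedModType R) (F : U -> V) :
  C1 F -> continuous F.
Proof. by move=> [dF _] z; exact: differentiable_continuous. Qed.

Lemma bounded_fun_bound (R : realType) (U V : normedModType R) (F : U -> V) :
  bounded_fun F -> exists2 M : R, 0 <= M & forall z, `|F z| <= M.
Proof.
move=> [M [_ HM]]; exists (`|M| + 1); first by rewrite addr_ge0.
by move=> z; apply: (HM (`|M| + 1)) => //; rewrite (le_lt_trans (ler_norm M))// ltrDl.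
Qed.

Lemma arc_admissible (R : realType) (n N : nat) (h T K M : R) (x0 xi0 : 'rV[R]_n)
    (f g : 'rV[R]_n * 'rV[R]_n -> 'rV[R]_n) (target : set 'rV[R]_n)
    (S : R) (th : R -> R) (eta : nat -> R -> R) (y : nat -> R -> 'rV[R]_n) :
  0 < h -> (0 < N)%N -> T = N%:R * h -> continuous f -> continuous g -> 0 <= M ->
  (forall z, `|f z| <= M) -> (forall z, `|g z| <= M) ->
  space_time_arc N h K M x0 xi0 S th eta y -> arc_dynamics N f g th eta y ->
  target (y N 1) ->
  exists x mu w, admissible N h T x0 xi0 f g K target x mu w /\ x T = y N 1.
Proof.
move=> h0 N0 TE fc gc M0 fM gM arc dyn tgt.
have S0 := arc_S_gt0 h0 arc.
have thlip u v : 0 <= u -> u <= v -> v <= 1 -> th v - th u <= S * (v - u).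
  move=> u0 uv v1; have iN : (1 <= 1 <= N)%N by [].
  apply: le_trans (arc_increments arc iN u0 uv v1).
  by rewrite lerDl subr_ge0 (sta_eta_nd arc).
have /choice[lv lvP] : forall r, exists p : R * R, 0 <= r <= h ->
    [/\ 0 <= p.1, p.1 <= p.2, p.2 <= 1, th p.1 = r & th p.2 = r] /\
    forall u, 0 <= u <= 1 -> th u = r -> p.1 <= u <= p.2.
  move=> r; have [rh|] := boolP (0 <= r <= h); last by exists (0, 0).
  have [p pP] := level_set (ltW S0) (sta_th0 arc) (sta_th1 arc) (sta_th_nd arc) thlip rh.
  by exists p.
pose sm r := (lv r).1; pose sp r := (lv r).2.
have etalip i u v : (1 <= i <= N)%N -> 0 <= u -> u <= v -> v <= 1 ->
    eta i v - eta i u <= S * (v - u).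
  move=> iN u0 uv v1; apply: le_trans (arc_increments arc iN u0 uv v1).
  by rewrite lerDr subr_ge0 (sta_th_nd arc).
have [mu [mu1 mu2 mu3 mu4 mu5]] := @arc_measure R N h T S th sm sp eta h0 TE (ltW S0)
  (sta_th0 arc) (sta_th1 arc) (sta_th_nd arc) lvP (sta_eta0 arc) (sta_eta_nd arc) etalip.
have [w wP] := @arc_process R n N h T K M x0 xi0 f g S th sm sp eta y mu h0 TE N0 fc gc M0 fM gM
  arc dyn lvP mu1 mu3 mu4 mu5.
exists (arc_trajectory N h T xi0 sp y), mu, w.
have xT := @arc_trajectory_end R n N h T xi0 sp y h0 TE N0.
split=> //; split=> //; first by rewrite xT.
(* At the end of the clock, h plus the total mass equals S, so [S <= h + K] is the bound on the
   total variation. *)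
have S1 := sta_sum arc (u := 1); rewrite ler01 lexx (sta_th1 arc) mulr1 in S1.
rewrite /total_var mu2 lee_fin; have := S1 isT; have /andP[_ SK] := sta_S arc.
lra.
Qed.

Theorem theorem5p1 (R : realType) (n N : nat) (h T K : R)
    (x0 xi0 : 'rV[R]_n) (f g : 'rV[R]_n * 'rV[R]_n -> 'rV[R]_n)
    (target : set 'rV[R]_n) (Psi : 'rV[R]_n -> R) :
  0 < h -> 0 < T -> (0 < N)%N -> T = N%:R * h ->
  C1 f -> bounded_fun f -> C1 g -> bounded_fun g ->
  0 < K -> target !=set0 -> closed target ->
  lower_semicontinuous (fun y => (Psi y)%:E) ->
  (exists x mu w, admissible N h T x0 xi0 f g K target x mu w) ->
  exists x mu w,
    admissible N h T x0 xi0 f g K target x mu w /\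
    forall x' mu' w',
      admissible N h T x0 xi0 f g K target x' mu' w' -> Psi (x T) <= Psi (x' T).
Proof.
move=> h0 T0 N0 TE /C1_continuous fc /bounded_fun_bound[Mf Mf0 fM]
  /C1_continuous gc /bounded_fun_bound[Mg Mg0 gM] K0 _ tgtc lsc [xa [mua [wa adma]]].
(* One bound for both fields, because arcs weigh elapsed time and mass with the same M. *)
pose M := Num.max Mf Mg.
have M0 : 0 <= M by rewrite le_max Mf0.
have fM' z : `|f z| <= M by rewrite le_max fM.
have gM' z : `|g z| <= M by rewrite le_max gM orbT.
(* Every admissible process has an arc with the same final state, so the minimum over arcs is a
   lower bound for the cost of processes. *)
have arc_of x mu w : admissible N h T x0 xi0 f g K target x mu w ->
    exists S th eta y, (space_time_arc N h K M x0 xi0 S th eta y /\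
      arc_dynamics N f g th eta y /\ target (y N 1)) /\ y N 1 = x T.
  move=> [[bv ic hist [zeta af [st1 st2 st3]]] tgt var].
  have var' : fine (mu `[0, T]%classic) <= K.
    by rewrite -lee_fin fineK// fin_num_measure.
  have [S [th [eta [y [sta dyn yT]]]]] :=
    process_arc h0 TE fc gc M0 fM' gM' bv ic hist af st2 st3 var' N0.
  by exists S, th, eta, y; split=> //; split=> //; split=> //; rewrite yT.
have [S [th [eta [y [[sta [dyn tgt]] minimal]]]]] :
  exists S th eta y, (space_time_arc N h K M x0 xi0 S th eta y /\
      arc_dynamics N f g th eta y /\ target (y N 1)) /\
    forall S' th' eta' y', space_time_arc N h K M x0 xi0 S' th' eta' y' /\
      arc_dynamics N f g th' eta' y' /\ target (y' N 1) -> Psi (y N 1) <= Psi (y' N 1).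
  apply: (arc_minimum h0 M0 N0 fc gc tgtc lsc).
  by have [S [th [eta [y [H _]]]]] := arc_of _ _ _ adma; exists S, th, eta, y.
have [x [mu [w [adm xT]]]] := arc_admissible h0 N0 TE fc gc M0 fM' gM' sta dyn tgt.
exists x, mu, w; split=> // x' mu' w' /arc_of[S' [th' [eta' [y' [H <-]]]]].
by rewrite xT; exact: minimal H.
Qed.
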